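(* Let $q$ be a prime power, $1 \leq j \leq n$, $A = \mathbb{F}_q^n$, $B = \mathbb{F}_q^j$, $G = \mathrm{GL}(A) \cong \mathrm{GL}_n(q)$, $S = \mathrm{GL}(B) \cong \mathrm{GL}_j(q)$, and $V = A \otimes_{\mathbb{F}_q} B$. Let $\tau$ be the character of $\mathrm{GL}(V)$ given by $\tau(x) = q^{\dim_{\mathbb{F}_q}\mathrm{Ker}(x-1_V)}$, viewed as a character of $G \times S$ via the natural action on $V$, and decompose $\tau|_{G\times S} = \sum_{\alpha \in \mathrm{Irr}(S)} D_\alpha \otimes \alpha$ where each $D_\alpha$ is $0$ or a character of $G$. Then: (i) If $\mathfrak{l}^*(\alpha) < 2j-n$ and $D_\alpha \neq 0$, then all irreducible constituents of $D_\alpha$ have true level smaller than $j$. (ii) If $\mathfrak{l}^*(\alpha) \geq 2j-n$, there is a unique $D^\circ_\alpha \in \mathrm{Irr}(G)$ of true level $j$ such that $D_\alpha - D^\circ_\alpha$ is either zero or a sum of irreducible characters of $G$ of true level less than $j$. (iii) The map $\alpha \mapsto D^\circ_\alpha$ is a bijection from $\{\alpha \in \mathrm{Irr}(\mathrm{GL}_j(q)) : \mathfrak{l}^*(\alpha) \geq 2j-n\}$ onto $\{\theta \in \mathrm{Irr}(\mathrm{GL}_n(q)) : \mathfrak{l}^*(\theta) = j\}$. (iv) If $\chi \in \mathrm{Irr}(G)$ has $\mathfrak{l}(\chi) \leq \sqrt{(8n-17)/12}-1/2$, then $|\chi(g)| < 1.76\,\chi(1)^{1-1/n}$ for all $g \in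 G \setminus \mathbf{Z}(G)$. If $\mathfrak{l}(\chi) \leq (\sqrt{12n-59}-1)/6$, then $|\chi(g)| < 1.76\,\chi(1)^{\max(1-1/(2\mathfrak{l}(\chi)),\, \delta(g)/n)}$ for all $g \in G$ (where for $\mathfrak{l}(\chi)=0$ the exponent is read as $\delta(g)/n$). (v) The statements in (iv) also hold with $G$ replaced by $\mathrm{SL}_n(q)$ (and $\mathbf{Z}(G)$ by $\mathbf{Z}(\mathrm{SL}_n(q))$).
   Context: For $\mathrm{GL}_m(q)$ with natural module $W=\mathbb{F}_q^m$, let $\tau_m(g) = q^{\dim \mathrm{Ker}(g-1_W)}$ (the permutation character on vectors of $W$). For $\chi \in \mathrm{Irr}(\mathrm{GL}_m(q))$, the true level $\mathfrak{l}^*(\chi)$ is the least $k\ge0$ with $\chi$ a constituent of $\tau_m^k$; the level $\mathfrak{l}(\chi)$ is the least $k$ with $\lambda\chi$ a constituent of $\tau_m^k$ for some linear character $\lambda$. For $\psi \in \mathrm{Irr}(\mathrm{SL}_m(q))$, $\mathfrak{l}(\psi)$ is $\mathfrak{l}(\chi)$ for any $\chi\in\mathrm{Irr}(\mathrm{GL}_m(q))$ lying over $\psi$. For $g \in \mathrm{GL}(A)$, $\delta(g)$ denotes the largest dimension of an eigenspace of $g$ acting on $A \otimes_{\mathbb{F}_q} \overline{\mathbb{F}}_q$. *)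

(* Defs.v *)
From HB Require Import structures.
From mathcomp Require Import all_boot all_order all_algebra all_fingroup all_solvable all_field all_character.
From Stdlib Require Import ClassicalEpsilon.
Set Implicit Arguments. Unset Strict Implicit. Unset Printing Implicit Defensive.
Import Order.TTheory GRing.Theory Num.Theory.
Local Open Scope ring_scope.

Section Defs.
Variable F : finFieldType.
Local Notation q := #|F|.
Local Notation GL m := (GLgroup_group m F).

(* tau_m(g) = q ^ dim Ker(g - 1) on the natural module W = F^m of GL_m(q). *)
Definition tau_nat (m : nat) (g : {'GL_m[F]}) : algC :=
  (q ^ \rank (kermx (GLval g - 1%:M)))%:R.

(* multiplicity <tau_m^k, chi> of chi in tau_m^k *)
Definition tau_mult (m k : nat) (chi : 'CF(GL m)) : algC :=
  #|GL m|%:R^-1 * \sum_(g in (GL m)) tau_nat g ^+ k * (chi g)^*.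

Definition tconst (m : nat) (chi : 'CF(GL m)) (k : nat) : bool :=
  tau_mult k chi != 0.

(* true level: least k with chi a constituent of tau_m^k (0 if none exists) *)
Definition true_level (m : nat) (chi : 'CF(GL m)) : nat :=
  match excluded_middle_informative (exists k, tconst chi k) with
  | left H => ex_minn H
  | right _ => 0%N
  end.

(* level: least k such that lambda*chi is a constituent of tau_m^k for some
   linear character lambda *)
Definition lconst (m : nat) (chi : 'CF(GL m)) (k : nat) : bool :=
  [exists i : Iirr (GL m), ('chi_i \is a linear_char) && tconst ('chi_i * chi) k].

Definition level (m : nat) (chi : 'CF(GL m)) : nat :=
  match excluded_middle_informative (exists k, lconst chi k) with
  | left H => ex_minn H
  | right _ => 0%N
  end.

(* tau on G x S where G = GL_n, S = GL_j, acting on V = A (x) B, identified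
   with n x j matrices: (g, s) acts by X |-> g^T X s (row-vector convention,
   so v (x) w ~ v^T w maps to (v g) (x) (w s)). *)
Definition tensor_act (n j : nat) (g : {'GL_n[F]}) (s : {'GL_j[F]}) :=
  lin_mx (fun X : 'M[F]_(n.-1.+1, j.-1.+1) => (GLval g)^T *m X *m GLval s).

Definition tau_tens (n j : nat) (g : {'GL_n[F]}) (s : {'GL_j[F]}) : algC :=
  (q ^ \rank (kermx (tensor_act g s - 1%:M)))%:R.

(* D_alpha = sum_chi <tau, chi (x) alpha>_{G x S} chi *)
Definition Dalpha (n j : nat) (a : Iirr (GL j)) : 'CF(GL n) :=
  \sum_(i : Iirr (GL n))
     ((#|GL n| * #|GL j|)%:R^-1 *
      \sum_(g in (GL n)) \sum_(s in (GL j))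
         tau_tens g s * ('chi_i g)^* * ('chi_a s)^*) *: 'chi_i.

(* The property "D_alpha^circ = chi_i" of part (ii). *)
Definition Dcirc_prop (n j : nat) (a : Iirr (GL j)) (i : Iirr (GL n)) : Prop :=
  true_level 'chi_i = j /\
  (Dalpha n a - 'chi_i = 0 \/
   (Dalpha n a - 'chi_i \is a character /\
    forall k, k \in irr_constt (Dalpha n a - 'chi_i) -> (true_level 'chi_k < j)%N)).

(* SL_n(q) *)
Definition SLset (n : nat) := [set g : {'GL_n[F]} | \det (GLval g) == 1].

Lemma SL_group_set (n : nat) : group_set (SLset n).
Proof.
apply/group_setP; split; first by rewrite inE GL_1E det1.
by move=> x y; rewrite !inE GL_MxE det_mulmx => /eqP -> /eqP ->; rewrite mulr1.
Qed.

Canonical SLgroup (n : nat) := Group (SL_group_set n).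

(* delta(g): largest dimension of an eigenspace of g over the algebraic closure;
   computed in the splitting field L of the characteristic polynomial of g
   (which contains all eigenvalues of g). *)
Definition char_poly_neq0 (m : nat) (g : {'GL_m[F]}) : char_poly (GLval g) != 0 :=
  monic_neq0 (char_poly_monic (GLval g)).

Definition delta (m : nat) (g : {'GL_m[F]}) : nat :=
  let L := sval (FinSplittingFieldFor (char_poly_neq0 g)) in
  \max_(lam : finvect_type L)
     \rank (kermx (map_mx (in_alg L) (GLval g) - (lam : L)%:M)).

End Defs.

(* real power x^r of a positive real x, r rational: (den r)-th root, then num r power *)
Definition rpow (x : algC) (r : rat) : algC :=
  ((`|denq r|%N).-root x) ^ (numq r).

Arguments Dalpha {F} n {j} a.
Arguments Dcirc_prop {F} n {j} a i.

(* Main.v *)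
Require Import Defs.
From HB Require Import structures.
From mathcomp Require Import all_boot all_order all_algebra all_fingroup all_solvable all_field all_character.
From mathcomp Require Import ring lra zify.
Set Implicit Arguments. Unset Strict Implicit. Unset Printing Implicit Defensive.
Import Order.TTheory GRing.Theory Num.Theory.
Local Open Scope ring_scope.
Local Arguments GLval {n R} u%_g : simpl never.

(* Let GL_n x GL_j act on n x j matrices.  If chi does not occur in tau^(j-1), then for fixed X the sum
   of chi(g) over g^T X = Y is a "top" function of Y: it vanishes on matrices of rank less than j,
   and its sum over Y + F^n w is 0 for each row w <> 0.  By Moebius inversion over subspaces, the sum
   of a top function over an orbit of a stabiliser in GL_n is a right convolution with a function
   on GL_j.  So the commutant of GL_n on top functions is the group algebra of GL_j, and the
   multiplicities of chi (x) alpha in tau, for these chi, are the entries of a partial permutation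
   matrix.  An explicit top function built from alpha shows that alpha is matched if
   l*(alpha) >= 2j - n; for alpha of smaller level the multiplicity vanishes.

   For 2j <= n the average of the explicit function over conjugates of g is a multiple of chi(g),
   which gives |chi(g)| / chi(1) <= Pr(g^T preserves the column space of X) + 1/(q^(n-j) - 1), with X
   random of rank j.  If g^T X = X H, then either H is a scalar l and the columns of X lie in the
   l-eigenspace, or X satisfies one of few linear conditions; elementary estimates give (iv).

   For 2l < n the stabiliser in GL_n of an n x 2l matrix contains elements of every determinant, so
   tau^(2l) has the same average over SL_n and GL_n.  Hence so has its summand |chi|^2 if chi has
   level l; thus chi restricts irreducibly to SL_n, and (v) follows from (iv). *)

(** * Character sums over a finite group *)

(** The sum of [chi] over a subgroup is its order times the dimension of the fixed vectors, and the
    multiplicity of [chi] in [tau ^ k] adds up such sums over fixators of matrices. So if [chi] is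
    absent from [tau ^ (j - 1)], the fixator of a matrix of rank below [j] fixes no vector, and sums
    over its cosets vanish too. The obstacle is that GL_n has many orbits on pairs of n x j
    matrices, one for each row space of [X Y], while only the pairs Y = X t should count. Top
    functions see nothing else: a linear condition on Y given X either sums to zero or pins Y down
    to X t. The resulting coefficients do not depend on [chi], so projecting onto one character acts
    on all top characters as one element of the group algebra of GL_j; hence injectivity.
    Multiplicity one comes from evaluating a sum of products of traces in two ways. The thresholds
    in (iv) are 3l^2+3l+5 <= 2n and 3l^2+l+5 <= n. Under the first, the ratio times q^l is at most
    1.4 + 1/8; under the second, a square is at most 9/8 * 2.3 + 9/32 < 1.76^2, and l = 1 uses n >=
    9 in full. *)

Section FullGroup.
Variables (gT : finGroupType) (G : {group gT}).
Hypothesis GT : forall x, x \in G.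

Lemma sum_in_full (R : nmodType) (f : gT -> R) : \sum_(x in G) f x = \sum_x f x.
Proof. by apply: eq_bigl => x; rewrite GT. Qed.

Lemma card_group_neq0 : #|G|%:R != 0 :> algC.
Proof. by rewrite pnatr_eq0 -lt0n cardG_gt0. Qed.

Definition chi1 (i : Iirr G) : algC := 'chi_i 1%g.

Lemma chi1_gt0 i : 0 < chi1 i. Proof. exact: irr1_gt0. Qed.

Lemma chi1_neq0 i : chi1 i != 0. Proof. exact: irr1_neq0. Qed.

Lemma exists_cfun (f : gT -> algC) :
  (forall x y, f (x ^ y)%g = f x) -> exists phi : 'CF(G), forall x, phi x = f x.
Proof.
move=> fJ; have P : is_class_fun <<G>>%g (finfun f).
  by rewrite genGid; apply: intro_class_fun => [x y _ _ | x]; rewrite ?fJ ?GT.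
by exists (Cfun 0 P) => x; rewrite cfunE.
Qed.

Lemma cfun_swap (phi : 'CF(G)) x y : phi (x * y)%g = phi (y * x)%g.
Proof. by rewrite -(cfunJ phi (x * y)%g (GT x)) conjgE !mulgA mulVg mul1g. Qed.

Lemma cfdot_full (phi psi : 'CF(G)) :
  '[phi, psi] = #|G|%:R^-1 * \sum_x phi x * (psi x)^*.
Proof. by rewrite cfdotE sum_in_full. Qed.

Lemma sum_irr_conv (i k : Iirr G) y :
  \sum_x 'chi_i (x * y)%g * 'chi_k x^-1%g = (i == k)%:R * (#|G|%:R / chi1 i) * 'chi_i y.
Proof.
have := generalized_orthogonality_relation y i k; rewrite sum_in_full.
move/(canRL (mulKf (invr_neq0 card_group_neq0))); rewrite invrK => ->.
by rewrite mulrCA -!mulrA [_^-1 * _]mulrC.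
Qed.

Lemma sum_irr_conv_cfun (i : Iirr G) (f : 'CF(G)) y :
  \sum_x 'chi_i x * f (x^-1 * y)%g = #|G|%:R * '[f, 'chi_i] / chi1 i * 'chi_i y.
Proof.
rewrite {1}[f]cfun_sum_cfdot (reindex_inj invg_inj) /=.
under eq_bigr do rewrite invgK sum_cfunE mulr_sumr.
rewrite exchange_big (bigD1 i) //= [X in _ + X]big1 ?addr0 => [|k ki].
  under eq_bigr do rewrite cfunE mulrCA [X in _ * X]mulrC.
  rewrite -mulr_sumr sum_irr_conv eqxx mul1r; move: '[_, _] => c.
  by rewrite !mulrA [c * _]mulrC.
under eq_bigr do rewrite cfunE mulrCA [X in _ * X]mulrC.
by rewrite -mulr_sumr sum_irr_conv (negPf ki) !mul0r mulr0.
Qed.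

(** The sum of the conjugates of [g] is central, so it acts on the representation by the scalar |G|
    chi_i(g) / chi_i(1). The proof reads this off from the expansion of the left side, a class
    function of [g], in irreducible characters. *)
Lemma irr_conj_sum (i : Iirr G) (g z : gT) :
  \sum_x 'chi_i ((g ^ x) * z)%g = #|G|%:R / chi1 i * 'chi_i z * 'chi_i g.
Proof.
have [|phi phiE] := @exists_cfun (fun g => \sum_x 'chi_i ((g ^ x) * z)%g).
  move=> x y; rewrite (reindex_inj (mulgI y^-1%g)) /=.
  by apply: eq_bigr => w _; rewrite -conjgM mulKVg.
rewrite -phiE {1}[phi]cfun_sum_cfdot sum_cfunE.
have D k : '[phi, 'chi_k] = (i == k)%:R * (#|G|%:R / chi1 i) * 'chi_i z.
  rewrite cfdot_full.
  under eq_bigr do rewrite phiE mulr_suml.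
  rewrite exchange_big /=; under eq_bigr => x _.
    rewrite (reindex_inj (conjg_inj x^-1%g)) /=.
    under eq_bigr do rewrite conjgKV cfunJ ?GT // -char_inv ?irr_char //.
    rewrite sum_irr_conv; over.
  by rewrite -sum_in_full sumr_const -(mulr_natl (_ * _)) mulKf ?card_group_neq0.
rewrite (bigD1 i) //= big1 ?addr0 ?cfunE ?D ?eqxx ?mul1r // => k ki.
by rewrite cfunE D eq_sym (negPf ki) !mul0r.
Qed.

Lemma sum_irr_conv2 (i k : Iirr G) (f : gT -> algC) u :
  \sum_x \sum_y 'chi_i x^-1%g * 'chi_k y^-1%g * f (x * (u * y))%g
   = (k == i)%:R * (#|G|%:R / chi1 k) * \sum_y 'chi_k (u * y^-1)%g * f y.
Proof.
transitivity (\sum_x \sum_y 'chi_k (x * (u * y^-1))%g * 'chi_i x^-1%g * f y).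
  apply: eq_bigr => x _; rewrite (reindex_inj (mulgI (x * u)^-1%g)).
  apply: eq_bigr => y _; rewrite [(x * (u * _))%g]mulgA mulKVg invMg invgK.
  by rewrite cfun_swap -mulgA [_ * 'chi_i _]mulrC.
rewrite exchange_big mulr_sumr; apply: eq_bigr => y _ /=.
by rewrite -mulr_suml sum_irr_conv; ring.
Qed.

Lemma sum_irr_comb (m : Iirr G -> algC) k y :
  \sum_x 'chi_k x^-1%g * \sum_i m i * 'chi_i (x * y)%g = #|G|%:R / chi1 k * m k * 'chi_k y.
Proof.
under eq_bigr do rewrite mulr_sumr.
rewrite exchange_big (bigD1 k) //= [X in _ + X]big1 ?addr0 => [|b ba].
  under eq_bigr do rewrite mulrCA ['chi_k _ * _]mulrC.
  rewrite -mulr_sumr sum_irr_conv eqxx mul1r; ring.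
under eq_bigr do rewrite mulrCA ['chi_k _ * _]mulrC.
by rewrite -mulr_sumr sum_irr_conv (negPf ba) !mul0r mulr0.
Qed.

Lemma sum_irr_comb1 (m : Iirr G -> algC) k :
  \sum_x 'chi_k x^-1%g * \sum_i m i * 'chi_i x = #|G|%:R * m k.
Proof.
have := sum_irr_comb m k 1%g; rewrite mulrAC divfK ?chi1_neq0 // => <-.
by apply: eq_bigr => x _; rewrite mulg1.
Qed.

Lemma sum_irr_mulV (i : Iirr G) A B :
  \sum_g (A * 'chi_i g^-1%g) * (B * 'chi_i g) = A * B * #|G|%:R.
Proof.
have := sum_irr_conv_cfun i 'chi_i 1%g.
under eq_bigr do rewrite mulg1.
rewrite cfnorm_irr mulr1 (divfK (chi1_neq0 i)) => <-; rewrite mulr_sumr.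
by apply: eq_bigr => g _; ring.
Qed.

Lemma sum_irr_conv_conj (i : Iirr G) y :
  \sum_x 'chi_i (y * x)%g * ('chi_i x)^* = #|G|%:R / chi1 i * 'chi_i y.
Proof.
have := sum_irr_conv i i y; rewrite eqxx mul1r => <-.
by apply: eq_bigr => x _; rewrite cfun_swap irr_inv.
Qed.

Lemma sum_chi1_irr x : \sum_i chi1 i * 'chi[G]_i x = #|G|%:R *+ (x == 1%g).
Proof.
have := cfRegE G x; rewrite cfReg_sum sum_cfunE => <-.
by apply: eq_bigr => i _; rewrite cfunE.
Qed.

(** The averaging idempotent of [H] has trace 0 in the representation, hence is 0, and so is its
    product with [x]. In terms of characters: the squared norm of the function of [x] on the left is
    a multiple of the sum of chi_i over quotients of elements of [H]. *)
Lemma irr_coset_vanish (H : {group gT}) (i : Iirr G) x :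
  \sum_(h in H) 'chi_i h = 0 -> \sum_(h in H) 'chi_i (h * x)%g = 0.
Proof.
move=> H0; pose f y := \sum_(h in H) 'chi_i (h * y)%g.
have E : \sum_y `|f y| ^+ 2 = 0.
  under eq_bigr do rewrite normCK /f rmorph_sum mulr_suml.
  rewrite exchange_big /=; under eq_bigr => h hH.
    under eq_bigr do rewrite mulr_sumr.
    rewrite exchange_big /=; under eq_bigr => h' h'H.
      rewrite (reindex_inj (mulgI h'^-1%g)) /=.
      under eq_bigr do rewrite mulKVg mulgA cfun_swap -char_inv ?irr_char //.
      rewrite sum_irr_conv; over.
    rewrite -mulr_sumr (reindex_inj invg_inj) /=.
    under eq_bigr do rewrite invgK.
    under eq_bigl do rewrite groupV.
    rewrite (_ : \sum_(j in H) _ = 0) ?mulr0; first over.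
    rewrite (reindex_inj (mulgI h^-1%g)) /=.
    under eq_bigl => z do rewrite groupMl ?groupV //.
    by under eq_bigr do rewrite mulKVg.
  by rewrite big1.
have /allP/(_ x (mem_index_enum x)) : all (fun y => `|f y| ^+ 2 == 0) (index_enum gT).
  move/eqP: E; rewrite psumr_eq0 // => y _; exact: exprn_ge0.
by rewrite expf_eq0 /= normr_eq0 => /eqP.
Qed.

Lemma sum_char_ge0 (H : {group gT}) (i : Iirr G) : 0 <= \sum_(h in H) 'chi_i h.
Proof.
have sHG : H \subset G by apply/subsetP => h _; exact: GT.
have : '['Res[H] 'chi_i, 1] \is a Num.nat.
  by rewrite Cnat_cfdot_char ?cfRes_char ?irr_char ?cfun1_char.
move/natr_ge0; rewrite cfdotE pmulr_rge0 ?invr_gt0 ?ltr0n ?cardG_gt0 //.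
by congr (_ <= _); apply: eq_bigr => h hH; rewrite cfResE // cfun1E hH conjC1 mulr1.
Qed.

Lemma sum_irr_inv (P : pred gT) (i : Iirr G) :
  \sum_(g | P g) 'chi_i g = (\sum_(g | P g^-1%g) 'chi_i g)^*.
Proof.
by rewrite rmorph_sum (reindex_inj invg_inj) /=; apply: eq_bigr => g _; rewrite irr_inv.
Qed.

Lemma sum_mul_conj_irr (f : gT -> algC) (i : Iirr G) :
  \sum_g f g * ('chi_i g)^* = \sum_g f g^-1%g * 'chi_i g.
Proof.
by rewrite (reindex_inj invg_inj); apply: eq_bigr => g _; rewrite irr_inv conjCK.
Qed.

End FullGroup.

(** * Linear groups acting on matrices *)

Section Counting.
Variable F : finFieldType.
Local Notation q := #|F|.

Lemma card_submx k p m (A : 'M[F]_(p, m)) :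
  #|[set Z : 'M[F]_(k, m) | (Z <= A)%MS]| = (q ^ (k * \rank A))%N.
Proof.
have inj : injective (fun X : 'M[F]_(k, \rank A) => X *m row_base A).
  by apply/row_free_inj/row_base_free.
rewrite -card_mx -(card_imset _ inj); apply: eq_card => Z; rewrite inE -(eq_row_base A).
apply/submxP/imsetP => [[D ->] | [D _ ->]]; exists D => //.
Qed.

Lemma card_annihilated k m (A : 'M[F]_m) :
  #|[set Z : 'M[F]_(m, k) | A *m Z == 0]| = (q ^ (k * \rank (kermx A)))%N.
Proof.
rewrite mxrank_ker -(mxrank_tr A) -mxrank_ker -card_submx -(card_imset _ trmx_inj).
apply: eq_card => Z; rewrite inE sub_kermx -trmx_eq0 trmx_mul trmxK.
apply/imsetP/idP => [[Y] | /eqP YZ]; first by rewrite inE => /eqP YE ->; rewrite trmxK YE.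
by exists Z^T; rewrite ?trmxK // inE YZ.
Qed.

Lemma card_field_gt1 : (1 < q)%N.
Proof. exact: finNzRing_gt1. Qed.

End Counting.

Section NaturalModule.
Variables (F : finFieldType) (n : nat).
Local Notation q := #|F|.
Local Notation N := n.-1.+1.
Local Notation G := (GLgroup_group n F).

Lemma GLT x : x \in G. Proof. exact: in_setT. Qed.

Lemma GLval_unit (g : {'GL_n[F]}) : GLval g \in unitmx.
Proof. exact: GL_unit. Qed.

Lemma GLvalM (g h : {'GL_n[F]}) : GLval g *m GLval h = GLval (g * h)%g.
Proof. by rewrite GL_MxE. Qed.

Lemma GLval_trM (g h : {'GL_n[F]}) : (GLval g)^T *m (GLval h)^T = (GLval (h * g)%g)^T.
Proof. by rewrite GL_MxE trmx_mul. Qed.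

Lemma GLval1 : GLval (1%g : {'GL_n[F]}) = 1%:M.
Proof. by rewrite GL_1E. Qed.

Lemma exists_GL (A : 'M[F]_N) : A \in unitmx -> {g : {'GL_n[F]} | GLval g = A}.
Proof. by move=> uA; exists (@FinRing.Unit _ A uA). Qed.

Lemma tau_natE k (g : {'GL_n[F]}) :
  tau_nat g ^+ k = #|[set Z : 'M[F]_(k, N) | Z *m GLval g == Z]|%:R.
Proof.
rewrite /tau_nat -natrX -expnM mulnC -card_submx; congr (_%:R); apply: eq_card => Z.
by rewrite !inE sub_kermx mulmxBr mulmx1 subr_eq0.
Qed.

Lemma card_fixed_trmx k (A : 'M[F]_N) :
  #|[set Z : 'M[F]_(N, k) | A *m Z == Z]| = (q ^ (k * \rank (kermx (A - 1%:M))))%N.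
Proof.
rewrite -card_annihilated; apply: eq_card => Z.
by rewrite !inE mulmxBl mul1mx subr_eq0.
Qed.

Lemma tau_natE_trmx k (g : {'GL_n[F]}) :
  tau_nat g ^+ k = #|[set Z : 'M[F]_(N, k) | (GLval g)^T *m Z == Z]|%:R.
Proof.
rewrite card_fixed_trmx /tau_nat -natrX -expnM mulnC !mxrank_ker.
by rewrite -(mxrank_tr (GLval g - _)) linearB /= trmx1.
Qed.

Lemma conj_tau_nat (g : {'GL_n[F]}) : (tau_nat g)^* = tau_nat g.
Proof. exact: conjC_nat. Qed.

Lemma tau_natV (g : {'GL_n[F]}) : tau_nat g^-1%g = tau_nat g.
Proof.
rewrite -[LHS]expr1 -[RHS]expr1 !tau_natE; congr (_%:R); apply: eq_card => Z.
rewrite !inE GL_VxE; apply/eqP/eqP => H.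
  by rewrite -{1}H mulmxKV ?GLval_unit.
by rewrite -{1}H mulmxK ?GLval_unit.
Qed.

Lemma tau_multE k (i : Iirr G) :
  tau_mult k 'chi_i = (#|G|%:R^-1 * \sum_g tau_nat g ^+ k * 'chi_i g)^*.
Proof.
rewrite /tau_mult sum_in_full; last exact: GLT.
rewrite rmorphM rmorph_sum fmorphV rmorph_nat; congr (_ * _); apply: eq_bigr => g _.
by rewrite rmorphM rmorphXn /= conj_tau_nat.
Qed.

Section Fixators.
(** Two actions satisfy the hypotheses below: the natural one and its contragredient. Treating both
    at once yields vanishing sums for conditions on g Z and on g^T Z. *)
Variable a : {'GL_n[F]} -> 'M[F]_N.
Hypothesis aM : forall g h, a (g * h)%g = a g *m a h.
Hypothesis aU : forall g, a g \in unitmx.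
Hypothesis a_fix : forall g k, #|[set Z : 'M[F]_(N, k) | a g *m Z == Z]|%:R = tau_nat g ^+ k :> algC.

Definition fixator k (Z : 'M[F]_(N, k)) := [set g | a g *m Z == Z].

Lemma fixator_group_set k (Z : 'M[F]_(N, k)) : group_set (fixator Z).
Proof.
apply/group_setP; split=> [|x y]; rewrite !inE.
  have : a 1%g *m a 1%g = a 1%g *m 1%:M by rewrite -aM mulmx1 mulg1.
  by move/(can_inj (mulKmx (aU _))) => ->; rewrite mul1mx.
by move=> /eqP xZ /eqP yZ; rewrite aM -mulmxA yZ xZ.
Qed.
Canonical fixator_group k (Z : 'M[F]_(N, k)) := Group (fixator_group_set Z).

Lemma sum_tau_fixator k (i : Iirr G) :
  \sum_g tau_nat g ^+ k * 'chi_i g = \sum_(Z : 'M[F]_(N, k)) \sum_(g in fixator Z) 'chi_i g.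
Proof.
under eq_bigr => g _ do rewrite -a_fix -sum1_card natr_sum mulr_suml.
rewrite (exchange_big_dep xpredT) //=; apply: eq_bigr => Z _.
by apply: eq_big => [g | g _]; rewrite ?inE // mul1r.
Qed.

(** Multiplicity 0 in [tau ^ k] writes 0 as a sum of nonnegative fixator sums, one for each N x k
    matrix, so each is 0. A matrix [Z] of rank at most [k] has the fixator of some N x k matrix [Z0]
    with the same column space, and the condition on [g] defines a coset of that fixator or the
    empty set. *)
Lemma fixator_vanish k m (i : Iirr G) (Z Z' : 'M[F]_(N, m)) :
  tau_mult k 'chi_i = 0 -> (\rank Z <= k)%N -> \sum_(g | a g *m Z == Z') 'chi_i g = 0.
Proof.
rewrite tau_multE => /eqP; rewrite conjC_eq0 mulf_eq0 invr_eq0 (negPf (card_group_neq0 _)) /=.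
rewrite sum_tau_fixator psumr_eq0 => [/allP Zs rk | Y _]; last first.
  exact: sum_char_ge0 GLT _ _.
pose Z0 := ((pid_mx (\rank Z^T) : 'M_(k, _)) *m row_base Z^T)^T.
have ZZ0 g : (a g *m Z == Z) = (a g *m Z0 == Z0).
  have fixE p (Y : 'M_(N, p)) : (a g *m Y == Y) = (Y^T <= kermx (a g - 1%:M)^T)%MS.
    by rewrite sub_kermx -trmx_mul trmx_eq0 mulmxBl mul1mx subr_eq0.
  rewrite !fixE trmxK -[in LHS](eq_row_base Z^T) (eqmxMfull (row_base Z^T)) //.
  by rewrite /row_full rank_pid_mx // mxrank_tr.
case: (pickP (fun g => a g *m Z == Z')) => [g0 /eqP g0Z | no]; last exact: big_pred0.
rewrite (reindex_inj (mulgI g0)) /=.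
have E g : (a (g0 * g)%g *m Z == Z') = (a g *m Z0 == Z0).
  by rewrite aM -mulmxA -{1}g0Z (inj_eq (can_inj (mulKmx (aU _)))) ZZ0.
under eq_bigl do rewrite E.
under eq_bigr do rewrite (cfun_swap GLT).
have := Zs Z0; rewrite mem_index_enum => /(_ isT) /eqP /(irr_coset_vanish GLT g0) E0.
by apply: (etrans _ E0); apply: eq_bigl => g; rewrite inE.
Qed.

End Fixators.
End NaturalModule.

Section Vanishing.
Variables (F : finFieldType) (n k : nat).
Local Notation N := n.-1.+1.
Local Notation G := (GLgroup_group n F).
Variables (m : nat) (i : Iirr G) (Z Z' : 'M[F]_(N, m)).
Hypotheses (chi_k : tau_mult k 'chi_i = 0) (rkZ : (\rank Z <= k)%N).

Lemma vanish_left : \sum_(g | GLval g *m Z == Z') 'chi_i g = 0.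
Proof.
apply: (fixator_vanish (a := fun g => GLval g) _ _ _ _ chi_k rkZ) => [g h | g | g l].
- exact: GL_MxE.
- exact: GLval_unit.
by rewrite card_fixed_trmx /tau_nat -natrX -expnM mulnC.
Qed.

Lemma vanish_trmx : \sum_(g | (GLval g)^T *m Z == Z') 'chi_i g = 0.
Proof.
(* Transposition reverses products, so the contragredient is used and the result is carried back by
   inverting [g], which conjugates the sum. *)
pose a (g : {'GL_n[F]}) := (GLval g^-1%g)^T.
have V : \sum_(g | a g *m Z == Z') 'chi_i g = 0.
  apply: (fixator_vanish _ _ _ _ chi_k rkZ) => [g h | g | g l].
  - by rewrite /a -trmx_mul invMg GL_MxE.
  - by rewrite unitmx_tr GLval_unit.
  by rewrite -tau_natE_trmx tau_natV.
by rewrite sum_irr_inv V conjC0.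
Qed.
End Vanishing.

(** * Top functions *)

Section TopFunctions.
Variables (F : finFieldType).
Local Notation q := #|F|.

(* The second condition says that [p] is orthogonal to every function of [Y *m K] with [K]
   singular; these functions come from the permutation module of [tau ^ (J - 1)]. *)
Definition top_fun N J (p : 'M[F]_(N, J) -> algC) :=
  (forall Y, (\rank Y < J)%N -> p Y = 0) /\
  (forall Y (w : 'rV_J), w != 0 -> \sum_(v : 'cV_N) p (Y + v *m w) = 0).

(* Moebius inversion over the subspace lattice. *)
Lemma subspace_ind (A : Type) k (W : 'M[F]_k -> A -> algC) (Q : (A -> algC) -> Prop) :
    Q (fun=> 0) -> (forall f g, Q f -> Q g -> Q (fun a => f a - g a)) ->
    (forall f g, f =1 g -> Q f -> Q g) ->
    (forall U : 'M_k, Q (fun a => \sum_(V : 'M_k | (V <= U)%MS && (<<V>>%MS == V)) W V a)) ->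
  forall U : 'M_k, Q (W <<U>>%MS).
Proof.
move=> Q0 QB Qext Qsum U; have [r leUr] := ubnP (\rank U); elim: r => // r IHr in U leUr *.
pose lower a := \sum_(V : 'M_k | [&& (V <= U)%MS, <<V>>%MS == V & V != <<U>>%MS]) W V a.
have Ql : Q lower.
  pose P V := [&& (V <= U)%MS, <<V>>%MS == V & V != <<U>>%MS].
  have Qs (s : seq 'M_k) : Q (fun a => - \sum_(V <- s | P V) W V a).
    elim: s => [|V s IHs]; first by apply: Qext Q0 => a; rewrite big_nil oppr0.
    case PV: (P V); last by apply: Qext IHs => a; rewrite big_cons PV.
    apply: Qext (QB _ _ IHs (_ : Q (W V))) => [a|]; first by rewrite big_cons PV opprD addrC.
    case/and3P: PV => VU /eqP eV nVU; rewrite -eV; apply: IHr; apply: (@leq_trans (\rank U)) leUr.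
    apply: rank_ltmx; rewrite ltmxE VU /=; apply: contraNN nVU => UV.
    by rewrite -eV; apply/eqP/eq_genmx/eqmxP; rewrite VU.
  by apply: Qext (QB _ _ Q0 (Qs (index_enum _))) => a; rewrite sub0r opprK.
apply: Qext (QB _ _ (Qsum U) Ql) => a.
rewrite (bigD1 <<U>>%MS) ?genmxE ?submx_refl ?genmx_id ?eqxx //=.
rewrite [X in _ + X - _](_ : _ = lower a) ?addrK //.
by apply: eq_bigl => V; rewrite andbA.
Qed.

(** With [K1] above [K2] the cokernel of [U], the condition on [Y] reads X K1 + Y K2 = 0. If w K2 =
    0 for some row w <> 0, the solutions are stable under adding v w, and the second property of a
    top function applies. If the rows of [K2] are not all combinations of those of [K1], every
    solution has rank below [J], and the first applies. Otherwise K2 = M K1. *)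
Lemma top_sum_sub N i J (U : 'M[F]_(i + J)) :
  (forall (p : 'M_(N, J) -> algC) X, top_fun p -> \sum_(Y | (row_mx X Y <= U)%MS) p Y = 0) \/
  (exists (M : 'M_(J, i)) (K : 'M_(i, i + J)), [/\ \rank M = J, (J <= \rank K)%N &
     forall (X : 'M_(N, i)) Y, (row_mx X Y <= U)%MS = ((X + Y *m M) *m K == 0)]).
Proof.
pose K1 := usubmx (cokermx U); pose K2 := dsubmx (cokermx U).
have KE (X : 'M_(N, i)) (Y : 'M_(N, J)) : (row_mx X Y <= U)%MS = (X *m K1 + Y *m K2 == 0).
  by rewrite submxE -[cokermx U]vsubmxK mul_row_col.
have [K2J|] := leqP J (\rank K2); last first.
  move=> K2J; left=> p X [_ psum].
  have /rowV0Pn[w /sub_kermxP wK w0] : kermx K2 != 0.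
    by rewrite kermx_eq0 /row_free neq_ltn K2J.
  have E : #|{: 'cV[F]_N}|%:R * \sum_(Y | (row_mx X Y <= U)%MS) p Y = 0.
    rewrite mulr_natl -sumr_const.
    under eq_bigr => v _.
      rewrite (reindex_inj (addIr (v *m w))) /=.
      under eq_bigl do rewrite KE mulmxDl -mulmxA wK mulmx0 addr0.
      over.
    by rewrite exchange_big big1 //= => Y _; apply: psum.
  move/eqP: E; rewrite mulf_eq0 pnatr_eq0 card_mx muln1 expn_eq0.
  by rewrite gtn_eqF ?(ltnW (card_field_gt1 F)) //= => /eqP.
have [/submxP[M MK]|] := boolP (K2 <= K1)%MS; last first.
  rewrite submxE => /eqP; left=> p X [p0 _]; apply: big1 => Y; rewrite KE => /eqP XY.
  apply: p0; rewrite ltnNge; apply/negP => JY.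
  have freeY : row_free Y^T by rewrite /row_free mxrank_tr eqn_leq JY rank_leq_col.
  have : Y *m (K2 *m cokermx K1) = 0.
    rewrite mulmxA -[Y *m K2](addKr (X *m K1)) XY addr0 mulNmx -mulmxA mulmx_coker.
    by rewrite mulmx0 oppr0.
  move/(congr1 trmx); rewrite trmx_mul trmx0 -(mul0mx _ Y^T) => /(row_free_inj freeY).
  by rewrite -trmx0 => /trmx_inj.
right; exists M, K1.
have JK1 : (J <= \rank K1)%N by rewrite (leq_trans K2J) // MK mxrankM_maxr.
split=> // [|X Y]; last by rewrite KE MK mulmxDl mulmxA.
by apply/eqP; rewrite eqn_leq rank_leq_row (leq_trans K2J) // MK mxrankM_maxl.
Qed.

Definition row_space_sum N i J (U : 'M[F]_(i + J)) (a : ('M[F]_(N, J) -> algC) * 'M[F]_(N, i)) :=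
  \sum_(Y | <<row_mx a.2 Y>>%MS == U) a.1 Y.

Lemma row_space_sumE N i J (U : 'M[F]_(i + J)) (a : ('M[F]_(N, J) -> algC) * 'M[F]_(N, i)) :
  \sum_(V : 'M_(i + J) | (V <= U)%MS && (<<V>>%MS == V)) row_space_sum V a
   = \sum_(Y | (row_mx a.2 Y <= U)%MS) a.1 Y.
Proof.
rewrite [RHS](partition_big (fun Y => <<row_mx a.2 Y>>%MS)
          (fun V => (V <= U)%MS && (<<V>>%MS == V))) => [|Y YU]; last first.
  by rewrite genmxE YU genmx_id eqxx.
apply: eq_bigr => V /andP[VU _]; apply: eq_bigl => Y; apply/idP/andP => [/eqP e | [_ //]].
by rewrite e eqxx -(genmxE (row_mx _ _)) e.
Qed.

(* The width of [X] is too small for [row_mx X Y] to determine [Y] when [Y] has rank [J]. *)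
Lemma top_row_space_vanish N i J r (U : 'M[F]_(r, i + J)) p (X : 'M[F]_(N, i)) :
  (i < J)%N -> top_fun p -> \sum_(Y | <<row_mx X Y>>%MS == <<U>>%MS) p Y = 0.
Proof.
move=> iJ ptop.
have := @subspace_ind _ _ (@row_space_sum N i J) (fun f => forall a, top_fun a.1 -> f a = 0).
move=> /(_ _ _ _ _ <<U>>%MS (p, X) ptop); rewrite genmx_id; apply=> // [f g f0 g0 a ta | f g fg f0 a ta | V a ta].
- by rewrite f0 // g0 // subr0.
- by rewrite -fg f0.
rewrite row_space_sumE; case: (top_sum_sub N V) => [-> // | [M [K [rM _ _]]]].
by have := rank_leq_col M; rewrite rM leqNgt iJ.
Qed.

(** When both blocks have the same width, [M] is invertible and [K] has independent rows, so the
    only solution is Y = X t with t = - M^-1. Combinations of the values p (X t) are stable under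
    differences, as Moebius inversion requires, and [c] depends on [U] alone. *)
Lemma top_row_space_sum j N r (U : 'M[F]_(r, j.-1.+1 + j.-1.+1)) :
  exists c : {'GL_j[F]} -> algC, forall (p : 'M_(N, j.-1.+1) -> algC) X, top_fun p ->
    \sum_(Y | <<row_mx X Y>>%MS == <<U>>%MS) p Y = \sum_t c t * p (X *m GLval t).
Proof.
pose Q (f : ('M[F]_(N, j.-1.+1) -> algC) * 'M[F]_(N, j.-1.+1) -> algC) :=
  exists c : {'GL_j[F]} -> algC,
    forall a, top_fun a.1 -> f a = \sum_t c t * a.1 (a.2 *m GLval t).
suff: Q (row_space_sum <<U>>%MS) by case=> c Hc; exists c => p X tp; exact: (Hc (p, X) tp).
rewrite -[<<U>>%MS]genmx_id; apply: subspace_ind => [|f g [c Hc] [d Hd]|f g fg [c Hc]|V].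
- by exists (fun=> 0) => a _; rewrite big1 // => t _; rewrite mul0r.
- exists (fun t => c t - d t) => a ta; rewrite Hc // Hd // -sumrB.
  by apply: eq_bigr => t _; rewrite mulrBl.
- by exists c => a ta; rewrite -fg Hc.
case: (top_sum_sub N V) => [V0 | [M [K [rM rK MK]]]].
  exists (fun=> 0) => a ta; rewrite row_space_sumE V0 // big1 // => t _; exact: mul0r.
have uM : M \in unitmx by rewrite -row_full_unit /row_full rM.
have uM' : - invmx M \in unitmx by rewrite -scaleN1r unitmxZ ?unitmx_inv // unitrN1.
have [t tM] := exists_GL uM'.
exists (fun s => (s == t)%:R) => a ta.
rewrite row_space_sumE (bigD1 t) //= eqxx mul1r [X in _ = _ + X]big1 ?addr0; last first.
  by move=> s /negPf->; rewrite mul0r.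
rewrite (big_pred1 (a.2 *m GLval t)) // => Y; rewrite MK /=.
have fK : row_free K by rewrite /row_free eqn_leq rank_leq_row.
rewrite -(mul0mx _ K) (inj_eq (row_free_inj fK)) addr_eq0 tM.
by apply/eqP/eqP => ->; rewrite mulmxN mulNmx opprK (mulmxK, mulmxKV).
Qed.
End TopFunctions.

(** * The correspondence between irreducible characters *)

Section Kernel.
Variables (F : finFieldType) (n j : nat).
Local Notation q := #|F|.
Local Notation N := n.-1.+1.
Local Notation J := j.-1.+1.
Local Notation G := (GLgroup_group n F).
Local Notation S := (GLgroup_group j F).
Implicit Types (i k : Iirr G) (a b : Iirr S) (X Y Z : 'M[F]_(N, J)).
Implicit Types (g h : {'GL_n[F]}) (s t u : {'GL_j[F]}).

Lemma tau_tensE g s :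
  tau_tens g s = #|[set X : 'M[F]_(N, J) | (GLval g)^T *m X *m GLval s == X]|%:R.
Proof.
pose f : 'M[F]_(N, J) -> 'M[F]_(N, J) := mulmxr (GLval s) \o mulmx (GLval g)^T.
rewrite /tau_tens (_ : tensor_act g s = lin_mx f) //.
rewrite -[\rank _]mul1n -card_submx -[in RHS](card_imset _ (can_inj mxvecK)).
congr (_%:R); apply: eq_card => v; rewrite inE sub_kermx mulmxBr mulmx1 subr_eq0 -[v]vec_mxK mul_vec_lin.
rewrite (inj_eq (can_inj mxvecK)) (mem_imset _ _ (can_inj mxvecK)) inE.
by rewrite /f /=.
Qed.

Definition mult i a : algC :=
  #|G|%:R^-1 * #|S|%:R^-1 * \sum_g \sum_s tau_tens g s * ('chi_i g)^* * ('chi_a s)^*.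

(** The character of GL_j on the multiplicity space of ['chi_i] in the functions on N x J
    matrices. *)
Definition Theta i s : algC := #|G|%:R^-1 * \sum_g tau_tens g s * ('chi_i g)^*.

(* Up to scaling, the kernel of the ['chi_i]-isotypic projection on functions of matrices. *)
Definition kap i X Y := \sum_(g | (GLval g)^T *m X == Y) 'chi_i g.

Lemma kap_act i g X Y : kap i ((GLval g)^T *m X) ((GLval g)^T *m Y) = kap i X Y.
Proof.
rewrite /kap (reindex_inj (conjg_inj g)) /=; apply: eq_big => [h | h _]; last by rewrite cfunJ ?GLT.
rewrite mulmxA GLval_trM conjgE mulKVg -GLval_trM -mulmxA.
by rewrite (inj_eq (can_inj (mulKmx _))) // unitmx_tr GLval_unit.
Qed.

Lemma kap_mulr i s X Y : kap i (X *m GLval s) (Y *m GLval s) = kap i X Y.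
Proof.
rewrite /kap; apply: eq_bigl => h; rewrite mulmxA (inj_eq (can_inj (mulmxK _))) //.
exact: GLval_unit.
Qed.

Lemma GLVK g (A : 'M[F]_(N, J)) : (GLval g)^T *m ((GLval g^-1%g)^T *m A) = A.
Proof. by rewrite mulmxA GLval_trM mulVg GLval1 trmx1 mul1mx. Qed.

Lemma GLKV g (A : 'M[F]_(N, J)) : (GLval g^-1%g)^T *m ((GLval g)^T *m A) = A.
Proof. by rewrite mulmxA GLval_trM mulgV GLval1 trmx1 mul1mx. Qed.

Lemma fixed_invE g s X :
  ((GLval g^-1%g)^T *m X *m GLval s == X) = ((GLval g)^T *m X == X *m GLval s).
Proof. by rewrite -mulmxA; apply/eqP/eqP => [{1}<- | <-]; rewrite ?GLVK ?GLKV. Qed.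

Lemma kap_mul i k X Y :
  \sum_Z kap i X Z * kap k Z Y = (k == i)%:R * (#|G|%:R / chi1 i) * kap i X Y.
Proof.
under eq_bigr do rewrite mulr_suml.
rewrite (exchange_big_dep xpredT) //=.
transitivity (\sum_g 'chi_i g * \sum_(y | (GLval y)^T *m X == Y) 'chi_k (g^-1 * y)%g).
  apply: eq_bigr => g _; rewrite (big_pred1 ((GLval g)^T *m X)) => [|Z]; last exact: eq_sym.
  congr (_ * _); rewrite /kap (reindex_inj (mulgI g^-1%g)) /=; apply: eq_bigl => y.
  by rewrite mulmxA GLval_trM mulKVg.
under eq_bigr do rewrite mulr_sumr.
rewrite exchange_big mulr_sumr; apply: eq_bigr => y _.
rewrite (sum_irr_conv_cfun (@GLT F n)) cfdot_irr; ring.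
Qed.

Lemma tau_tensJ g h s : tau_tens (g ^ h)%g s = tau_tens g s.
Proof.
rewrite !tau_tensE; congr (_%:R).
have hI : injective (mulmx (GLval h)^T : 'M[F]_(N, J) -> _).
  by apply: (can_inj (mulKmx _)); rewrite unitmx_tr GLval_unit.
rewrite -[in RHS](card_imset _ hI); apply: eq_card => X.
rewrite -(GLVK h X) (mem_imset _ _ hI) !inE mulmxA GLval_trM conjgE mulKVg.
by rewrite -GLval_trM -!mulmxA (inj_eq hI).
Qed.

Lemma ThetaE i s : Theta i s = #|G|%:R^-1 * \sum_Z kap i Z (Z *m GLval s).
Proof.
congr (_ * _); rewrite /kap (exchange_big_dep xpredT) //= sum_mul_conj_irr.
apply: eq_bigr => g _; rewrite sumr_const -mulr_natl; congr (_ * _).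
rewrite tau_tensE; congr (_%:R); apply: eq_card => Z; rewrite inE.
exact: fixed_invE.
Qed.

(** Up to a factor, the left side is the trace of a pair of group elements on the ['chi_i]-isotypic
    part of the functions on matrices. That part is ['chi_i] tensored with its multiplicity space,
    so the trace is a product. *)
Lemma kap_shift i g s :
  \sum_Z kap i ((GLval g)^T *m Z) (Z *m GLval s)
   = #|G|%:R / chi1 i * Theta i s * 'chi_i g^-1%g.
Proof.
have tJ x y : tau_tens (x ^ y)%g s = tau_tens x s := tau_tensJ x y s.
have [phi phiE] := exists_cfun (@GLT F n) tJ.
transitivity (\sum_x 'chi_i x * phi (x^-1 * g^-1)%g).
  rewrite /kap (exchange_big_dep xpredT) //=.
  apply: eq_bigr => x _; rewrite sumr_const -mulr_natr phiE tau_tensE; congr (_ * _%:R).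
  by apply: eq_card => Z; rewrite inE -invMg fixed_invE -GLval_trM -mulmxA.
rewrite (sum_irr_conv_cfun (@GLT F n)) (cfdot_full (@GLT F n)) /Theta.
under [in LHS]eq_bigr do rewrite phiE.
ring.
Qed.

Lemma ThetaJ i s t : Theta i (s ^ t)%g = Theta i s.
Proof.
rewrite !ThetaE; congr (_ * _); rewrite (reindex_inj (can_inj (mulmxK (GLval_unit t)))).
apply: eq_bigr => Z _; rewrite -(kap_mulr _ t Z) -!mulmxA !GLvalM conjgE mulKVg.
by [].
Qed.

Lemma Theta_irr i s : Theta i s = \sum_a mult i a * 'chi_a s.
Proof.
have [phi phiE] := exists_cfun (@GLT F j) (ThetaJ i).
rewrite -phiE {1}[phi]cfun_sum_cfdot sum_cfunE; apply: eq_bigr => a _; rewrite cfunE.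
congr (_ * _); rewrite (cfdot_full (@GLT F j)) /mult -mulrA [RHS]mulrCA; congr (_ * _).
rewrite exchange_big mulr_sumr; apply: eq_bigr => t _.
by rewrite phiE /Theta -mulrA mulr_suml.
Qed.

Lemma sum_Theta_irr i a t :
  \sum_s 'chi_a s^-1%g * Theta i (s * t)%g = #|S|%:R / chi1 a * mult i a * 'chi_a t.
Proof.
under eq_bigr do rewrite Theta_irr.
exact: sum_irr_comb (@GLT F j) _ _ _.
Qed.

End Kernel.

(** * The commutant of GL_n on top functions *)

Section Correspondence.
Variables (F : finFieldType) (n j : nat).
Local Notation q := #|F|.
Local Notation N := n.-1.+1.
Local Notation J := j.-1.+1.
Local Notation G := (GLgroup_group n F).
Local Notation S := (GLgroup_group j F).
Implicit Types (i k : Iirr G) (a b : Iirr S) (X Y Z : 'M[F]_(N, J)).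
Implicit Types (g h : {'GL_n[F]}) (s t u : {'GL_j[F]}).

(* Equivalently, the true level of ['chi_i] is at least [J]. *)
Definition top_irr i := tau_mult j.-1 'chi_i == 0.

(** For [Y] of rank below [J], the value is an empty sum or a coset sum for an [X] of the same rank.
    Summing over Y + v w fixes g^T X only modulo [w], that is, it fixes g^T (X C) with C =
    [cokermx w] of rank J - 1. *)
Lemma kap_top i X : top_irr i -> top_fun (kap i X).
Proof.
move=> /eqP ti; split=> [Y rY | Y w w0].
  rewrite /kap; case: (pickP (fun g => (GLval g)^T *m X == Y)) => [g /eqP gX|]; last first.
    exact: big_pred0.
  apply: vanish_trmx ti _; rewrite -ltnS -(eqmxMfull X (A := (GLval g)^T)) ?gX //.
  by rewrite row_full_unit unitmx_tr GLval_unit.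
rewrite /kap (exchange_big_dep xpredT) //=.
transitivity (\sum_(g | (GLval g)^T *m (X *m cokermx w) == Y *m cokermx w) 'chi_i g).
  rewrite [RHS]big_mkcond; apply: eq_bigr => g _.
  rewrite mulmxA -subr_eq0 -mulmxBl -submxE.
  case: ifPn => [/submxP[D XY] | nXY].
    have fw : row_free w by rewrite /row_free rank_rV w0.
    rewrite (big_pred1 D) // => v; move/eqP: XY; rewrite subr_eq => /eqP ->.
    by rewrite addrC (inj_eq (addrI Y)) (inj_eq (row_free_inj fw)) eq_sym.
  rewrite big_pred0 // => v; apply: contraNF nXY => /eqP ->.
  by rewrite addrC addKr submxMl.
apply: vanish_trmx ti _; rewrite (leq_trans (mxrankM_maxr _ _)) // mxrank_coker.
by rewrite rank_rV w0 subn1.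
Qed.

Local Opaque Theta mult kap.

(** The orbits of GL_n acting on matrices from the left are classified by the row space; the order
    of the stabiliser of the pair counts how often each [Y] is hit. *)
Lemma orbit_sum r (X0 X : 'M[F]_(N, r)) Y0 (p : 'M[F]_(N, J) -> algC) :
  \sum_(g | (GLval g)^T *m X0 == X) p ((GLval g)^T *m Y0) =
    #|[set g | ((GLval g)^T *m X0 == X0) && ((GLval g)^T *m Y0 == Y0)]|%:R *
    \sum_(Y | <<row_mx X Y>>%MS == <<row_mx X0 Y0>>%MS) p Y.
Proof.
rewrite mulr_sumr.
rewrite (partition_big (fun g => (GLval g)^T *m Y0)
           (fun Y => <<row_mx X Y>>%MS == <<row_mx X0 Y0>>%MS)) => [|g /eqP <-]; last first.
  rewrite -mul_mx_row; apply/eqP/eq_genmx/eqmxMfull.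
  by rewrite row_full_unit unitmx_tr GLval_unit.
apply: eq_bigr => Y /eqP/genmxP/eqmxMunitP[P uP].
have [h hP] : {h : {'GL_n[F]} | GLval h = P^T} by apply: exists_GL; rewrite unitmx_tr.
rewrite -[P]trmxK -hP mul_mx_row => /eq_row_mx[XE YE].
under eq_bigr => g /andP[_ /eqP->] do rewrite -[p Y]mul1r.
rewrite -mulr_suml; congr (_ * _).
rewrite sumr_const; congr (_%:R).
rewrite -[in RHS](card_imset _ (mulIg h)); apply: eq_card => g.
rewrite -[in RHS](mulgKV h g) (mem_imset _ _ (mulIg h)) inE.
rewrite [LHS]/in_mem /= XE YE -{1 2}(mulgKV h g) -!GLval_trM -!mulmxA.
by rewrite !(inj_eq (can_inj (mulKmx _))) // unitmx_tr GLval_unit.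
Qed.

Lemma kap_orbit_sum X0 Y0 :
  exists c : {'GL_j[F]} -> algC, forall (p : 'M_(N, J) -> algC) X, top_fun p ->
    \sum_(g | (GLval g)^T *m X0 == X) p ((GLval g)^T *m Y0) = \sum_t c t * p (X *m GLval t).
Proof.
have [c Hc] := top_row_space_sum N (row_mx X0 Y0).
pose m : algC := #|[set g | ((GLval g)^T *m X0 == X0) && ((GLval g)^T *m Y0 == Y0)]|%:R.
exists (fun t => m * c t) => p X ptop; rewrite orbit_sum Hc // mulr_sumr.
by apply: eq_bigr => t _; rewrite mulrA.
Qed.

(** The first identity is the second with X = Z, summed over [Z], by the invariance of [kap] under
    GL_n. The point is that one [c] serves all top characters. *)
Lemma kap_span X0 Y0 :
  exists c : {'GL_j[F]} -> algC, 
    (forall i s, top_irr i -> kap i X0 (Y0 *m GLval s) = \sum_t c t * Theta i (t * s)%g) /\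
    (forall i X Z s, top_irr i ->
     \sum_(g | (GLval g)^T *m X0 == X) kap i Z ((GLval g)^T *m Y0 *m GLval s)
      = \sum_t c t * kap i Z (X *m GLval (t * s)%g)).
Proof.
have [c Hc] := kap_orbit_sum X0 Y0; exists c.
have Hk i X Z s : top_irr i ->
    \sum_(g | (GLval g)^T *m X0 == X) kap i Z ((GLval g)^T *m Y0 *m GLval s)
     = \sum_t c t * kap i Z (X *m GLval (t * s)%g).
  move=> ti; have kE Y : kap i Z (Y *m GLval s) = kap i (Z *m GLval s^-1%g) Y.
    by rewrite -(kap_mulr i s (Z *m _)) -mulmxA GLvalM mulVg GLval1 mulmx1.
  under eq_bigr do rewrite kE.
  rewrite (Hc _ X (kap_top _ ti)); apply: eq_bigr => t _.
  by rewrite -kE -mulmxA GLvalM.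
split=> // i s ti.
apply: (mulfI (card_group_neq0 G)).
transitivity (\sum_Z \sum_(g | (GLval g)^T *m X0 == Z) kap i Z ((GLval g)^T *m Y0 *m GLval s)).
  rewrite (exchange_big_dep xpredT) //=.
  under eq_bigr => g _.
    rewrite (big_pred1 ((GLval g)^T *m X0)) => [|Z]; last exact: eq_sym.
    rewrite -mulmxA kap_act; over.
  by rewrite -(sum_in_full (@GLT F n)) sumr_const mulr_natl.
under eq_bigr do rewrite (Hk _ _ _ _ ti).
rewrite exchange_big mulr_sumr; apply: eq_bigr => t _.
by rewrite -mulr_sumr ThetaE mulrCA mulVKf ?card_group_neq0.
Qed.

Lemma Theta_swap i s t : Theta i (s * t)%g = Theta i (t * s)%g.
Proof. by rewrite -(ThetaJ i (s * t)%g s) conjgE mulgA mulKg. Qed.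

Lemma sum_irr_Theta i a : \sum_s 'chi_a s^-1%g * Theta i s = #|S|%:R * mult i a.
Proof.
under eq_bigr do rewrite Theta_irr.
exact: sum_irr_comb1 (@GLT F j) _ _.
Qed.

(** Up to a factor, [A] is the element of the group algebra of GL_j by which the projection onto
    ['chi_i] acts on top functions. On the [a]-component it gives one scalar, the same for [i] and
    [k]; yet it must be nonzero for ['chi_i] and zero for any other ['chi_k]. *)
Lemma top_irr_disjoint i k a :
  top_irr i -> top_irr k -> mult i a != 0 -> mult k a != 0 -> i = k.
Proof.
move=> ti tk mi mk; apply/eqP/idPn => ik.
have [c Hc] := fin_all_exists (fun XY : 'M[F]_(N, J) * 'M[F]_(N, J) => kap_span XY.1 XY.2).
pose A t := \sum_XY kap i XY.2 XY.1 * c XY t.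
have main (l : Iirr G) : top_irr l -> \sum_s 'chi_a s^-1%g * \sum_t A t * Theta l (t * s)%g
    = (l == i)%:R * (#|G|%:R / chi1 i) * #|G|%:R * (#|S|%:R * mult i a).
  move=> tl; rewrite -sum_irr_Theta mulr_sumr; apply: eq_bigr => s _.
  rewrite [RHS]mulrCA; congr (_ * _).
  transitivity (\sum_(XY : 'M[F]_(N, J) * 'M[F]_(N, J)) kap i XY.2 XY.1 * kap l XY.1 (XY.2 *m GLval s)).
    under eq_bigr do rewrite mulr_suml.
    rewrite exchange_big; apply: eq_bigr => XY _ /=.
    have [-> // _] := Hc XY; rewrite mulr_sumr.
    by apply: eq_bigr => t _; rewrite mulrA.
  rewrite -(pair_bigA _ (fun X Y => kap i Y X * kap l X (Y *m GLval s))) exchange_big /=.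
  under eq_bigr do rewrite kap_mul.
  rewrite -mulr_sumr ThetaE -!mulrA; congr (_ * (_ * (_ * _))).
  by rewrite mulVKf ?card_group_neq0.
have E (l : Iirr G) : \sum_s 'chi_a s^-1%g * \sum_t A t * Theta l (t * s)%g
    = mult l a * (\sum_t A t * 'chi_a t * (#|S|%:R / chi1 a)).
  under eq_bigr do rewrite mulr_sumr.
  rewrite exchange_big mulr_sumr; apply: eq_bigr => t _.
  under eq_bigr do rewrite Theta_swap mulrCA.
  rewrite -mulr_sumr sum_Theta_irr; ring.
have := main i ti; have := main k tk; rewrite !E eqxx mul1r eq_sym (negPf ik) !mul0r.
move/eqP; rewrite mulf_eq0 (negPf mk) => /eqP->; rewrite mulr0 => /esym/eqP.
move: (mult i a) mi => x x0; apply/negP.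
by rewrite !mulf_neq0 ?invr_neq0 ?card_group_neq0 // (chi1_neq0 i).
Qed.

(** Two evaluations of a sum over [g] of products of two traces on the isotypic part: by [kap_shift]
    and orthogonality, and by expanding both traces over matrices [X] and [Y] and applying the orbit
    sums. *)
Lemma Theta_mul i (c : 'M[F]_(N, J) * 'M[F]_(N, J) -> {'GL_j[F]} -> algC) s t : top_irr i ->
  (forall XY X Z u,
     \sum_(g | (GLval g)^T *m XY.1 == X) kap i Z ((GLval g)^T *m XY.2 *m GLval u)
      = \sum_v c XY v * kap i Z (X *m GLval (v * u)%g)) ->
  #|G|%:R ^+ 2 / chi1 i * (Theta i s * Theta i t)
    = \sum_XY \sum_u c XY u * kap i XY.2 (XY.1 *m GLval (s * (u * t))%g).
Proof.
move=> ti Hc.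
have nz : #|G|%:R / chi1 i != 0 by rewrite mulf_neq0 ?invr_neq0 ?card_group_neq0 ?chi1_neq0.
apply: (mulfI nz).
transitivity (\sum_g (\sum_X kap i ((GLval g)^T *m X) (X *m GLval s)) *
                     (\sum_Y kap i Y ((GLval g)^T *m Y *m GLval t))).
  under [RHS]eq_bigr => g _.
    rewrite kap_shift.
    under [X in _ * X]eq_bigr => Y _ do
      rewrite -(kap_act i g^-1%g Y) -[_ *m _ *m GLval t]mulmxA GLKV.
    rewrite kap_shift invgK; over.
  by rewrite (sum_irr_mulV (@GLT F n)); ring.
transitivity (\sum_X \sum_Y \sum_g kap i ((GLval g)^T *m X) (X *m GLval s) *
                kap i Y ((GLval g)^T *m Y *m GLval t)).
  under eq_bigr do rewrite mulr_suml.
  rewrite exchange_big; apply: eq_bigr => X _ /=.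
  under eq_bigr do rewrite mulr_sumr.
  by rewrite exchange_big.
rewrite pair_bigA mulr_sumr; apply: eq_bigr => XY _ /=.
transitivity (\sum_(W : 'M[F]_(N, J)) kap i W (XY.1 *m GLval s) *
   \sum_(g | (GLval g)^T *m XY.1 == W) kap i XY.2 ((GLval g)^T *m XY.2 *m GLval t)).
  under [RHS]eq_bigr do rewrite mulr_sumr.
  rewrite [RHS](exchange_big_dep xpredT) //=; apply: eq_bigr => g _.
  by rewrite (big_pred1 ((GLval g)^T *m XY.1)) // => W; rewrite eq_sym.
under [LHS]eq_bigr => W _ do rewrite (Hc XY W XY.2 t) mulr_sumr.
rewrite exchange_big mulr_sumr; apply: eq_bigr => v _ /=.
have vtI : injective (fun W : 'M[F]_(N, J) => W *m GLval (v * t)%g).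
  exact: can_inj (mulmxK (GLval_unit _)).
transitivity (c XY v * \sum_(W : 'M[F]_(N, J)) kap i XY.2 W * kap i W (XY.1 *m GLval (s * (v * t))%g)).
  rewrite [in RHS](reindex_inj vtI) mulr_sumr; apply: eq_bigr => W _ /=.
  by rewrite -(kap_mulr i (v * t)%g W) -mulmxA GLvalM; ring.
by rewrite kap_mul eqxx mul1r; ring.
Qed.

(** The Fourier transform of [Theta_mul] in [s] and [t], which enter its right side only through the
    product s u t; hence the factor [b == a]. *)
Lemma mult_mul_eq i a b (c : 'M[F]_(N, J) * 'M[F]_(N, J) -> {'GL_j[F]} -> algC) : top_irr i ->
  (forall XY X Z u,
     \sum_(g | (GLval g)^T *m XY.1 == X) kap i Z ((GLval g)^T *m XY.2 *m GLval u)
      = \sum_v c XY v * kap i Z (X *m GLval (v * u)%g)) ->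
  #|G|%:R ^+ 2 / chi1 i * (#|S|%:R ^+ 2 * (mult i a * mult i b))
  = (b == a)%:R * (#|S|%:R / chi1 b) *
    \sum_XY \sum_u \sum_t c XY t * 'chi_b (t * u^-1)%g * kap i XY.2 (XY.1 *m GLval u).
Proof.
move=> ti Hc.
transitivity (\sum_s \sum_t 'chi_a s^-1%g * 'chi_b t^-1%g *
                (#|G|%:R ^+ 2 / chi1 i * (Theta i s * Theta i t))).
  have -> : #|S|%:R ^+ 2 * (mult i a * mult i b) = #|S|%:R * mult i a * (#|S|%:R * mult i b).
    by ring.
  rewrite -!sum_irr_Theta big_distrlr mulr_sumr; apply: eq_bigr => s _ /=.
  by rewrite mulr_sumr; apply: eq_bigr => t _; ring.
transitivity (\sum_XY \sum_u \sum_s \sum_t 'chi_a s^-1%g * 'chi_b t^-1%g *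
                (c XY u * kap i XY.2 (XY.1 *m GLval (s * (u * t))%g))).
  under eq_bigr => s _.
    under eq_bigr do rewrite (Theta_mul _ _ ti Hc) mulr_sumr.
    rewrite exchange_big; under eq_bigr => XY _ do under eq_bigr do rewrite mulr_sumr.
    over.
  rewrite exchange_big; apply: eq_bigr => XY _ /=.
  under eq_bigr do rewrite exchange_big; exact: exchange_big.
rewrite mulr_sumr; apply: eq_bigr => XY _ /=.
transitivity (\sum_u (b == a)%:R * (#|S|%:R / chi1 b) *
    \sum_v 'chi_b (u * v^-1)%g * (c XY u * kap i XY.2 (XY.1 *m GLval v))).
  apply: eq_bigr => u _.
  exact: sum_irr_conv2 (@GLT F j) a b (fun v => c XY u * kap i XY.2 (XY.1 *m GLval v)) u.
rewrite -mulr_sumr exchange_big; congr (_ * _); apply: eq_bigr => v _.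
by apply: eq_bigr => u _; rewrite mulrCA mulrA.
Qed.

Lemma top_irr_uniq i a b : top_irr i -> mult i a != 0 -> mult i b != 0 -> a = b.
Proof.
move=> ti ma mb; apply/eqP/idPn => ab.
have [c Hc] := fin_all_exists (fun XY : 'M[F]_(N, J) * 'M[F]_(N, J) => kap_span XY.1 XY.2).
have := mult_mul_eq (c := c) a b ti (fun XY X Z u => (Hc XY).2 i X Z u ti).
rewrite eq_sym (negPf ab) !mul0r; apply/eqP.
move: (mult i a) (mult i b) ma mb => x y x0 y0.
by rewrite !mulf_neq0 ?invr_neq0 ?expf_neq0 ?card_group_neq0 // (chi1_neq0 i).
Qed.

(** By uniqueness [Theta i] is a multiple of ['chi_a], so the [a]-component of the orbit
    coefficients [c] is a value of [kap] divided by [mult i a]. Inserted in [mult_mul_eq] with b =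
    a, it leaves a sum of products of two kernels, which [kap_mul] evaluates. *)
Lemma top_irr_mult1 i a : top_irr i -> mult i a != 0 -> mult i a ^+ 2 = 1.
Proof.
move=> ti ma.
have [c Hc] := fin_all_exists (fun XY : 'M[F]_(N, J) * 'M[F]_(N, J) => kap_span XY.1 XY.2).
have := mult_mul_eq (c := c) a a ti (fun XY X Z u => (Hc XY).2 i X Z u ti).
rewrite eqxx mul1r.
have ThE s : Theta i s = mult i a * 'chi_a s.
  rewrite Theta_irr (bigD1 a) //= big1 ?addr0 // => b ba.
  have [-> | mb] := eqVneq (mult i b) 0; first exact: mul0r.
  by rewrite (top_irr_uniq ti ma mb) eqxx in ba.
have kE XY u : \sum_t mult i a * (c XY t * 'chi_a (t * u^-1)%g) = kap i XY.1 (XY.2 *m GLval u^-1%g).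
  rewrite (Hc XY).1 //; apply: eq_bigr => t _; rewrite ThE; exact: mulrCA.
have E : mult i a * (\sum_XY \sum_u \sum_t c XY t * 'chi_a (t * u^-1)%g * kap i XY.2 (XY.1 *m GLval u))
   = #|S|%:R * (#|G|%:R / chi1 i) * (#|G|%:R * (mult i a * chi1 a)).
  transitivity (\sum_(XY : 'M[F]_(N, J) * 'M[F]_(N, J)) \sum_u kap i XY.2 (XY.1 *m GLval u) * kap i (XY.1 *m GLval u) XY.2).
    rewrite mulr_sumr; apply: eq_bigr => XY _; rewrite mulr_sumr; apply: eq_bigr => u _.
    rewrite -mulr_suml mulrA mulr_sumr kE mulrC; congr (_ * _).
    by rewrite -(kap_mulr i u XY.1) -mulmxA GLvalM mulVg GLval1 mulmx1.
  rewrite -(pair_bigA _ (fun X Y : 'M[F]_(N, J) => \sum_u kap i Y (X *m GLval u) * kap i (X *m GLval u) Y)) /=.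
  rewrite exchange_big; under eq_bigr do rewrite exchange_big.
  have R Y u : \sum_X kap i Y (X *m GLval u) * kap i (X *m GLval u) Y
      = #|G|%:R / chi1 i * kap i Y Y.
    have := kap_mul i i Y Y; rewrite eqxx mul1r => <-.
    by rewrite [in RHS](reindex_inj (can_inj (mulmxK (GLval_unit u)))).
  under eq_bigr do under eq_bigr do rewrite R.
  rewrite exchange_big -(sum_in_full (@GLT F j)) sumr_const -mulr_sumr -[RHS]mulrA -[LHS]mulr_natl.
  congr (_ * (_ * _)).
  rewrite -[mult i a * chi1 a]/(mult i a * 'chi_a 1%g) -ThE ThetaE mulVKf ?card_group_neq0 //.
  by apply: eq_bigr => Y _; rewrite GLval1 mulmx1.
move=> /(congr1 ( *%R (mult i a))).
rewrite [RHS]mulrCA E.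
move: (mult i a) (chi1 i) (chi1 a) ma (chi1_neq0 i) (chi1_neq0 a) => x d e x0 d0 e0.
have G0 := card_group_neq0 G; have S0 := card_group_neq0 S.
move=> H; have : (#|G|%:R ^+ 2 / d * #|S|%:R ^+ 2 * x) * (x ^+ 2) = (#|G|%:R ^+ 2 / d * #|S|%:R ^+ 2 * x) * 1.
  rewrite (_ : _ * x ^+ 2 = x * (#|G|%:R ^+ 2 / d * (#|S|%:R ^+ 2 * (x * x)))); last by ring.
  rewrite H; field.
  by rewrite d0 e0.
apply: mulfI; by rewrite !mulf_neq0 ?expf_neq0 ?invr_neq0.
Qed.

End Correspondence.

(** * Levels and multiplicities as inner products of characters *)

Section PermutationCharacter.
Variables (gT : finGroupType) (G : {group gT}).
Hypothesis GT : forall x, x \in G.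

Lemma perm_character (T : finType) (act : gT -> T -> T) :
    (forall t, act 1%g t = t) -> (forall x y t, act (x * y)%g t = act y (act x t)) ->
  exists2 phi : 'CF(G), phi \is a character & forall x, phi x = #|[set t | act x t == t]|%:R.
Proof.
move=> act1 actM.
pose rho x := \matrix_(a < #|T|, b < #|T|) (act x (enum_val a) == enum_val b)%:R : 'M[algC]__.
have rhoP : mx_repr G rho.
  split=> [|x y _ _]; apply/matrixP => a b; rewrite !mxE.
    by rewrite act1 (inj_eq enum_val_inj).
  rewrite (bigD1 (enum_rank (act x (enum_val a)))) //= !mxE enum_rankK eqxx mul1r -actM.
  rewrite big1 ?addr0 // => c; rewrite !mxE -(inj_eq enum_val_inj) enum_rankK eq_sym.
  by move/negPf->; rewrite mul0r.
exists (cfRepr (MxRepresentation rhoP)) => [|x]; first exact: cfRepr_char.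
rewrite cfunE GT mulr1n /= /mxtrace.
under eq_bigr do rewrite mxE.
rewrite (reindex (@enum_rank T)) /=; last by apply: onW_bij; exact: enum_rank_bij.
under eq_bigr do rewrite enum_rankK.
by rewrite -sum1_card natr_sum [RHS]big_mkcond; apply: eq_bigr => t _; rewrite inE; case: eqP.
Qed.

Lemma pullback_character (hT : finGroupType) (H : {group hT}) (f : gT -> hT) (chi : 'CF(H)) :
    (forall x, x \in H) -> {morph f : x y / (x * y)%g} -> chi \is a character ->
  exists2 phi : 'CF(G), phi \is a character & forall x, phi x = chi (f x).
Proof.
move=> HT fM /char_reprP[rG ->].
have f1 : f 1%g = 1%g by apply: (mulgI (f 1%g)); rewrite -fM !mulg1.
have rhoP : mx_repr G (fun x => rG (f x)).
  by split=> [|x y _ _]; rewrite ?f1 ?repr_mx1 // fM repr_mxM ?HT.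
exists (cfRepr (MxRepresentation rhoP)) => [|x]; first exact: cfRepr_char.
by rewrite !cfunE GT HT.
Qed.
End PermutationCharacter.

Section Levels.
Variables (F : finFieldType) (n : nat).
Local Notation N := n.-1.+1.
Local Notation G := (GLgroup_group n F).
Implicit Types (i : Iirr G) (k : nat).

Lemma tau_character k :
  exists2 phi : 'CF(G), phi \is a character & forall g, phi g = tau_nat g ^+ k.
Proof.
have [||phi phiC phiE] := perm_character (@GLT F n)
  (act := fun g (Z : 'M[F]_(k, n.-1.+1)) => Z *m GLval g).
- by move=> Z; rewrite GLval1 mulmx1.
- by move=> x y Z; rewrite -GLvalM mulmxA.
by exists phi => // g; rewrite phiE tau_natE.
Qed.

Lemma tau_mult_le k m i : (k <= m)%N -> tau_mult m 'chi_i = 0 -> tau_mult k 'chi_i = 0.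
Proof.
move=> km m0; rewrite tau_multE (_ : \sum_g _ = 0) ?mulr0 ?conjC0 //.
under eq_bigr => g _ do rewrite tau_natE_trmx -sum1_card natr_sum mulr_suml.
rewrite (exchange_big_dep xpredT) //= big1 // => Z _.
rewrite -[RHS](vanish_trmx Z m0 (leq_trans (rank_leq_col Z) km)).
by apply: eq_big => [g|g _]; rewrite ?inE // mul1r.
Qed.

(** The default value 0 in [true_level] is never taken: the fixator of the identity matrix is
    trivial, so a character absent from [tau ^ N] would have degree 0. *)
Lemma true_levelP i :
  tau_mult (true_level 'chi_i) 'chi_i != 0 /\
  forall k, (k < true_level 'chi_i)%N -> tau_mult k 'chi_i = 0.
Proof.
rewrite /true_level; case: ClassicalEpsilon.excluded_middle_informative => [ex|no].
  case: ex_minnP => l lP lmin; split=> // k kl.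
  by apply/eqP/negPn/negP => /lmin; rewrite leqNgt kl.
case: no; exists N; apply/eqP => H.
have := @vanish_left F n N N i 1%:M 1%:M H (rank_leq_col _).
rewrite (big_pred1 1%g) => [E|g]; first by case/eqP: (chi1_neq0 i).
rewrite mulmx1 -(GLval1 F n); apply/eqP/eqP => [|->//].
by case: g => A uA /= E; apply: val_inj.
Qed.

Lemma tau_constt i (phi : 'CF(G)) : (forall g, phi g = tau_nat g ^+ true_level 'chi_i) ->
  i \in irr_constt phi.
Proof.
move=> phiE; rewrite irr_consttE; apply: contraNN (true_levelP i).1 => /eqP <-; apply/eqP.
by rewrite [RHS]cfdotE; congr (_ * _); apply: eq_bigr => g _; rewrite phiE.
Qed.

End Levels.

Section Multiplicities.
Variables (F : finFieldType) (n j : nat).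
Local Notation q := #|F|.
Local Notation N := n.-1.+1.
Local Notation J := j.-1.+1.
Local Notation G := (GLgroup_group n F).
Local Notation S := (GLgroup_group j F).
Implicit Types (i : Iirr G) (a b : Iirr S) (k : nat).

Lemma mult_nat i a : mult i a \is a Num.nat.
Proof.
pose GS := [set: {'GL_n[F]} * {'GL_j[F]}]%G.
have GST x : x \in GS by rewrite inE.
have [||tau tauC tauE] := perm_character GST
  (act := fun x (X : 'M[F]_(N, J)) => (GLval x.1)^T *m X *m GLval x.2).
- by move=> X; rewrite !GLval1 trmx1 mul1mx mulmx1.
- by move=> x y X; rewrite -GLvalM -GLval_trM !mulmxA.
have [//|phi phiC phiE] := pullback_character GST (@GLT F n) (f := fst) _ (irr_char i).
have [//|psi psiC psiE] := pullback_character GST (@GLT F j) (f := snd) _ (irr_char a).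
rewrite (_ : mult i a = '[tau, phi * psi]); first by rewrite Cnat_cfdot_char ?rpredM.
rewrite (cfdot_full GST) /mult -invfM -natrM; congr (_^-1 * _).
  by rewrite -cardX; congr (_%:R); apply: eq_card => x; rewrite !inE.
rewrite pair_bigA; apply: eq_bigr => x _ /=.
by rewrite tauE cfunE phiE psiE rmorphM mulrA tau_tensE.
Qed.

Lemma Dalpha_coef i a : '[Dalpha n a, 'chi_i] = mult i a.
Proof.
rewrite /Dalpha cfdot_suml (bigD1 i) //= [X in _ + X]big1 ?addr0 => [|l li].
  rewrite cfdotZl cfnorm_irr mulr1 natrM invfM /mult !(sum_in_full (@GLT F n)).
  by congr (_ * _); apply: eq_bigr => g _; rewrite (sum_in_full (@GLT F j)).
by rewrite cfdotZl cfdot_irr (negPf li) mulr0.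
Qed.

Lemma tau_mult_sum i : tau_mult J 'chi_i = \sum_(a : Iirr S) mult i a * chi1 a.
Proof.
transitivity (Theta i (1%g : {'GL_j[F]})); last exact: Theta_irr.
rewrite /Theta /tau_mult (sum_in_full (@GLT F n)); congr (_ * _).
apply: eq_bigr => g _; congr (_ * _); rewrite tau_natE_trmx tau_tensE; congr (_%:R).
by apply: eq_card => X; rewrite !inE GLval1 mulmx1.
Qed.

Lemma true_level_top i a : top_irr j i -> mult i a != 0 -> true_level 'chi_i = J.
Proof.
move=> /eqP ti mi; have [l0 lmin] := true_levelP i; apply/eqP; rewrite eqn_leq.
apply/andP; split; last first.
  by apply: contraR l0; rewrite -leqNgt => le; rewrite (tau_mult_le le ti).
rewrite leqNgt; apply/negP => /lmin/eqP.
rewrite tau_mult_sum psumr_eq0 => [/allP/(_ a (mem_index_enum a))|b _].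
  by rewrite mulf_eq0 (negPf mi) (negPf (chi1_neq0 a)).
by apply: mulr_ge0; [exact/natr_ge0/mult_nat | exact/ltW/chi1_gt0].
Qed.

Lemma true_level_mult i : true_level 'chi_i = J -> top_irr j i /\ exists a : Iirr S, mult i a != 0.
Proof.
have [l0 lmin] := true_levelP i => lE; rewrite lE in l0 lmin; split.
  by rewrite /top_irr lmin.
apply/existsP; apply: contraR l0; rewrite negb_exists => /forallP m0.
by rewrite tau_mult_sum big1 // => a _; move/negPn/eqP: (m0 a) => ->; rewrite mul0r.
Qed.

Lemma true_level_lt i : ~~ top_irr j i -> (true_level 'chi_i < J)%N.
Proof.
move=> nt; rewrite ltnS leqNgt; apply: contraNN nt => /(true_levelP i).2.
by rewrite /top_irr => ->.
Qed.

Lemma sum_GLval (P : pred 'M[F]_J) (f : 'M[F]_J -> algC) :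
  \sum_(h : {'GL_j[F]} | P (GLval h)) f (GLval h) = \sum_(H | P H && (H \in unitmx)) f H.
Proof.
have vI : injective (fun h : {'GL_j[F]} => GLval h).
  by move=> [A uA] [B uB] /= E; apply: val_inj.
apply/esym; transitivity (\sum_(H in [set GLval h | h : {'GL_j[F]} & P (GLval h)]) f H).
  apply: eq_bigl => H; apply/andP/imsetP => [[PH /exists_GL[h hH]] | [h]].
    by exists h; rewrite // inE hH.
  by rewrite inE => Ph ->; rewrite Ph GLval_unit.
by rewrite big_imset; [apply: eq_bigl => h; rewrite inE | move=> h h' _ _; exact: vI].
Qed.

(** For [X] of rank [J], the conditions zeta h = zeta and g^T Y = X h amount to P g^T Y = R, where
    [P] has rank at most (N - J) + k < J: the first block of [P] forces the columns of g^T Y into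
    those of [X]. The sum of ['chi_i] over all [g] with a given P g^T vanishes. *)
Lemma top_kap_coset_sum k i (X Y : 'M[F]_(N, J)) (zeta : 'M[F]_(k, J)) :
  (k < 2 * J - N)%N -> top_irr j i ->
  \sum_(h : {'GL_j[F]} | zeta *m GLval h == zeta) kap i Y (X *m GLval h) = 0.
Proof.
move=> kJN ti; have [ktop _] := kap_top Y ti.
have [fX | nfX] := boolP (row_full X); last first.
  rewrite big1 // => h _; apply: ktop; apply: leq_ltn_trans (mxrankM_maxl _ _) _.
  by rewrite ltn_neqAle nfX rank_leq_col.
have [L LX] := row_fullP fX.
rewrite (sum_GLval (fun H => zeta *m H == zeta) (fun H => kap i Y (X *m H))).
pose P := col_mx (1%:M - X *m L) (zeta *m L); pose R := col_mx 0 zeta : 'M_(N + k, J).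
(* Singular [H] may be included, because a top function vanishes at X H. *)
transitivity (\sum_(H | zeta *m H == zeta) kap i Y (X *m H)).
  rewrite big_mkcondr; apply: eq_bigr => H _; case: ifPn => // nuH; apply/esym/ktop.
  apply: leq_ltn_trans (mxrankM_maxr _ _) _.
  by rewrite ltn_neqAle rank_leq_row andbT; apply: contraNN nuH; rewrite -row_free_unit.
transitivity (\sum_(g | P *m (GLval g)^T *m Y == R) 'chi_i g).
  rewrite /kap (exchange_big_dep xpredT) //= [RHS]big_mkcond; apply: eq_bigr => g _.
  rewrite -mulmxA; move: ((GLval g)^T *m Y) => W; case: ifPn => [/eqP | nPW].
    rewrite mul_col_mx => /eq_col_mx[/eqP]; rewrite mulmxBl mul1mx subr_eq0 => /eqP WE zW.
    rewrite (big_pred1 (L *m W)) // => H; apply/andP/eqP => [[_ /eqP ->] | ->].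
      by rewrite mulmxA LX mul1mx.
    by rewrite !mulmxA -WE zW.
  rewrite big_pred0 // => H; apply: contraNF nPW => /andP[/eqP zH /eqP ->].
  by rewrite mul_col_mx mulmxBl mul1mx -!mulmxA [L *m _]mulmxA LX mul1mx zH subrr.
rewrite (partition_big (fun g => P *m (GLval g)^T) (fun R' => R' *m Y == R)) //=.
rewrite big1 // => R' /eqP R'Y.
rewrite -[RHS](@vanish_left F n j.-1 _ i P^T R'^T (eqP ti)).
  apply: eq_bigl => g; rewrite -[in RHS](inj_eq trmx_inj) trmx_mul !trmxK.
  by case: (P *m _ =P R') => [->|]; rewrite ?andbF // R'Y eqxx.
rewrite mxrank_tr.
have rP : (\rank (1%:M - X *m L)%R <= N - J)%N.
  have <- : \rank (kermx X) = (N - J)%N by rewrite mxrank_ker (eqP fX).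
  by rewrite mxrankS // sub_kermx mulmxBl mul1mx -mulmxA LX mulmx1 subrr.
have := rank_leq_row X; rewrite (eqP fX) => JN.
have : (\rank P <= (N - J) + k)%N.
  apply: leq_trans (leq_add rP (rank_leq_row (zeta *m L))).
  by rewrite -addsmxE mxrank_adds_leqif.
move=> rk; lia.
Qed.

(** Let [k] be the true level of ['chi_a]. Convolving [Theta i] with the k-th power of the
    permutation character of GL_j gives 0 by the preceding lemma, while on the [a]-component it
    multiplies by a nonzero multiple of the multiplicity of ['chi_a] in that power. *)
Lemma top_irr_low_level i a : 
  (true_level 'chi_a < 2 * J - N)%N -> top_irr j i -> mult i a = 0.
Proof.
move=> la ti.
have [l0 _] := true_levelP a.
set k := true_level _ in la l0.
have B (x : {'GL_j[F]}) : \sum_h tau_nat h ^+ k * Theta i (x * h)%g = 0.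
  under eq_bigr do rewrite tau_natE ThetaE -sum1_card natr_sum mulr_suml.
  rewrite (exchange_big_dep xpredT) //= big1 // => zeta _.
  transitivity (#|G|%:R^-1 * \sum_(Z : 'M[F]_(N, J)) \sum_(h : {'GL_j[F]} | zeta *m GLval h == zeta)
                   kap i Z (Z *m GLval x *m GLval h)).
    rewrite exchange_big mulr_sumr; apply: eq_big => [h | h _]; rewrite ?inE // mul1r.
    by under [in LHS]eq_bigr do rewrite -GLvalM mulmxA.
  by rewrite big1 ?mulr0 // => Z _; exact: top_kap_coset_sum.
have : \sum_x 'chi_a x^-1%g * \sum_h tau_nat h ^+ k * Theta i (x * h)%g = 0.
  by rewrite big1 // => x _; rewrite B mulr0.
under eq_bigr do rewrite mulr_sumr.
rewrite exchange_big /=.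
under eq_bigr => h _.
  under eq_bigr do rewrite mulrCA.
  rewrite -mulr_sumr sum_Theta_irr mulrCA; over.
rewrite -mulr_sumr => /eqP; rewrite mulf_eq0 => /orP[|/eqP S0].
  rewrite 2!mulf_eq0 invr_eq0 (negPf (card_group_neq0 _)) (negPf (chi1_neq0 a)) /=.
  by move/eqP.
by case/eqP: l0; rewrite tau_multE S0 mulr0 conjC0.
Qed.

End Multiplicities.

(** * An explicit top function *)

Section RankOneUpdate.
Variables (F : fieldType) (m N J : nat).
Implicit Types (B : 'M[F]_(m, J)) (w : 'rV[F]_J).

Lemma adds_rank1 B w : ~~ (w <= B)%MS -> \rank (B + w)%MS = (\rank B).+1.
Proof.
move=> wB; have w0 : w != 0 by apply: contraNneq wB => ->; exact: sub0mx.
rewrite mxrank_disjoint_sum ?rank_rV ?w0 ?addn1 //.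
apply/eqP/rowV0P => x; rewrite sub_capmx => /andP[xB /sub_rVP[a xw]].
apply/eqP; apply: contraNT wB => x0; have a0 : a != 0.
  by apply: contraNneq x0 => a0; rewrite xw a0 scale0r.
by rewrite -(scalerK a0 w) -xw scalemx_sub.
Qed.

Lemma addmx_subr B (X y : 'M[F]_(J, J)) : (y <= B)%MS -> ((X + y)%R <= B)%MS = (X <= B)%MS.
Proof.
move=> yB; apply/idP/idP => [XyB | XB]; last exact: addmx_sub.
by rewrite -(addrK y X) addmx_sub // -scaleN1r scalemx_sub.
Qed.

Lemma adds_update B w (x : 'cV_m) : ((B + x *m w)%R + w :=: B + w)%MS.
Proof.
apply/eqmxP/andP; split; rewrite addsmx_sub addsmxSr andbT.
  by rewrite addmx_sub_adds ?submxMl.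
rewrite -{1}[B](addrK (x *m w)) addmx_sub_adds // -mulNmx; exact: submxMl.
Qed.

Lemma outer_eqmx (z : 'cV[F]_J) w : z != 0 -> (z *m w :=: w)%MS.
Proof.
move=> z0; apply: eqmxMfull; rewrite /row_full eqn_leq rank_leq_col lt0n mxrank_eq0.
exact: z0.
Qed.

Lemma not_sub_dual k (B : 'M_(m, k)) (x : 'cV[F]_m) : ~~ (x^T <= B^T)%MS ->
  exists2 y : 'rV_m, y *m B = 0 & y *m x = 1%:M.
Proof.
rewrite submxE => xC.
have [l xl] : exists l, (x^T *m cokermx B^T) 0 l != 0.
  apply/existsP; apply: contraR xC; rewrite negb_exists => /forallP x0.
  by apply/eqP/rowP => l; rewrite [RHS]mxE; apply/eqP/negPn; exact: x0.
pose y := (col l (cokermx B^T))^T; have yB : y *m B = 0.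
  apply: trmx_inj; rewrite trmx_mul trmxK trmx0 colE mulmxA mulmx_coker.
  exact: mul0mx.
exists (((x^T *m cokermx B^T) 0 l)^-1 *: y); first by rewrite -scalemxAl yB scaler0.
have yx : y *m x = ((x^T *m cokermx B^T) 0 l)%:M.
  apply: trmx_inj; rewrite trmx_mul trmxK colE mulmxA -colE tr_scalar_mx.
  by apply/matrixP => a b; rewrite !ord1 !mxE eqxx mulr1n.
by rewrite -scalemxAl yx scale_scalar_mx mulVf.
Qed.

(** Multiplying y (B + x w) = w by [u] gives y x = 1, hence y B = 0; such a [y] exists exactly when
    [x] is outside the column space of [B]. *)
Lemma sub_update B w u (x : 'cV_m) : w *m u = 1%:M -> B *m u = 0 ->
  (w <= (B + x *m w)%R)%MS = ~~ (x^T <= B^T)%MS.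
Proof.
move=> wu Bu; apply/submxP/idP => [[y wE] | ].
  apply/negP => /submxP[D xE].
  have yx : y *m x = 1%:M.
    by rewrite -wu [in RHS]wE -[RHS]mulmxA mulmxDl Bu add0r -!mulmxA wu mulmx1.
  have yB : y *m B = 0.
    by apply: (addIr w); rewrite add0r {2}wE mulmxDr [y *m (x *m w)]mulmxA yx mul1mx.
  have : y *m x = 0 by rewrite -[x]trmxK xE trmx_mul trmxK mulmxA yB mul0mx.
  by rewrite yx => /eqP; rewrite oner_eq0.
move=> /not_sub_dual[y yB yx]; exists y.
by rewrite mulmxDr yB add0r mulmxA yx mul1mx.
Qed.
End RankOneUpdate.

Section TopFunctionFromIrr.
Variables (F : finFieldType) (n j : nat).
Local Notation q := #|F|.
Local Notation N := n.-1.+1.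
Local Notation J := j.-1.+1.
Local Notation G := (GLgroup_group n F).
Local Notation S := (GLgroup_group j F).
Variables (E : 'M[F]_(N, J)) (L : 'M[F]_(J, N)).
Hypothesis LE : L *m E = 1%:M.
Variable a : Iirr S.
Hypothesis high : (2 * J - N <= true_level 'chi_a)%N.

(** The projection onto the kernel of [L] along the column space of [E]; it vanishes at [Y] exactly
    when the columns of [Y] lie in that space. *)
Definition proj m (Y : 'M[F]_(N, m)) := Y - E *m (L *m Y).

(* On the translates [Y + v *m w], the rank of [proj] takes only two values [d.+1] and [d], whose
   contributions to the sum of [top_of] are proportional to [q^J (q^N - q^(J+d))] and [q^(J+d)];
   that they cancel determines [mcoef d.+1 / mcoef d]. *)
Definition mcoef r : algC :=
  \prod_(i < r) - (q%:R ^+ i / (q%:R ^+ N - q%:R ^+ (J + i))).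

(* The extension of [E *m GLval h |-> ('chi_a h)^*] to a top function. *)
Definition top_of (Y : 'M[F]_(N, J)) : algC :=
  mcoef (\rank (proj Y)) * \sum_(h : {'GL_j[F]} | ((GLval h - L *m Y)%R <= proj Y)%MS) ('chi_a h)^*.

Lemma proj_mul m k (Y : 'M_(N, m)) (Z : 'M_(m, k)) : proj (Y *m Z) = proj Y *m Z.
Proof. by rewrite /proj mulmxBl !mulmxA. Qed.

Lemma projD m (Y Z : 'M_(N, m)) : proj (Y + Z) = proj Y + proj Z.
Proof. by rewrite /proj !mulmxDr opprD addrACA. Qed.

Lemma projE m (Z : 'M_(J, m)) : proj (E *m Z) = 0.
Proof. by rewrite /proj [L *m _]mulmxA LE mul1mx subrr. Qed.

Lemma proj_idem m (Y : 'M_(N, m)) : proj (proj Y) = proj Y.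
Proof. by rewrite {1}/proj mulmxBr [L *m (E *m _)]mulmxA LE mul1mx subrr mulmx0 subr0. Qed.

Lemma L_proj m (Y : 'M_(N, m)) : L *m proj Y = 0.
Proof. by rewrite /proj mulmxBr [L *m (E *m _)]mulmxA LE mul1mx subrr. Qed.

Lemma rank_E : \rank E = J.
Proof.
by apply/eqP; rewrite -[_ == _]/(row_full E); apply/row_fullP; exists L.
Qed.

Lemma rank_proj m (Y : 'M_(N, m)) : (\rank (proj Y) <= N - J)%N.
Proof.
have -> : proj Y = (1%:M - E *m L) *m Y by rewrite mulmxBl mul1mx -mulmxA.
apply: leq_trans (mxrankM_maxl _ _) _.
have <- : \rank (kermx E) = (N - J)%N by rewrite mxrank_ker rank_E.
by rewrite mxrankS // sub_kermx mulmxBl mul1mx -mulmxA LE mulmx1 subrr.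
Qed.

(** The lower bound on the true level enters here: the condition is h C = A C with C the cokernel of
    [R], whose rank 2J - N - 1 is below that level. *)
Lemma coset_sum_vanish m (A : 'M[F]_J) (R : 'M[F]_(m, J)) : \rank R = (N - J).+1 ->
  \sum_(h : {'GL_j[F]} | ((GLval h - A)%R <= R)%MS) ('chi_a h)^* = 0.
Proof.
move=> rR.
have rRJ := rank_leq_col R; rewrite rR in rRJ.
have tk : tau_mult (2 * J - N).-1 'chi_a = 0.
  apply: (true_levelP a).2; apply: leq_trans high; lia.
have rb : (\rank (cokermx R) <= (2 * J - N).-1)%N by rewrite mxrank_coker rR; lia.
have V := vanish_left (A *m cokermx R) tk rb.
rewrite -rmorph_sum; apply/eqP; rewrite conjC_eq0; apply/eqP; apply: etrans V.
apply: eq_bigl => h.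
by rewrite submxE mulmxBl subr_eq0.
Qed.

(** Subtracting (B u) w, where w u = 1, turns [B] into [B1] with B1 u = 0. By [sub_update], [v] is
    counted exactly when v + B u lies in the sum of the column spaces of [B1] and [E], which are
    independent because [L] kills the first. *)
Lemma card_sub_update (B : 'M[F]_(N, J)) (w : 'rV_J) : w != 0 -> proj B = B ->
  #|[set v : 'cV[F]_N | ~~ (w <= (B + proj v *m w)%R)%MS]| =
    (q ^ (J + (\rank (B + w)%MS).-1))%N.
Proof.
move=> w0 BB.
have [u wu] : exists u, w *m u = 1%:M.
  by apply/row_freeP; rewrite /row_free rank_rV w0.
pose B1 := B - (B *m u) *m w.
have B1u : B1 *m u = 0 by rewrite mulmxBl -(mulmxA _ w u) wu mulmx1 subrr.
have B1w : ~~ (w <= B1)%MS.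
  apply/negP => /submxP[D wD]; move: wu; rewrite wD -mulmxA B1u mulmx0 => /esym/eqP.
  by rewrite oner_eq0.
have pB1 : proj B1 = B1 by rewrite /B1 -!mulNmx projD BB !mulNmx -!mulmxN !proj_mul BB.
have LB1 : L *m B1 = 0 by rewrite -pB1 L_proj.
have rk : \rank (B + w)%MS = (\rank B1).+1.
  by rewrite -(adds_rank1 B1w) /B1 -mulNmx adds_update.
rewrite rk /= addnC.
have <- : \rank (B1^T + E^T)%MS = (\rank B1 + J)%N.
  rewrite mxrank_disjoint_sum ?mxrank_tr ?rank_E //.
  apply/eqP/rowV0P => x; rewrite sub_capmx => /andP[/submxP[D1 x1] /submxP[D2 x2]].
  have : L *m x^T = 0 by rewrite x1 trmx_mul trmxK mulmxA LB1 mul0mx.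
  rewrite x2 trmx_mul trmxK mulmxA LE mul1mx => /(congr1 trmx); rewrite trmxK trmx0 => ->.
  exact: mul0mx.
have fI : injective (fun v : 'cV[F]_N => (v + B *m u)^T).
  by apply: inj_comp trmx_inj _; exact: addIr.
rewrite -[\rank _]mul1n -card_submx -(card_imset _ fI); apply: eq_card => Z.
have -> : Z = (Z^T - B *m u + B *m u)^T by rewrite subrK trmxK.
rewrite (mem_imset _ _ fI) !inE subrK.
have -> : B + proj (Z^T - B *m u) *m w = B1 + proj Z^T *m w.
  rewrite projD -mulmxN proj_mul BB mulmxDl mulmxN mulNmx /B1.
  by rewrite [proj _ *m _ - _]addrC addrA.
rewrite (sub_update _ wu B1u) negbK trmxK.
apply/submxP/idP => [[D ZD] | /sub_addsmxP[[D1 D2] /= ZD]].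
  have -> : Z = (proj Z^T)^T + (L *m Z^T)^T *m E^T.
    by rewrite -trmx_mul -linearD /= subrK trmxK.
  by rewrite ZD addmx_sub_adds ?submxMl.
have ZT : Z^T = B1 *m D1^T + E *m D2^T by rewrite ZD linearD /= !trmx_mul !trmxK.
exists D1; apply: trmx_inj; rewrite trmxK ZT projD projE addr0 proj_mul pB1.
by rewrite trmx_mul trmxK.
Qed.

Lemma top_of_top : top_fun top_of.
Proof.
split=> [Y rY | Y w w0].
  rewrite /top_of big_pred0 ?mulr0 // => h; apply: contraTF rY => /submxP[D hD].
  rewrite -leqNgt -[X in (X <= _)%N](mxrank_unit (GLval_unit h)).
  have -> : GLval h = (L + D - D *m E *m L) *m Y.
    apply: (addIr (- (L *m Y))); rewrite hD /proj mulmxBr !mulmxBl !mulmxDl !mulmxA.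
    by rewrite -!addrA [RHS]addrC !addrA addrNK.
  exact: mxrankM_maxr.
set R := (proj Y + w)%MS.
set T := \sum_(h : {'GL_j[F]} | ((GLval h - L *m Y)%R <= R)%MS) ('chi_a h)^*.
pose B (v : 'cV[F]_N) := proj Y + proj v *m w.
pose d := (\rank R).-1.
have RB v : (B v + w :=: R)%MS by exact: adds_update.
have rR : \rank R = d.+1.
  by apply/esym/prednK; rewrite lt0n mxrank_eq0; apply: contraNneq w0 => R0; rewrite -submx0 -R0 addsmxSr.
have BE v (z : 'cV[F]_J) : proj (Y + (v + E *m z) *m w) = B v.
  by rewrite projD proj_mul projD projE addr0.
(* Moving [v] along [E] does not change [proj]. For [h] counted by [T], every [z] is compatible with
   [h] if [w] lies in the row space of [B v], and exactly one is otherwise. *)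
have shift v : \sum_(z : 'cV[F]_J) top_of (Y + (v + E *m z) *m w)
    = mcoef (\rank (B v)) * (if (w <= B v)%MS then q%:R ^+ J else 1) * T.
  rewrite /top_of; under eq_bigr do rewrite BE.
  rewrite -mulr_sumr -mulrA; congr (_ * _).
  rewrite (exchange_big_dep xpredT) //= /T mulr_sumr [RHS]big_mkcond; apply: eq_bigr => h _.
  rewrite sumr_const -[LHS]mulr_natl.
  have LzE (z : 'cV[F]_J) : GLval h - L *m (Y + (v + E *m z) *m w)
      = GLval h - L *m Y - (L *m v + z) *m w.
    by rewrite mulmxDr opprD addrA mulmxA mulmxDr mulmxA LE mul1mx.
  rewrite (eq_card (B := [pred z : 'cV[F]_J | ((GLval h - L *m Y - (L *m v + z) *m w)%R <= B v)%MS]));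
    last by move=> z; rewrite [LHS]/in_mem /= LzE.
  have [wB | wB] := boolP (w <= B v)%MS.
    have BR : (B v :=: R)%MS by apply: eqmx_trans (RB v); exact/eqmx_sym/addsmx_idPl.
    rewrite (eq_card (B := [pred z : 'cV[F]_J | ((GLval h - L *m Y)%R <= R)%MS])).
      case: ifP => hR; last by rewrite eq_card0 ?mul0r // => z; rewrite inE hR.
      rewrite (eq_card (B := 'cV[F]_J)) => [|z]; last by rewrite !inE.
      by rewrite card_mx muln1 natrX.
    move=> z; rewrite !inE BR addmx_subr // -scaleN1r scalemx_sub // -BR.
    by rewrite (submx_trans (submxMl _ _)).
  case: ifP => hR; last first.
    rewrite eq_card0 ?mul0r // => z; apply: contraFF hR; rewrite !inE => zB.
    rewrite -(subrK ((L *m v + z) *m w) (GLval h - L *m Y)) -(RB v) addmx_sub_adds //.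
    exact: submxMl.
  have := hR; rewrite -(RB v) => /sub_addsmxP[[u1 u2] /= hu].
  rewrite (eq_card1 (x := u2 - L *m v)) // => z; rewrite !inE hu.
  have -> : u1 *m B v + u2 *m w - (L *m v + z) *m w = u1 *m B v + (u2 - (L *m v + z)) *m w.
    by rewrite mulmxBl addrA.
  apply/idP/eqP => [zB | ->]; last first.
    by rewrite [L *m v + _]addrC subrK subrr mul0mx addr0 submxMl.
  apply/eqP; rewrite eq_sym subr_eq addrC -subr_eq0; apply: contraNT wB => z0.
  rewrite -(outer_eqmx w z0) -(addKr (u1 *m B v) (_ *m w)) addmx_sub //.
  by rewrite -mulNmx submxMl.
have rB v : \rank (B v) = if (w <= B v)%MS then d.+1 else d.
  case: ifPn => [/addsmx_idPl BR | /adds_rank1]; first by rewrite -rR -(RB v) BR.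
  by rewrite (RB v) rR => -[].
have qJ0 : q%:R ^+ J != 0 :> algC.
  by rewrite expf_neq0 // pnatr_eq0 -lt0n (ltn_trans _ (card_field_gt1 F)).
apply: (mulfI qJ0); rewrite mulr0.
have -> : q%:R ^+ J * \sum_(v : 'cV[F]_N) top_of (Y + v *m w)
    = \sum_(v : 'cV[F]_N) \sum_(z : 'cV[F]_J) top_of (Y + (v + E *m z) *m w).
  rewrite exchange_big /= [RHS](eq_bigr (fun=> \sum_(v : 'cV[F]_N) top_of (Y + v *m w))).
    by rewrite sumr_const card_mx muln1 -[RHS]mulr_natl natrX.
  by move=> z _; rewrite [RHS](reindex_inj (addIr (E *m z))).
under eq_bigr do rewrite shift.
rewrite -mulr_suml.
have dNJ : (d <= N - J)%N.
  rewrite -ltnS -rR; apply: leq_trans (mxrank_adds_leqif _ _) _.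
  rewrite -[(N - J).+1]addn1 leq_add ?rank_proj //.
  exact: rank_leq_row.
(* At the extreme d = N - J the recursion for [mcoef] has denominator 0, and it is [T] that
   vanishes. Below it, the two rank classes of [v] cancel. *)
move: dNJ; rewrite leq_eqVlt => /orP[/eqP dE | dlt].
  by rewrite /T (coset_sum_vanish _ (R := R)) ?mulr0 // rR dE.
rewrite (_ : \sum_v _ = 0) ?mul0r //.
have cB : #|[set v : 'cV[F]_N | ~~ (w <= B v)%MS]| = (q ^ (J + d))%N.
  exact: card_sub_update w0 (proj_idem Y).
rewrite (bigID (fun v => w <= B v)%MS) /=.
under eq_bigr => v vB do rewrite rB vB.
under [X in _ + X]eq_bigr => v vB do rewrite rB (negPf vB) mulr1.
rewrite !sumr_const.
have cA : (#|[pred v : 'cV[F]_N | (w <= B v)%MS]| + q ^ (J + d) = q ^ N)%N.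
  rewrite -cB -[in RHS](muln1 N) -card_mx -(cardC [pred v : 'cV[F]_N | (w <= B v)%MS]).
  by congr (_ + _)%N; apply: eq_card => v; rewrite !inE.
have -> : #|[pred v : 'cV[F]_N | ~~ (w <= B v)%MS]| = (q ^ (J + d))%N.
  by rewrite -cB; apply: eq_card => v; rewrite inE.
rewrite -[_ *+ #|_|]mulr_natr -[_ *+ (q ^ _)%N]mulr_natr.
have -> : #|[pred v : 'cV[F]_N | (w <= B v)%MS]|%:R = q%:R ^+ N - q%:R ^+ (J + d) :> algC.
  by rewrite -!natrX -cA natrD addrK.
have D0 : q%:R ^+ N - q%:R ^+ (J + d) != 0 :> algC.
  rewrite subr_eq0 -!natrX eqr_nat eqn_exp2l ?card_field_gt1 // neq_ltn; apply/orP; right; lia.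
rewrite /mcoef big_ord_recr /=.
move: (\prod_(i < d) _) (q%:R ^+ N - q%:R ^+ (J + d)) D0 => M D D0.
rewrite natrX exprD; move: (q%:R ^+ J) (q%:R ^+ d) => x y.
by field.
Qed.
End TopFunctionFromIrr.

(** * Isotypic components of the explicit top function *)

Section SphericalFunction.
Variables (F : finFieldType) (n j : nat).
Local Notation q := #|F|.
Local Notation N := n.-1.+1.
Local Notation J := j.-1.+1.
Local Notation G := (GLgroup_group n F).
Local Notation S := (GLgroup_group j F).
Variables (E : 'M[F]_(N, J)) (L : 'M[F]_(J, N)).
Hypothesis LE : L *m E = 1%:M.
Variable a : Iirr S.
Hypothesis high : (2 * J - N <= true_level 'chi_a)%N.

Local Notation p := (top_of E L a).
Let ptop : top_fun p := top_of_top LE high.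

(** Up to a factor and conjugation, [K] is the kernel of the projection onto the isotypic part of
    ['chi_i] times ['chi_a]. Its squared norm is a multiple of its trace, which is proportional to
    the multiplicity. *)
Lemma mult0_kernel_sum (i : Iirr G) X Y : mult i a = 0 ->
  \sum_g \sum_(s | (GLval g)^T *m X *m GLval s == Y) 'chi_i g * 'chi_a s = 0.
Proof.
move=> m0; pose K X Y := \sum_g \sum_(s | (GLval g)^T *m X *m GLval s == Y) 'chi_i g * 'chi_a s.
pose C : algC := #|G|%:R / chi1 i * (#|S|%:R / chi1 a).
have KK X' : \sum_Y `|K X' Y| ^+ 2
    = C * K X' X'.
  pose w (x : {'GL_n[F]} * {'GL_j[F]}) := 'chi_i x.1 * 'chi_a x.2.
  pose act (x : {'GL_n[F]} * {'GL_j[F]}) := (GLval x.1)^T *m X' *m GLval x.2.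
  have actM (x y : {'GL_n[F]} * {'GL_j[F]}) : (act (x * y)%g == act y) = (act x == X').
    have -> : act (x * y)%g = (GLval y.1)^T *m act x *m GLval y.2.
      by rewrite /act /= -GLvalM -GLval_trM !mulmxA.
    rewrite [act y]/act (inj_eq (can_inj (mulmxK _))) ?GLval_unit //.
    by rewrite (inj_eq (can_inj (mulKmx _))) // unitmx_tr GLval_unit.
  have KE Y' : K X' Y' = \sum_(x | act x == Y') w x.
    by rewrite /K pair_big_dep.
  transitivity (\sum_x \sum_(x' | act x' == act x) w x' * (w x)^*).
    under eq_bigr do rewrite normCK KE rmorph_sum mulr_sumr.
    rewrite (exchange_big_dep xpredT) //=; apply: eq_bigr => x _.
    by rewrite (big_pred1 (act x)) => [|Y']; rewrite ?mulr_suml // eq_sym.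
  under eq_bigr => x _.
    rewrite (reindex_inj (mulIg x)) /=.
    under eq_bigl do rewrite actM.
    over.
  rewrite exchange_big KE mulr_sumr; apply: eq_bigr => x _ /=.
  transitivity ((\sum_g 'chi_i (x.1 * g)%g * ('chi_i g)^*) * (\sum_s 'chi_a (x.2 * s)%g * ('chi_a s)^*)).
    rewrite big_distrlr pair_bigA; apply: eq_bigr => y _ /=.
    by rewrite /w rmorphM mulrACA.
  rewrite (sum_irr_conv_conj (@GLT F n)) (sum_irr_conv_conj (@GLT F j)); exact: mulrACA.
have : \sum_X \sum_Y `|K X Y| ^+ 2 = 0.
  under eq_bigr do rewrite KK.
  rewrite -mulr_sumr /K exchange_big /= (_ : \sum_g _ = 0) ?mulr0 //.
  move/eqP: m0; rewrite /mult !mulf_eq0 !invr_eq0 !(negPf (card_group_neq0 _)) /= -conjC_eq0 => /eqP m0.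
  rewrite -[RHS]m0 rmorph_sum; apply: eq_bigr => g _ /=; rewrite rmorph_sum.
  rewrite (exchange_big_dep xpredT) //=; apply: eq_bigr => s _.
  rewrite sumr_const !rmorphM /= !conjCK -mulrA tau_tensE conjC_nat -[LHS]mulr_natl; congr (_%:R * _).
  by apply: eq_card => Z; rewrite !inE.
move/eqP; rewrite psumr_eq0 => [/allP/(_ X (mem_index_enum X))|X' _]; last first.
  by apply: sumr_ge0 => Y' _; rewrite exprn_ge0.
rewrite psumr_eq0 => [/allP/(_ Y (mem_index_enum Y))|Y' _]; last exact: exprn_ge0.
by rewrite expf_eq0 normr_eq0 => /eqP.
Qed.

Lemma top_of_sect : p E = chi1 a.
Proof.
have pE : proj E L E = 0 by rewrite /proj LE mulmx1 subrr.
rewrite /top_of pE LE mxrank0 /mcoef big_ord0 mul1r (big_pred1 1%g) => [|h].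
  by rewrite -irr_inv invg1.
rewrite eqmx0 submx0 subr_eq0 -(GLval1 F j); apply/eqP/eqP => [|->//].
by case: h => A uA /= AE; apply: val_inj.
Qed.

Lemma top_of_mulr Y s :
  p (Y *m GLval s) = mcoef F n j (\rank (proj E L Y)) *
    \sum_(h : {'GL_j[F]} | ((GLval h - L *m Y)%R <= proj E L Y)%MS) ('chi_a (h * s)%g)^*.
Proof.
have fs : row_free (GLval s) by rewrite row_free_unit GLval_unit.
rewrite /top_of proj_mul mxrankMfree //; congr (_ * _).
rewrite (reindex_inj (mulIg s)) /=; apply: eq_bigl => h.
by rewrite -GLvalM mulmxA -mulmxBl submxMfree.
Qed.

Lemma top_of_isotypic Y : \sum_s 'chi_a s * p (Y *m GLval s) = #|S|%:R / chi1 a * p Y.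
Proof.
under eq_bigr do rewrite top_of_mulr mulrCA mulr_sumr.
rewrite -mulr_sumr exchange_big [RHS]mulrCA; congr (_ * _).
rewrite mulr_sumr; apply: eq_bigr => h _ /=.
have := sum_irr_conv_conj (@GLT F j) a h.
move=> /(congr1 Num.conj); rewrite rmorph_sum [RHS]rmorphM /= conj_Creal; last first.
  by rewrite realM ?realV ?realn // gtr0_real ?chi1_gt0.
by move=> <-; apply: eq_bigr => s _; rewrite rmorphM /= conjCK mulrC.
Qed.

Definition top_proj (i : Iirr G) X := \sum_g 'chi_i g * p ((GLval g)^T *m X).

(** Convolution with [tau ^ (J - 1)] kills top functions, its values being sums of orbit sums for
    matrices [Z] of width J - 1. On the ['chi_i]-component it acts by a nonzero multiple of a
    multiplicity, which must therefore vanish if the component does not. *)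
Lemma top_proj_top i X : top_proj i X != 0 -> top_irr j i.
Proof.
have [phi phiC phiE] := tau_character F n j.-1.
rewrite /top_irr; apply: contraR => nt.
have V Y : \sum_x phi x * p ((GLval x)^T *m Y) = 0.
  under eq_bigr do rewrite phiE tau_natE_trmx -sum1_card natr_sum mulr_suml.
  rewrite (exchange_big_dep xpredT) //= big1 // => Z _.
  transitivity (\sum_(g | (GLval g)^T *m Z == Z) p ((GLval g)^T *m Y)).
    by apply: eq_big => [g|g _]; rewrite ?inE // mul1r.
  by rewrite orbit_sum (top_row_space_vanish _ _ (leqnn _)) ?mulr0.
have : #|G|%:R * tau_mult j.-1 'chi_i / chi1 i * top_proj i X = 0.
  rewrite /top_proj mulr_sumr.
  transitivity (\sum_g 'chi_i g * \sum_x phi x * p ((GLval x)^T *m ((GLval g)^T *m X))); last first.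
    by rewrite big1 // => g _; rewrite V mulr0.
  under [RHS]eq_bigr => g _.
    rewrite (reindex_inj (mulgI g^-1%g)) mulr_sumr.
    under eq_bigr => y _ do rewrite mulmxA GLval_trM mulKVg mulrA.
    over.
  rewrite exchange_big; apply: eq_bigr => y _ /=.
  rewrite -mulr_suml (sum_irr_conv_cfun (@GLT F n)) mulrA; congr (_ / _ * _ * _); congr (_ * _).
  by rewrite cfdotE; congr (_ * _); apply: eq_bigr => g _; rewrite phiE.
move/eqP; rewrite mulf_eq0 => /orP[|//].
by rewrite 2!mulf_eq0 invr_eq0 (negPf (card_group_neq0 _)) (negPf (chi1_neq0 i)) (negPf nt).
Qed.

Lemma top_proj_mult i X : top_proj i X != 0 -> mult i a != 0.
Proof.
apply: contraNneq => m0.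
have : #|S|%:R / chi1 a * top_proj i X = 0.
  transitivity (\sum_g \sum_s ('chi_i g * 'chi_a s) * p ((GLval g)^T *m X *m GLval s)).
    rewrite mulr_sumr; apply: eq_bigr => g _; rewrite mulrCA -top_of_isotypic mulr_sumr.
    by apply: eq_bigr => s _; rewrite mulrA.
  transitivity (\sum_Y (\sum_g \sum_(s | (GLval g)^T *m X *m GLval s == Y) 'chi_i g * 'chi_a s) * p Y).
    under [RHS]eq_bigr do rewrite mulr_suml.
    rewrite [RHS]exchange_big; apply: eq_bigr => g _ /=.
    under [RHS]eq_bigr do rewrite mulr_suml.
    rewrite [RHS](exchange_big_dep xpredT) //=; apply: eq_bigr => s _.
    by rewrite (big_pred1 ((GLval g)^T *m X *m GLval s)) // => Y; rewrite eq_sym.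
  by rewrite big1 // => Y _; rewrite mult0_kernel_sum ?mul0r.
by move/eqP; rewrite 2!mulf_eq0 invr_eq0 (negPf (card_group_neq0 _)) (negPf (chi1_neq0 a)).
Qed.

Lemma top_proj_complete X : \sum_i chi1 i * top_proj i X = #|G|%:R * p X.
Proof.
rewrite /top_proj; under eq_bigr do rewrite mulr_sumr.
rewrite exchange_big (bigD1 1%g) //= [X in _ + X]big1 ?addr0 => [|g g1].
  under eq_bigr do rewrite mulrA.
  by rewrite -mulr_suml sum_chi1_irr eqxx GLval1 trmx1 mul1mx.
under eq_bigr do rewrite mulrA.
by rewrite -mulr_suml sum_chi1_irr (negPf g1) mul0r.
Qed.

Lemma exists_top_irr : exists2 i : Iirr G, top_irr j i & mult i a != 0.
Proof.
have [i ui | u0] := pickP (fun i => top_proj i E != 0).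
  by exists i; [apply: top_proj_top ui | apply: top_proj_mult ui].
have /eqP := top_proj_complete E; rewrite big1 => [|i _]; last first.
  by move/negbFE/eqP: (u0 i) => ->; rewrite mulr0.
rewrite eq_sym mulf_eq0 (negPf (card_group_neq0 _)) top_of_sect.
by rewrite (negPf (chi1_neq0 a)).
Qed.

(** By [top_irr_disjoint] no other character contributes to the explicit function, so averaging over
    the conjugates of [g], a central operation, multiplies it by a scalar; its value at [E] is the
    degree of ['chi_a]. *)
Lemma spherical_sum i g : top_irr j i -> mult i a != 0 ->
  \sum_x p ((GLval (g ^ x)%g)^T *m E) = #|G|%:R * chi1 a / chi1 i * 'chi_i g^-1%g.
Proof.
move=> ti mi.
have pE X : p X = chi1 i / #|G|%:R * top_proj i X.
  apply: (mulfI (card_group_neq0 G)); rewrite -top_proj_complete (bigD1 i) //= big1 ?addr0.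
    by rewrite mulrA mulrCA divff ?card_group_neq0 // mulr1.
  move=> k ki; have [-> | uk] := eqVneq (top_proj k X) 0; first exact: mulr0.
  by rewrite (top_irr_disjoint (top_proj_top uk) ti (top_proj_mult uk) mi) eqxx in ki.
have uE : top_proj i E = #|G|%:R * chi1 a / chi1 i.
  rewrite -top_of_sect pE; move: (chi1 i) (chi1_neq0 i) (card_group_neq0 G) => d d0 G0.
  by field; rewrite d0.
under eq_bigr => x _.
  rewrite pE /top_proj (reindex_inj (mulgI (g ^ x)^-1%g)) /=.
  under eq_bigr do rewrite mulmxA GLval_trM mulKVg -conjVg.
  over.
rewrite -mulr_sumr exchange_big /=.
rewrite (eq_bigr (fun z => #|G|%:R / chi1 i * 'chi_i g^-1%g * ('chi_i z * p ((GLval z)^T *m E)))).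
  rewrite -mulr_sumr -[\sum_g _]/(top_proj i E) uE.
  move: ('chi_i _) (chi1 i) (chi1_neq0 i) (card_group_neq0 G) => c d d0 G0.
  by field; rewrite d0.
by move=> z _; rewrite -mulr_suml (irr_conj_sum (@GLT F n)); ring.
Qed.

End SphericalFunction.

(** * The bijection of (i) to (iii) *)

Section EtaCorrespondence.
Variables (F : finFieldType) (n j : nat).
Hypotheses (j_gt0 : (0 < j)%N) (j_le_n : (j <= n)%N).
Local Notation G := (GLgroup_group n F).
Local Notation S := (GLgroup_group j F).
Implicit Types (i k : Iirr G) (a b : Iirr S).

Let jE : j.-1.+1 = j. Proof. exact: prednK. Qed.
Let nE : n.-1.+1 = n. Proof. by rewrite prednK // (leq_trans j_gt0). Qed.

Lemma Dalpha_constt i a : (i \in irr_constt (Dalpha n a)) = (mult i a != 0).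
Proof. by rewrite irr_consttE Dalpha_coef. Qed.

(** [Dalpha] has at most one constituent that is top, and its multiplicity is a natural number of
    square 1; all other constituents have smaller true level. *)
Lemma Dcirc_iff i a : Dcirc_prop n a i <-> top_irr j i /\ mult i a != 0.
Proof.
split=> [[li H] | [ti mi]].
  have [|ti _] := @true_level_mult F n j i; first by rewrite jE.
  split=> //; rewrite -Dalpha_coef -[Dalpha n a](subrK 'chi_i) cfdotDl cfnorm_irr.
  case: H => [-> | [Dchar _]]; first by rewrite cfdot0l add0r oner_eq0.
  have : 0 <= '[Dalpha n a - 'chi_i, 'chi_i].
    by apply/natr_ge0/Cnat_cfdot_char/irr_char.
  by move=> D0; rewrite gt_eqF // ltr_wpDl ?ltr01.
have m1 : mult i a = 1.
  have := top_irr_mult1 ti mi; move/eqP; rewrite sqrf_eq1 => /orP[/eqP //|/eqP m1].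
  by have := natr_ge0 (mult_nat i a); rewrite m1 oppr_ge0 real_leNgt ?ltr01 ?real1 ?real0.
have coef k : '[Dalpha n a - 'chi_i, 'chi_k] = mult k a *+ (k != i).
  rewrite cfdotBl Dalpha_coef cfdot_irr eq_sym; case: eqVneq => [->|_]; last by rewrite subr0.
  by rewrite m1 subrr.
split; first by rewrite (true_level_top ti mi) jE.
right; split.
  rewrite [_ - _]cfun_sum_cfdot rpred_sum // => k _.
  rewrite coef mulrb; case: ifP => _; last by rewrite scale0r rpred0.
  by have /natrP[m ->] := mult_nat k a; rewrite scaler_nat rpredMn ?irr_char.
move=> k; rewrite irr_consttE coef mulrb; case: ifP => [ki mk|]; last by rewrite eqxx.
rewrite -[X in (_ < X)%N]jE true_level_lt //; apply: contraNN ki => tk.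
by rewrite (top_irr_disjoint tk ti mk mi).
Qed.

Lemma Dalpha_low_level a : (true_level 'chi_a < 2 * j - n)%N ->
  forall i, i \in irr_constt (Dalpha n a) -> (true_level 'chi_i < j)%N.
Proof.
move=> la i; rewrite Dalpha_constt => mi; rewrite -[X in (_ < X)%N]jE; apply: true_level_lt.
by apply: contraNN mi => ti; rewrite top_irr_low_level // jE nE.
Qed.

Lemma exists_unique_Dcirc a : (2 * j - n <= true_level 'chi_a)%N ->
  exists! i : Iirr G, Dcirc_prop n a i.
Proof.
move=> la0; have la : (2 * j.-1.+1 - n.-1.+1 <= true_level 'chi_a)%N by rewrite jE nE.
have LE : (pid_mx j.-1.+1 : 'M[F]_(j.-1.+1, n.-1.+1)) *m pid_mx j.-1.+1 = 1%:M.
  by rewrite pid_mx_id ?jE ?nE // -pid_mx_1.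
have [i ti mi] := exists_top_irr LE la.
exists i; split=> [|k /Dcirc_iff[tk mk]]; first exact/Dcirc_iff.
exact: top_irr_disjoint ti tk mi mk.
Qed.

Lemma exists_unique_alpha i : true_level 'chi_i = j ->
  exists! a : Iirr S, (2 * j - n <= true_level 'chi_a)%N /\ Dcirc_prop n a i.
Proof.
move=> li; have [|ti [a ma]] := @true_level_mult F n j i; first by rewrite jE.
exists a; split=> [|b [_ /Dcirc_iff[_ mb]]]; last exact: top_irr_uniq ti ma mb.
split; last exact/Dcirc_iff.
rewrite leqNgt; apply: contraNN ma => la.
by rewrite top_irr_low_level // jE nE.
Qed.
End EtaCorrespondence.

(** * Counting matrices with invariant column space *)

Section CountingInvariantSubspaces.
Variables (F : finFieldType) (N J : nat).
Local Notation q := #|F|.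

(** With c v = 0 and c u = 1, translating [X] by z c changes X u by z and leaves X v alone, so the
    q^N conditions A X v = X u + z have equally many solutions. *)
Lemma card_linear_condition (A : 'M[F]_N) (v u : 'cV_J) : ~~ (u^T <= v^T)%MS ->
  #|[set X : 'M[F]_(N, J) | A *m X *m v == X *m u]| = (q ^ (N * J - N))%N.
Proof.
move=> uv; have J0 : (0 < J)%N.
  rewrite lt0n; apply: contraNneq uv => J0; rewrite (_ : u^T = 0) ?sub0mx //; apply/eqP.
  by rewrite -mxrank_eq0 -leqn0 (leq_trans (rank_leq_col _)) ?J0.
have qN0 : (0 < q ^ N)%N by rewrite expn_gt0 ltnW ?card_field_gt1.
apply/eqP; rewrite -(eqn_pmul2r qN0) -expnD subnK ?leq_pmulr //; apply/eqP.
have [c cv cu] := not_sub_dual uv.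
rewrite -card_mx -[in X in (_ * X)%N](muln1 N) -card_mx mulnC -sum_nat_const.
transitivity (\sum_(z : 'cV[F]_N) \sum_(X : 'M[F]_(N, J)) (A *m X *m v == X *m u + z)%R)%N.
  apply: eq_bigr => z _; rewrite -sum1_card big_mkcond (reindex_inj (addIr (z *m c))).
  apply: eq_bigr => X _ /=; rewrite inE mulmxDr !mulmxDl -!mulmxA cv cu !mulmx0 addr0 mulmx1.
  by case: eqP.
rewrite exchange_big /=.
transitivity (\sum_(X : 'M[F]_(N, J)) 1)%N; last by rewrite sum1_card.
apply: eq_bigr => X _; rewrite (bigD1 (A *m X *m v - X *m u)) //= addrC subrK eqxx.
rewrite big1 // => z zE; apply/eqP; rewrite eqb0; apply: contraNN zE => /eqP->.
by rewrite addrC addKr.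
Qed.

Lemma scalar_of_eigenvectors (A : 'M[F]_J) :
  (forall v : 'cV_J, ((A *m v)^T <= v^T)%MS) -> exists c, A = c%:M.
Proof.
move=> Av; case: (posnP J) => [J0 | J0].
  by exists 0; apply/matrixP => a; have := ltn_ord a; rewrite [X in (_ < X)%N]J0.
have eig (v : 'cV_J) : exists c, A *m v = c *: v.
  have /sub_rVP[c Ac] := Av v; exists c; apply: trmx_inj.
  by rewrite Ac linearZ.
pose o := Ordinal J0.
exists (A o o); apply/matrixP => a b.
have diag k l : k != l -> A k l = 0.
  move=> kl; have [c /(congr1 (fun M : 'cV_J => M k 0))] := eig (delta_mx l 0).
  by rewrite -colE !mxE (negPf kl) mulr0.
have Aaa k l : k != l -> A k k = A l l.
  move=> kl; have [c Ec] := eig (delta_mx k 0 + delta_mx l 0).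
  have /(congr1 (fun M : 'cV_J => M k 0)) := Ec; have /(congr1 (fun M : 'cV_J => M l 0)) := Ec.
  have lk : l != k by rewrite eq_sym.
  rewrite mulmxDr -!colE !mxE !eqxx (negPf kl) (negPf lk) (diag _ _ kl) (diag _ _ lk).
  by rewrite add0r addr0 => -> ->; rewrite add0r addr0.
rewrite !mxE; have [->|ab] := eqVneq a b; last by rewrite mulr0n diag.
by rewrite mulr1n; have [->//|/Aaa] := eqVneq b o.
Qed.

(** Union bound: either [H] is a scalar [l] and A - l annihilates [X], or A X v = X u for some v <>
    0 and some u = H v outside the line of v. For J = 1 the second summand is 0, which the estimates
    below exploit. *)
Lemma card_invariant_frames (A : 'M[F]_N) : (0 < J)%N ->
  (#|[set X : 'M[F]_(N, J) | (\rank X == J) && [exists H : 'M[F]_J, A *m X == X *m H]]|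
   <= \sum_(l : F | (0 < \rank (kermx (A - l%:M)%R))%N) q ^ (J * \rank (kermx (A - l%:M)%R))
      + q ^ J * ((q ^ J - q) * q ^ (N * J - N)))%N.
Proof.
move=> J0; rewrite -sum1_card big_mkcond /=.
pose B1 (X : 'M[F]_(N, J)) := (\sum_(l : F | 0 < \rank (kermx (A - l%:M)%R)) ((A - l%:M) *m X == 0)%R)%N.
pose B2 (X : 'M[F]_(N, J)) := (\sum_(v : 'cV[F]_J | v != 0%R)
   \sum_(u : 'cV[F]_J | ~~ (u^T <= v^T)%MS) (A *m X *m v == X *m u))%N.
apply: (@leq_trans (\sum_(X : 'M[F]_(N, J)) (B1 X + B2 X))%N).
  apply: leq_sum => X _; rewrite inE; case: ifP => // /andP[/eqP rX /existsP[H /eqP AX]].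
  have [sc | /existsP[v nv]] := boolP [forall v : 'cV[F]_J, ((H *m v)^T <= v^T)%MS].
    have [l Hl] := scalar_of_eigenvectors (fun v => forallP sc v).
    have Xl : (A - l%:M) *m X == 0 by rewrite mulmxBl AX Hl mul_mx_scalar mul_scalar_mx subrr.
    rewrite /B1 (bigD1 l) /= ?Xl -?addnA ?leq_addr // lt0n mxrank_eq0 kermx_eq0.
    rewrite row_free_unit; apply/negP => uA; move: J0; rewrite -rX.
    by rewrite -(mulKmx uA X) (eqP Xl) mulmx0 mxrank0.
  have v0 : v != 0 by apply: contraNneq nv => ->; rewrite mulmx0 trmx0 submx_refl.
  by rewrite /B2 (bigD1 v) //= (bigD1 (H *m v)) //= mulmxA AX eqxx addnCA -!addnA leq_addr.
rewrite big_split leq_add //=.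
  rewrite exchange_big /=; apply: leq_sum => l _.
  rewrite -card_annihilated -sum1_card [X in (_ <= X)%N]big_mkcond leq_sum // => X _; rewrite inE.
  by case: eqP.
rewrite exchange_big /=.
apply: (@leq_trans (\sum_(v : 'cV[F]_J) (q ^ J - q) * q ^ (N * J - N))%N); last first.
  by rewrite sum_nat_const card_mx muln1.
rewrite big_mkcond; apply: leq_sum => v _; case: ifP => // v0.
have cu : #|[set u : 'cV[F]_J | ~~ (u^T <= v^T)%MS]| = (q ^ J - q)%N.
  have c1 : #|[set u : 'cV[F]_J | (u^T <= v^T)%MS]| = q.
    have := card_submx 1 v^T; rewrite mul1n rank_rV trmx_eq0 v0 expn1 => cq.
    rewrite -[RHS]cq -(card_imset _ trmx_inj); apply: eq_card => u; rewrite inE.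
    apply/imsetP/idP => [[w] | uv]; first by rewrite inE => wv ->.
    by exists u^T; rewrite ?trmxK // inE trmxK.
  have := cardsC [set u : 'cV[F]_J | (u^T <= v^T)%MS]; rewrite card_mx muln1 c1 => <-.
  by rewrite addKn; apply: eq_card => u; rewrite !inE.
rewrite exchange_big -cu -sum_nat_const /=.
rewrite [X in (_ <= X)%N]big_mkcond [X in (X <= _)%N]big_mkcond; apply: leq_sum => u _; rewrite inE.
case: ifP => // uv; rewrite -(card_linear_condition A uv) -sum1_card [X in (_ <= X)%N]big_mkcond.
by apply: leq_sum => X _; rewrite inE; case: eqP.
Qed.

Lemma card_not_full : (0 < J)%N ->
  (q ^ (N * J) <= #|[set X : 'M[F]_(N, J) | \rank X == J]| + q ^ J * q ^ (N * J - N))%N.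
Proof.
move=> J0; rewrite -card_mx -(cardsC [set X : 'M[F]_(N, J) | \rank X == J]) leq_add2l.
(* A matrix of rank below [J] kills a nonzero column; X v = 0 is written as a linear condition with
   zero left side. *)
apply: (@leq_trans (\sum_(v : 'cV[F]_J | v != 0%R) #|[set X : 'M[F]_(N, J) | 0%R *m X *m 0%R == X *m v]|)%N).
  under eq_bigr do rewrite -sum1_card big_mkcond.
  rewrite exchange_big -sum1_card big_mkcond; apply: leq_sum => X _ /=; rewrite !inE.
  case: ifP => // rX.
  have /rowV0Pn[w /sub_kermxP wX w0] : kermx X^T != 0.
    by rewrite kermx_eq0 /row_free mxrank_tr rX.
  rewrite (bigD1 w^T) ?trmx_eq0 //= inE mulmx0 eq_sym -trmx_eq0 trmx_mul trmxK wX eqxx.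
  exact: leq_addr.
apply: (@leq_trans (\sum_(v : 'cV[F]_J) q ^ (N * J - N))%N); last first.
  by rewrite sum_nat_const card_mx muln1.
rewrite big_mkcond; apply: leq_sum => v _; case: ifP => // v0.
by rewrite card_linear_condition // trmx0 eqmx0 submx0 trmx_eq0.
Qed.

End CountingInvariantSubspaces.

(** * The character bound *)

Section SphericalBound.
Variables (F : finFieldType) (n j : nat).
Local Notation q := #|F|.
Local Notation N := n.-1.+1.
Local Notation J := j.-1.+1.
Local Notation G := (GLgroup_group n F).
Local Notation S := (GLgroup_group j F).
Hypothesis JN : (2 * J <= N)%N.
Variable a : Iirr S.

Local Notation E := (pid_mx J : 'M[F]_(N, J)).
Local Notation L := (pid_mx J : 'M[F]_(J, N)).

Lemma pid_section : L *m E = 1%:M.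
Proof. by rewrite pid_mx_id -?pid_mx_1 //; lia. Qed.

Local Notation eps := ((q%:R ^+ (N - J) - 1)^-1 : algC).

Let q_gt0 : 0 < q%:R :> algC.
Proof. by rewrite ltr0n (ltn_trans _ (card_field_gt1 F)). Qed.

Let q_ge1 : 1 <= q%:R :> algC.
Proof. by rewrite ler1n (ltn_trans _ (card_field_gt1 F)). Qed.

(** Since J + r < 2J <= N, the power q^N is at least twice q^(J + r). *)
Lemma mcoef_factor r : (r < J)%N ->
  0 < q%:R ^+ N - q%:R ^+ (J + r) :> algC /\
  q%:R ^+ (J + r) / (q%:R ^+ N - q%:R ^+ (J + r)) <= 1 :> algC.
Proof.
move=> rJ.
have H : q%:R ^+ (J + r) *+ 2 <= q%:R ^+ N :> algC.
  apply: le_trans (_ : q%:R ^+ (J + r).+1 <= _); last by rewrite ler_weXn2l //; lia.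
  rewrite [X in _ <= X]exprS -[X in X <= _]mulr_natl ler_wpM2r ?exprn_ge0 ?(ltW q_gt0) //.
  by rewrite ler_nat card_field_gt1.
have P : 0 < q%:R ^+ (J + r) :> algC by rewrite exprn_gt0.
have D : q%:R ^+ (J + r) <= q%:R ^+ N - q%:R ^+ (J + r) :> algC.
  by rewrite lerBrDr -mulr2n.
have D0 := lt_le_trans P D; split=> //.
by rewrite ler_pdivrMr // mul1r.
Qed.

(** [eps] is the exact value for r = 1; each further step multiplies by q^(J + r) / (q^N - q^(J +
    r)) <= 1. *)
Lemma mcoef_bound r : (r <= J)%N -> `|mcoef F n j r| * q%:R ^+ (J * r) <= (r == 0%N)%:R + eps.
Proof.
have eps0 : 0 <= eps by rewrite invr_ge0 subr_ge0 exprn_ege1.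
case: r => [_ | r]; first by rewrite muln0 mulr1 /mcoef big_ord0 normr1 lerDl.
rewrite add0r; elim: r => [_ | r IHr rJ].
  have [|D0 _] := mcoef_factor (r := 0); first by [].
  rewrite /mcoef big_ord_recr big_ord0 /= mul1r normrN muln1 addn0 normrM normfV expr0 normr1 mul1r.
  rewrite addn0 in D0; rewrite gtr0_norm //.
  have qN : q%:R ^+ N = q%:R ^+ J * q%:R ^+ (N - J) :> algC by rewrite -exprD subnKC //; lia.
  have qJ : q%:R ^+ J != 0 :> algC by rewrite expf_neq0 // gt_eqF.
  by rewrite qN -{2}[q%:R ^+ J]mulr1 -mulrBr invfM mulrC mulrA divff // mul1r.
have [|D0 le1] := mcoef_factor (r := r.+1); first by [].
apply: le_trans (IHr (ltnW rJ)); rewrite /mcoef big_ord_recr /= normrM normrN.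
rewrite normrM normfV (gtr0_norm D0) normrX (ger0_norm (ltW q_gt0)).
move: (normr_ge0 (\prod_(i < r.+1) - (q%:R ^+ i / (q%:R ^+ N - q%:R ^+ (J + i)) : algC))).
move: `|_| (_ - _) D0 le1 => M D D0 le1 M0.
have -> : M * (q%:R ^+ r.+1 / D) * q%:R ^+ (J * r.+2)
    = (M * q%:R ^+ (J * r.+1)) * (q%:R ^+ (J + r.+1) / D) by rewrite (mulnS J) !exprD; ring.
by rewrite ler_piMr // mulr_ge0 ?exprn_ge0 ?(ltW q_gt0).
Qed.

Lemma top_of_bound X : `|top_of E L a X| <= chi1 a * ((proj E L X == 0)%:R + eps).
Proof.
rewrite /top_of normrM; set r := \rank _.
have rJ : (r <= J)%N by exact: rank_leq_col.
rewrite -mxrank_eq0 -/r mulrC.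
have C : `|\sum_(h : {'GL_j[F]} | ((GLval h - L *m X)%R <= proj E L X)%MS) ('chi_a h)^*|
    <= chi1 a * q%:R ^+ (J * r).
  apply: le_trans (ler_norm_sum _ _ _) _.
  apply: le_trans (ler_sum _ (_ : forall h, _ -> _ <= chi1 a)) _ => [h _|].
    by rewrite norm_conjC char1_ge_norm ?irr_char.
  rewrite sumr_const -[X in X <= _]mulr_natr ler_wpM2l ?(ltW (chi1_gt0 _)) // -natrX ler_nat -card_submx.
  have fI : injective (fun h : {'GL_j[F]} => GLval h - L *m X).
    by move=> [A uA] [B uB] /= /addIr AB; apply: val_inj.
  rewrite -(card_imset _ fI); apply: subset_leq_card; apply/subsetP => Z /imsetP[h hX ->].
  by rewrite inE.
apply: le_trans (ler_wpM2r (normr_ge0 _) C) _.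
rewrite -mulrA ler_wpM2l ?(ltW (chi1_gt0 _)) // mulrC; exact: mcoef_bound.
Qed.

Definition frames := [set X : 'M[F]_(N, J) | \rank X == J].
Definition invariant_frames (A : 'M[F]_N) :=
  [set X : 'M[F]_(N, J) | (\rank X == J) && [exists H : 'M[F]_J, A *m X == X *m H]].

(** As [x] varies, (x^-1)^T E is uniformly distributed over the matrices of rank [J], and the
    vanishing of [proj] means that g^T preserves its column space. *)
Lemma card_invariant_conj g :
  (#|[set x : {'GL_n[F]} | proj E L ((GLval (g ^ x)%g)^T *m E) == 0%R]| * #|frames|
   <= #|G| * #|invariant_frames (GLval g)^T|)%N.
Proof.
pose f (x : {'GL_n[F]}) := (GLval x^-1%g)^T *m E.
have rE : \rank E = J := rank_E pid_section.
have fJ x : f x \in frames by rewrite inE (eqmxMfull E) ?rE // row_full_unit unitmx_tr GLval_unit.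
have fib X : X \in frames -> #|[set x | f x == X]| = #|[set x | f x == E]|.
  rewrite inE => /eqP rX; have [P uP XP] : exists2 P : 'M_N, P \in unitmx & X = P *m E.
    apply/eqmxMunitP/andP; split; apply: (@submx_trans _ _ _ _ _ _ 1%:M); rewrite ?submx1 // sub1mx.
      by rewrite /row_full rE.
    by rewrite /row_full rX.
  have [h hP] : {h : {'GL_n[F]} | GLval h = P^T} by apply: exists_GL; rewrite unitmx_tr.
  rewrite -[in RHS](card_imset _ (mulgI h^-1%g)); apply: eq_card => x.
  rewrite -[in RHS](mulKg h x) (mem_imset _ _ (mulgI h^-1%g)) !inE /f invMg -GLval_trM -mulmxA XP.
  have hU : (GLval h^-1%g)^T \in unitmx by rewrite unitmx_tr GLval_unit.
  by rewrite -[P]trmxK -hP -[in LHS](inj_eq (can_inj (mulKmx hU))) GLKV.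
have cG : (#|G| = #|frames| * #|[set x | f x == E]|)%N.
  transitivity (\sum_(X in frames) #|[set x | f x == X]|)%N.
    rewrite -sum1_card (partition_big f (mem frames)) /=; last by move=> x _; exact: fJ.
    by apply: eq_bigr => X _; rewrite -sum1_card; apply: eq_bigl => x; rewrite !inE.
  by rewrite (eq_bigr _ fib) sum_nat_const.
have cB : (#|[set x : {'GL_n[F]} | proj E L ((GLval (g ^ x)%g)^T *m E) == 0%R]|
     <= #|invariant_frames (GLval g)^T| * #|[set x | f x == E]|)%N.
  rewrite -sum_nat_const -sum1_card (partition_big f (mem (invariant_frames (GLval g)^T))) /=.
    apply: leq_sum => X; rewrite inE => /andP[rX _]; rewrite -(fib X) ?inE // -sum1_card.
    rewrite [X in (X <= _)%N]big_mkcond [X in (_ <= X)%N]big_mkcond; apply: leq_sum => x _.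
    by rewrite !inE; case: (f x == X); rewrite ?andbF //; case: ifP.
  move=> x; rewrite !inE => /eqP H; apply/andP; split.
    by have := fJ x; rewrite inE.
  apply/existsP; exists (L *m ((GLval (g ^ x)%g)^T *m E)); move/eqP: H.
  rewrite /proj subr_eq0 => /eqP WE; rewrite /f -[X in _ == X]mulmxA -WE !mulmxA !GLval_trM.
  by rewrite conjgE !mulgA mulgK.
by rewrite cG mulnC -mulnA leq_mul2l [X in (_ <= X)%N]mulnC cB orbT.
Qed.

Lemma char_bound i g : top_irr j i -> mult i a != 0 ->
  `|'chi_i g| <= chi1 i * (#|invariant_frames (GLval g)^T|%:R / #|frames|%:R + eps).
Proof.
move=> ti mi.
have high : (2 * J - N <= true_level 'chi_a)%N by move: JN; rewrite -subn_eq0 => /eqP->.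
have sph := spherical_sum pid_section high g ti mi.
have G0 : 0 < #|G|%:R :> algC by rewrite ltr0n cardG_gt0.
have fr0 : 0 < #|frames|%:R :> algC.
  by rewrite ltr0n; apply/card_gt0P; exists E; rewrite inE (rank_E pid_section).
have c1 : 0 < #|G|%:R * chi1 a / chi1 i.
  by rewrite !mulr_gt0 ?invr_gt0 ?chi1_gt0.
have -> : `|'chi_i g| = `|\sum_x top_of E L a ((GLval (g ^ x)%g)^T *m E)| / (#|G|%:R * chi1 a / chi1 i).
  rewrite sph normrM (gtr0_norm c1) mulrC mulKf ?gt_eqF //.
  by rewrite irr_inv norm_conjC.
rewrite ler_pdivrMr //.
apply: le_trans (ler_norm_sum _ _ _) _.
apply: le_trans (ler_sum _ (fun x _ => top_of_bound ((GLval (g ^ x)%g)^T *m E))) _.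
rewrite -mulr_sumr big_split /= -[\sum_x eps](sum_in_full (@GLT F n)) sumr_const.
set B : algC := \sum_x _.
have BE : B = #|[set x : {'GL_n[F]} | proj E L ((GLval (g ^ x)%g)^T *m E) == 0]|%:R.
  by rewrite -sum1_card natr_sum [RHS]big_mkcond; apply: eq_bigr => x _; rewrite inE; case: eqP.
have Ble : B <= #|G|%:R * (#|invariant_frames (GLval g)^T|%:R / #|frames|%:R).
  by rewrite mulrA ler_pdivlMr // BE -!natrM ler_nat card_invariant_conj.
have -> : chi1 i * (#|invariant_frames (GLval g)^T|%:R / #|frames|%:R + eps) * (#|G|%:R * chi1 a / chi1 i)
    = chi1 a * (#|G|%:R * (#|invariant_frames (GLval g)^T|%:R / #|frames|%:R) + eps *+ #|G|).
  rewrite -[eps *+ _]mulr_natr.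
  move: (_ / _) eps (chi1 i) (chi1_neq0 i) => r e d d0; field; exact: d0.
by rewrite ler_wpM2l ?(ltW (chi1_gt0 _)) // lerD2r.
Qed.

End SphericalBound.

(** * Numerical estimates *)

Section RationalPowers.
Implicit Types (x y c T X : algC) (r s : rat).

Lemma rpow_ge0 x r : 0 <= x -> 0 <= rpow x r.
Proof. by move=> x0; rewrite /rpow exprz_ge0 // rootC_ge0 // absz_gt0 denq_neq0. Qed.

(** The fraction need not be reduced, so exponents are compared through numq r * (m + 1) = denq r *
    p. *)
Lemma rpowX x (p m : nat) : 0 <= x -> rpow x (p%:Q / m.+1%:Q) ^+ m.+1 = x ^+ p.
Proof.
move=> x0; rewrite /rpow; set r := _ / _.
have d0 : (0 < `|denq r|)%N by rewrite absz_gt0 denq_neq0.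
have r0 : 0 <= r by rewrite divr_ge0 ?ler0z.
have [k kE] : exists k : nat, numq r = k%:Z.
  by exists `|numq r|%N; rewrite gez0_abs // numq_ge0.
rewrite kE -exprnP -exprM.
have -> : (k * m.+1 = `|denq r| * p)%N.
  have : r * m.+1%:Q = p%:Q by rewrite divfK // intr_eq0.
  have dQ : (denq r)%:Q != 0 by rewrite intr_eq0 denq_neq0.
  rewrite -{1}[r]divq_num_den kE mulrAC => /(canRL (divfK dQ)) /eqP.
  rewrite -[denq r]gez0_abs ?denq_ge0 // -!intrM -!PoszM eqr_int => /eqP[->].
  exact: mulnC.
by rewrite exprM rootCK.
Qed.

Lemma rpow_le x r s : 1 <= x -> 0 <= r -> r <= s -> rpow x r <= rpow x s.
Proof.
move=> x1 r0 rs; have x0 : 0 <= x by rewrite (le_trans ler01).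
have frac t : 0 <= t -> exists p m : nat, t = p%:Q / m.+1%:Q.
  move=> t0; exists `|numq t|%N, `|denq t|.-1%N; rewrite prednK ?absz_gt0 ?denq_neq0 //.
  by rewrite !gez0_abs ?denq_ge0 ?numq_ge0 // divq_num_den.
have [p [m rE]] := frac r r0; have [p' [m' sE]] := frac s (le_trans r0 rs).
rewrite -(ler_pXn2r (n := m.+1 * m'.+1)) ?nnegrE ?rpow_ge0 ?muln_gt0 //.
rewrite [X in X <= _]exprM rE rpowX // mulnC [X in _ <= X]exprM sE rpowX // -!exprM.
rewrite ler_weXn2l //; move: rs; rewrite rE sE ler_pdivrMr ?ltr0z // mulrAC ler_pdivlMr ?ltr0z //.
by rewrite -!intrM ler_int.
Qed.

(** The level is [J.+1] here. Raised to the power 2(J + 1), the claim is T^(2(J + 1)) x < c^(2(J +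
    1)), which follows from the (J + 1)-st power of T^2 X < c^2. *)
Lemma lt_rpow_root2 x T X c (J : nat) : 0 < x -> 0 <= T -> 0 < c -> 0 <= X -> x <= X ^+ J.+1 ->
  T ^+ 2 * X < c ^+ 2 -> T * x < c * rpow x (1 - (2 * J.+1)%:Q^-1).
Proof.
move=> x0 T0 c0 X0 xX TX.
have rE : 1 - (2 * J.+1)%:Q^-1 = (2 * J + 1)%N%:Q / (2 * J).+2%:Q.
  have d0 : (2 * J).+2%:Q != 0 by rewrite intr_eq0.
  have -> : (2 * J.+1)%:Q = (2 * J).+2%:Q by congr (_%:~R); lia.
  apply: (mulIf d0); rewrite divfK // mulrBl mul1r mulVf //.
  by rewrite -[1]/(1%N%:Q) -intrB; congr (_%:~R); lia.
rewrite rE -(ltr_pXn2r (n := (2 * J).+2)) ?nnegrE ?mulr_ge0 ?rpow_ge0 ?(ltW c0) ?(ltW x0) //.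
rewrite !exprMn rpowX ?(ltW x0) // addn1.
have -> : T ^+ (2 * J).+2 * x ^+ (2 * J).+2 = (T ^+ 2) ^+ J.+1 * x * x ^+ (2 * J).+1.
  by rewrite -exprM mulnS add2n (exprS x) mulrA.
have -> : c ^+ (2 * J).+2 = (c ^+ 2) ^+ J.+1 by rewrite -exprM mulnS add2n.
rewrite ltr_pM2r ?exprn_gt0 //.
apply: le_lt_trans (_ : (T ^+ 2 * X) ^+ J.+1 < _).
  by rewrite [X in _ <= X]exprMn ler_wpM2l ?exprn_ge0.
by rewrite ltr_pXn2r ?nnegrE ?mulr_ge0 ?exprn_ge0 // ltW.
Qed.

(** [y] stands for an upper bound of x^(1 - D/(m + 1)). *)
Lemma lt_rpow_ratio x T y c (D m : nat) : 0 < x -> 0 <= T -> 0 < c -> 0 <= y -> (D <= m.+1)%N ->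
  x ^+ (m.+1 - D) <= y ^+ m.+1 -> T * y < c -> T * x < c * rpow x (D%:Q / m.+1%:Q).
Proof.
move=> x0 T0 c0 y0 Dm xy Ty.
rewrite -(ltr_pXn2r (n := m.+1)) ?nnegrE ?mulr_ge0 ?rpow_ge0 ?(ltW c0) ?(ltW x0) //.
rewrite !exprMn rpowX ?(ltW x0) //.
have -> : x ^+ m.+1 = x ^+ (m.+1 - D) * x ^+ D by rewrite -exprD subnK.
rewrite mulrA ltr_pM2r ?exprn_gt0 //.
apply: le_lt_trans (_ : (T * y) ^+ m.+1 < _).
  by rewrite exprMn ler_wpM2l ?exprn_ge0.
by rewrite ltr_pXn2r ?nnegrE ?mulr_ge0 // ltW.
Qed.
End RationalPowers.

Section Estimates.
Variables (R : realFieldType) (q N J : nat).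
Hypotheses (q_ge2 : (1 < q)%N) (J_gt0 : (0 < J)%N).
Local Notation Z := (q ^ (N * J))%N.
Local Notation s := (q ^ J * ((q ^ J - q) * q ^ (N * J - N)))%N.
Local Notation t := (q ^ J * q ^ (N * J - N))%N.
Local Notation eps := ((q%:R ^+ (N - J) - 1)^-1 : R).

(** From (T1 + k)^2 <= (1 + 1/8) T1^2 + (1 + 8) k^2 and 9/8 * 2.3 + 9/32 < 2.87 < 1.76^2. *)
Lemma sum_square_bound (T1 k X : R) : 0 <= T1 -> 0 <= k -> 0 <= X ->
  T1 ^+ 2 * X <= 23%:R / 10%:R -> k ^+ 2 * X <= 32%:R^-1 ->
  (T1 + k) ^+ 2 * X < (176%:R / 100%:R) ^+ 2.
Proof.
move=> T0 k0 X0 TX kX.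
have H : (T1 + k) ^+ 2 <= 9%:R / 8%:R * T1 ^+ 2 + 9%:R * k ^+ 2.
  rewrite -subr_ge0 (_ : _ - _ = (T1 - 8%:R * k) ^+ 2 / 8%:R); last by field.
  by rewrite divr_ge0 ?sqr_ge0.
by apply: le_lt_trans (ler_wpM2r X0 H) _; lra.
Qed.

Lemma two_expn_le a k m : (k + m <= a)%N -> (2 ^ k * q ^ m <= q ^ a)%N.
Proof.
move=> kma; apply: leq_trans (_ : q ^ k * q ^ m <= _)%N.
  by rewrite leq_mul2r; apply/orP; right; case: (k) => // k'; rewrite leq_exp2r.
by rewrite -expnD leq_pexp2l // ltnW.
Qed.

Lemma frame_defect k : (k + J <= N)%N -> (2 ^ k * t <= Z)%N.
Proof. 
move=> kJ; rewrite -expnD two_expn_le //.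
have : (N <= N * J)%N by rewrite leq_pmulr.
by lia.
Qed.

Lemma nonscalar_part k m : (1 < J -> m + 2 * J + k <= N)%N -> (2 ^ k * (q ^ m * s) <= Z)%N.
Proof.
move=> kJ; have [J1 | J1 | <-] := ltngtP 1%N J.
- apply: leq_trans (_ : 2 ^ k * q ^ (m + (J + (J + (N * J - N)))) <= _)%N.
    by rewrite !expnD !leq_mul2l !leq_mul2r leq_subr !orbT.
  have : (N <= N * J)%N by rewrite leq_pmulr.
  by move=> NJ; apply: two_expn_le; have := kJ J1; lia.
- by move: J_gt0; rewrite leqNgt J1.
by rewrite expn1 subnn mul0n !muln0.
Qed.

Lemma noncentral_estimate b cnt fr : (3 * J ^ 2 + 3 * J + 5 <= 2 * N)%N ->
  (N.-1 * b <= N * q ^ (J * N.-1))%N -> (cnt <= b + s)%N -> (Z <= fr + t)%N ->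
  (cnt%:R / fr%:R + eps) * q%:R ^+ J < 176%:R / 100%:R.
Proof.
move=> JN bD cntb Zfr.
have J2 : (J <= J ^ 2)%N by rewrite -{1}[J]expn1 leq_pexp2l.
have JJ : (1 < J -> 2 * J <= J ^ 2)%N by move=> J1; rewrite expnS expn1 leq_mul2r J1 orbT.
(* N >= 6 gives N / (N - 1) <= 6/5. With the next three bounds, the counted part is at most (6/5 +
   1/16) / (31/32) < 1.4 and the part from [eps] at most 1/8. *)
have b6 : (5 * (q ^ J * b) <= 6 * Z)%N.
  have N1 : (0 < N.-1)%N by lia.
  rewrite -(leq_pmul2l N1) mulnCA.
  apply: leq_trans (_ : 5 * (N * Z) <= _)%N.
    rewrite leq_mul2l /= mulnCA.
    apply: leq_trans (leq_mul (leqnn (q ^ J)) bD) _.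
    rewrite mulnCA leq_mul2l -expnD -{1}[J]muln1 -mulnDr add1n prednK ?(mulnC J) ?leqnn ?orbT //.
    by lia.
  by rewrite !mulnA leq_mul2r; apply/orP; right; lia.
have s16 : (2 ^ 4 * (q ^ J * s) <= Z)%N by apply: nonscalar_part; lia.
have t32 : (2 ^ 5 * t <= Z)%N by apply: frame_defect; case: (ltngtP J 1); lia.
have W : (2 ^ 4 * q ^ J <= q ^ (N - J))%N.
  by apply: two_expn_le; case: (ltngtP J 1); lia.
have Z0 : (0 < Z)%N by rewrite expn_gt0 ltnW.
have qJ0 : (0 < q ^ J)%N by rewrite expn_gt0 ltnW.
have yc : (q ^ J * cnt <= q ^ J * b + q ^ J * s)%N by rewrite -mulnDr leq_mul2l cntb orbT.
rewrite -!natrX.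
move: b6 s16 t32 W Zfr yc Z0 qJ0.
move: (q ^ J * s)%N => s'; move: t => t'; move: Z => Z'.
move: (q ^ J)%N (q ^ (N - J))%N => y w.
move: (y * b)%N => yb b6 s16 t32 W Zfr yc Z0 y0.
have fr0 : (0 < fr)%N by lia.
have y0R : 0 < y%:R :> R by rewrite ltr0n.
have fr0R : 0 < fr%:R :> R by rewrite ltr0n.
have w1 : 8%:R * y%:R <= w%:R - 1 :> R.
  by rewrite lerBrDr -natrM -[1]/(1%:R) -natrD ler_nat; lia.
have E1 : (w%:R - 1)^-1 * y%:R <= 8%:R^-1 :> R.
  have w0 : 0 < w%:R - 1 :> R by apply: lt_le_trans w1; rewrite mulr_gt0.
  by rewrite mulrC ler_pdivrMr // mulrC ler_pdivlMr // mulrC.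
have E2 : cnt%:R / fr%:R * y%:R <= 14%:R / 10%:R :> R.
  rewrite mulrAC ler_pdivrMr // mulrAC ler_pdivlMr // -!natrM ler_nat; lia.
lra.
Qed.

Lemma scaled_defect_le (p x y z : R) : 0 <= p -> 256%:R * x + 510%:R * y <= 510%:R * z ->
  256%:R / 255%:R * (x * p) + 2%:R * y * p <= 2%:R * z * p.
Proof. by move=> p0 /(ler_wpM2r p0); lra. Qed.

Lemma square_defect_le (x y z t : R) : (255%:R * y) ^+ 2 <= (256%:R * z) ^+ 2 ->
  100%:R * (x ^+ 2 * t) <= 228%:R * y ^+ 2 -> x ^+ 2 * t <= 23%:R / 10%:R * z ^+ 2.
Proof.
by rewrite !exprMn; move: (x ^+ 2 * t) (y ^+ 2) (z ^+ 2) (sqr_ge0 z) => u v w w0; lra.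
Qed.

Lemma small_level_estimate b cnt fr X : (3 * J ^ 2 + J + 5 <= N)%N ->
  (cnt <= b + s)%N -> (Z <= fr + t)%N -> (X <= q ^ N)%N -> (100 * (b ^ 2 * X) <= 228 * Z ^ 2)%N ->
  (cnt%:R / fr%:R + eps) ^+ 2 * X%:R < (176%:R / 100%:R) ^+ 2.
Proof.
move=> JN cntb Zfr XN bX.
have JJ : (1 < J -> 2 * J <= J ^ 2)%N by move=> J1; rewrite expnS expn1 leq_mul2r J1 orbT.
have J2 : (J <= J ^ 2)%N by rewrite -{1}[J]expn1 leq_pexp2l.
have NJ : (N <= N * J)%N by rewrite leq_pmulr.
have J1N : (J < N)%N by lia.
(* A / q^N bounds s / Z, and q^k is such that 2 q^k / q^N absorbs both the nonscalar matrices and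
   [eps], while its square times q^N stays within 4/128 = 1/32. For J = 1, where s = 0, k = 1 works
   and N >= 9 is just enough. *)
have [k K128 [A sA AK]] : exists2 k, (2 ^ 7 * q ^ (2 * k) <= q ^ N)%N &
    exists2 A, (s * q ^ N <= A * Z)%N & (256 * A + 510 * q ^ J <= 510 * q ^ k)%N.
  have [J1 | J1 | J1] := ltngtP 1%N J; last 2 first.
  - by move: J_gt0; rewrite leqNgt J1.
  - exists 1%N; first by apply: two_expn_le; lia.
    by exists 0%N; rewrite -J1 expn1 ?subnn ?mul0n ?muln0.
  exists (2 * J)%N; first by apply: two_expn_le; have := JJ J1; lia.
  exists (q ^ (2 * J))%N.
    rewrite -!mulnA -expnD subnK // mul2n -addnn expnD -!mulnA !leq_mul2l.
    by rewrite leq_mul2r leq_subr !orbT.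
  have : (2 ^ 2 * q ^ J <= q ^ (2 * J))%N by apply: two_expn_le; lia.
  lia.
have t256 : (2 ^ 8 * t <= Z)%N by apply: frame_defect; lia.
have Z0 : (0 < Z)%N by rewrite expn_gt0 ltnW.
have P0 : (0 < q ^ N)%N by rewrite expn_gt0 ltnW.
have y0 : (0 < q ^ J)%N by rewrite expn_gt0 ltnW.
have PE : (q ^ N = q ^ J * q ^ (N - J))%N by rewrite -expnD subnKC // ltnW.
have w2 : (2 <= q ^ (N - J))%N.
  by apply: leq_trans q_ge2 _; rewrite -{1}[q]expn1 leq_pexp2l ?subn_gt0 // ltnW.
rewrite -natrX; move: K128; rewrite mulnC (mulnC 2%N) expnM.
move: sA AK t256 Zfr XN bX cntb Z0 P0 y0 PE w2.
move: s => s'; move: t => t'; move: Z => Z'.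
move: (q ^ J)%N (q ^ (N - J))%N (q ^ N)%N (q ^ k)%N => y w P K.
move=> sA AK t256 Zfr XN bX cntb Z0 P0 y0 PE w2 K128.
have fr0 : (0 < fr)%N by lia.
have fZ : (255 * Z' <= 256 * fr)%N by lia.
have frR : 0 < fr%:R :> R by rewrite ltr0n.
have PR : 0 < P%:R :> R by rewrite ltr0n.
pose kap : R := 2%:R * K%:R / P%:R.
have epsE : (w%:R - 1)^-1 <= 2%:R * y%:R / P%:R :> R.
  have w1 : 0 < w%:R - 1 :> R by rewrite subr_gt0 ltr1n.
  rewrite PE natrM -mulrA invfM [y%:R * _]mulrA divff ?pnatr_eq0 -?lt0n // mul1r.
  rewrite -[X in X <= _]mul1r ler_pdivrMr // mulrAC ler_pdivlMr ?ltr0n; last by lia.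
  by rewrite mul1r mulrBr mulr1 lerBrDr -natrM -!natrD ler_nat; lia.
have sE : s'%:R / fr%:R <= 256%:R / 255%:R * (A%:R / P%:R) :> R.
  rewrite ler_pdivrMr // (_ : _ * fr%:R = (256 * (A * fr))%N%:R / (255 * P)%N%:R); last first.
    by rewrite !natrM; field; rewrite gt_eqF.
  rewrite ler_pdivlMr ?ltr0n ?muln_gt0 //= -natrM ler_nat.
  have AZ : (A * (255 * Z') <= A * (256 * fr))%N by rewrite leq_mul2l fZ orbT.
  move: sA AZ; rewrite !(mulnCA A) (mulnCA s').
  by move: (s' * P)%N (A * Z')%N (A * fr)%N; clear; lia.
have Tle : cnt%:R / fr%:R + (w%:R - 1)^-1 <= b%:R / fr%:R + kap.
  have cE : cnt%:R / fr%:R <= b%:R / fr%:R + s'%:R / fr%:R :> R.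
    by rewrite -mulrDl ler_pM2r ?invr_gt0 // -natrD ler_nat.
  have kE : 256%:R / 255%:R * (A%:R / P%:R) + 2%:R * y%:R / P%:R <= kap.
    have AKR : 256%:R * A%:R + 510%:R * y%:R <= 510%:R * K%:R :> R.
      by rewrite -!natrM -natrD ler_nat.
    have P0R : 0 <= P%:R^-1 :> R by rewrite invr_ge0 ler0n.
    exact: scaled_defect_le P0R AKR.
  lra.
have T0 : 0 <= cnt%:R / fr%:R + (w%:R - 1)^-1 :> R.
  by rewrite addr_ge0 ?divr_ge0 ?ler0n // invr_ge0 subr_ge0 ler1n ltnW.
apply: le_lt_trans (_ : (b%:R / fr%:R + kap) ^+ 2 * X%:R < _).
  by rewrite ler_wpM2r ?ler0n // lerXn2r ?nnegrE // (le_trans T0).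
have bXR : 100%:R * (b%:R ^+ 2 * X%:R) <= 228%:R * Z'%:R ^+ 2 :> R.
  by rewrite -!natrX -!natrM ler_nat.
have KXR : 128%:R * (K%:R ^+ 2 * X%:R) <= P%:R ^+ 2 :> R.
  rewrite -!natrX -!natrM ler_nat mulnA (mulnC 128); exact: leq_mul K128 XN.
have fZR : (255%:R * Z'%:R) ^+ 2 <= (256%:R * fr%:R) ^+ 2 :> R.
  by rewrite lerXn2r ?nnegrE ?mulr_ge0 ?ler0n // -!natrM ler_nat.
apply: sum_square_bound; rewrite ?divr_ge0 ?mulr_ge0 ?ler0n //.
  rewrite exprMn exprVn mulrAC ler_pdivrMr ?exprn_gt0 //.
  exact: square_defect_le fZR bXR.
rewrite /kap exprMn exprVn mulrAC ler_pdivrMr ?exprn_gt0 //.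
by move: KXR; rewrite !exprMn; move: (K%:R ^+ 2) (P%:R ^+ 2) X%:R => u v x; lra.
Qed.
End Estimates.

(** * Eigenspaces and the bounds for fixed true level *)

Section EigenspaceCounting.
Variables (F : finFieldType) (N : nat) (A : 'M[F]_N).
Local Notation q := #|F|.
Implicit Types (P : pred F) (l : F) (D J : nat).

Definition eigdim l := \rank (kermx (A - l%:M)).

Lemma sum_eigdim_le P : (\sum_(l | P l) eigdim l <= N)%N.
Proof.
have /mxdirectP /= <- : mxdirect (\sum_(l | P l) eigenspace A l).
  by apply: mxdirect_sum_eigenspace => x y.
exact: rank_leq_row.
Qed.

Lemma eigdim_le l : (eigdim l <= N)%N.
Proof. exact: rank_leq_row. Qed.

Lemma eigdim_full l : eigdim l = N -> A = l%:M.
Proof.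
move=> eN; apply/eqP; rewrite -subr_eq0 -mxrank_eq0.
move: eN (rank_leq_row (A - l%:M)); rewrite /eigdim mxrank_ker.
by move: (\rank (A - l%:M)) => r rN rN'; rewrite -leqn0 -(subKn rN') rN subnn.
Qed.

(** x^e / e does not decrease in e >= 1, so eigenspace sums can be bounded as if every eigenspace
    had the maximal dimension [D]. *)
Lemma expn_convex x e D : (1 < x)%N -> (0 < e <= D)%N -> (D * x ^ e <= e * x ^ D)%N.
Proof.
move=> x1 /andP[e0 eD]; rewrite -{2}(subnK eD) expnD mulnA leq_mul2r; apply/orP; right.
apply: leq_trans (_ : e * (D - e).+1 <= _)%N; last by rewrite leq_mul2l ltn_expl ?orbT.
rewrite -{1}(subnK eD) mulnS addnC leq_add2l -{1}[(D - e)%N]mul1n leq_mul2r e0 orbT //.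
Qed.

Lemma sum_eigenspace_le P D J : (0 < J)%N -> (forall l, P l -> eigdim l <= D)%N ->
  (D * \sum_(l | P l && (0 < eigdim l)) q ^ (J * eigdim l)
     <= (\sum_(l | P l) eigdim l) * q ^ (J * D))%N.
Proof.
move=> J0 eD; rewrite big_distrr big_distrl /= big_mkcondr /=; apply: leq_sum => l Pl.
case: ifP => // e0; rewrite !expnM; apply: expn_convex; last by rewrite e0 eD.
by apply: leq_trans (card_field_gt1 F) _; rewrite -{1}[q]expn1 leq_pexp2l // ltnW ?card_field_gt1.
Qed.

Lemma dominant_eigenspace_le l0 J : (0 < J)%N -> (N < 2 * eigdim l0)%N -> (eigdim l0 < N)%N ->
  (\sum_(l | 0 < eigdim l) q ^ (J * eigdim l)
     <= q ^ (J * eigdim l0) + q ^ (J * (N - eigdim l0)))%N.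
Proof.
move=> J0 D2 DN; rewrite (bigD1 l0) /=; last by lia.
have S : (\sum_(l | l != l0) eigdim l <= N - eigdim l0)%N.
  by have := sum_eigdim_le predT; rewrite (bigD1 l0) //=; lia.
rewrite leq_add2l -(leq_pmul2l (_ : 0 < N - eigdim l0)%N) ?subn_gt0 //.
rewrite (eq_bigl (fun l => (l != l0) && (0 < eigdim l))%N) => [|l]; last exact: andbC.
apply: leq_trans (sum_eigenspace_le J0 _) _; last by rewrite leq_mul2r S orbT.
by move=> l ll0; apply: leq_trans S; rewrite (bigD1 l) //= leq_addr.
Qed.

Lemma small_eigenspaces_le D J : (0 < J)%N -> (forall l, eigdim l <= D)%N ->
  (D * \sum_(l | 0 < eigdim l) q ^ (J * eigdim l) <= N * q ^ (J * D))%N.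
Proof.
move=> J0 eD; apply: leq_trans (sum_eigenspace_le (P := predT) J0 _) _ => [l _|]; first exact: eD.
by rewrite leq_mul2r sum_eigdim_le orbT.
Qed.

Lemma unit_eigenspaces_le D J : A \in unitmx -> (forall l, eigdim l <= D)%N ->
  (\sum_(l | 0 < eigdim l) q ^ (J * eigdim l) <= q.-1 * q ^ (J * D))%N.
Proof.
move=> uA eD.
have e0 : eigdim 0 = 0%N.
  by apply/eqP; rewrite mxrank_eq0 kermx_eq0 raddf0 subr0 row_free_unit.
rewrite -(cardC1 (0 : F)) -sum_nat_const [X in (_ <= X)%N]big_mkcond [X in (X <= _)%N]big_mkcond.
apply: leq_sum => l _; rewrite inE; case: (eqVneq l 0) => [-> | _]; first by rewrite e0.
by case: ifP => // _; rewrite leq_pexp2l ?leq_mul2l ?eD ?orbT // ltnW ?card_field_gt1.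
Qed.

End EigenspaceCounting.

(** * A sharper degree bound at level one *)

Section LevelOneDegree.
Variables (F : finFieldType) (n : nat).
Local Notation q := #|F|.
Local Notation N := n.-1.+1.
Local Notation G := (GLgroup_group n F).

Lemma sum_mult_degree (j : nat) (a : Iirr (GLgroup_group j F)) :
  \sum_(k : Iirr G) mult k a * chi1 k
   = #|GLgroup_group j F|%:R^-1 * \sum_(s : {'GL_j[F]}) tau_tens (1%g : {'GL_n[F]}) s * ('chi_a s)^*.
Proof.
pose f (g : {'GL_n[F]}) : algC := \sum_(s : {'GL_j[F]}) tau_tens g s * ('chi_a s)^*.
transitivity (\sum_(k : Iirr G) #|G|%:R^-1 * #|GLgroup_group j F|%:R^-1 *
    \sum_g f g * (chi1 k * 'chi_k g)^*).
  apply: eq_bigr => k _; rewrite /mult -[LHS]mulrA; congr (_ * _); rewrite mulr_suml.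
  apply: eq_bigr => g _; rewrite [X in _ = _ * X]rmorphM /= (geC0_conj (ltW (chi1_gt0 k))) /f !mulr_suml.
  by apply: eq_bigr => s _; move: (chi1 k) (_ ^*) (_ ^*) (tau_tens _ _) => c x y z; ring.
rewrite -mulr_sumr exchange_big /= -[LHS]mulrA [LHS]mulrCA; congr (_ * _).
under eq_bigr do rewrite -mulr_sumr -rmorph_sum sum_chi1_irr ?rmorphMn ?rmorph_nat //=.
rewrite (bigD1 1%g) //= eqxx mulr1n big1 ?addr0 => [|g /negPf->]; last by rewrite mulr0n mulr0.
by rewrite mulrCA conjC1 mulVf ?mulr1 ?card_group_neq0.
Qed.

(** The degree is at most that of [Dalpha], and [tau_tens 1 s] is q^N at s = 1 and 1 elsewhere, as a
    scalar other than 1 fixes only the zero matrix. This gains a factor of about q - 1 over the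
    bound q^N. *)
Lemma level_one_degree (i : Iirr G) (a : Iirr (GLgroup_group 1 F)) : mult i a != 0 ->
  (q%:R - 1) * chi1 i <= q%:R ^+ N + q%:R - 2%:R.
Proof.
move=> mi.
have S_ab : abelian (GLgroup_group 1 F).
  apply/centsP => x _ y _; suff E : GLval (x * y)%g = GLval (y * x)%g by exact: val_inj E.
  by rewrite -!GLvalM [GLval x]mx11_scalar [GLval y]mx11_scalar; exact: scalar_mxC.
have a1 s : `|'chi_a s| <= 1.
  have /(char_abelianP _)/(_ a)/lin_char1 <- := S_ab; exact: char1_ge_norm (irr_char a).
have m1 : 1 <= mult i a.
  have /natrP[m mE] := mult_nat i a; move: mi; rewrite mE pnatr_eq0 ler1n lt0n //.
have cS : #|GLgroup_group 1 F|%:R = q%:R - 1 :> algC.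
  by rewrite card_GL_1 -subn1 natrB // ltnW ?card_field_gt1.
have q1 : 0 < q%:R - 1 :> algC by rewrite subr_gt0 ltr1n card_field_gt1.
have tau1 (s : {'GL_1[F]}) : tau_tens (1%g : {'GL_n[F]}) s = q%:R ^+ N *+ (s == 1%g) + (s != 1%g)%:R.
  rewrite tau_tensE GLval1 trmx1; have [-> | s1] := eqVneq s 1%g.
    rewrite addr0 -natrX -[in RHS](muln1 N) -card_mx; congr (_%:R).
    by apply: eq_card => X; rewrite !inE GLval1 mul1mx mulmx1 eqxx.
  rewrite add0r (_ : [set _ | _] = [set 0]) ?cards1 //; apply/setP => X.
  rewrite !inE mul1mx [GLval s]mx11_scalar mul_mx_scalar.
  rewrite -{2}[X]scale1r -subr_eq0 -scalerBl scaler_eq0 subr_eq0.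
  rewrite (negPf (_ : _ != 1)) //; apply: contra s1 => /eqP s1; apply/eqP.
  suff E : GLval s = GLval 1%g by exact: val_inj E.
  by rewrite GLval1 [GLval s]mx11_scalar s1.
have ub : chi1 i <= #|GLgroup_group 1 F|%:R^-1 * \sum_s tau_tens (1%g : {'GL_n[F]}) s * ('chi_a s)^*.
  rewrite -sum_mult_degree (bigD1 i) //= -[X in X <= _]addr0 lerD //.
    by rewrite -[X in X <= _]mul1r ler_wpM2r // ltW ?chi1_gt0.
  apply: sumr_ge0 => k _; apply: mulr_ge0; [exact/natr_ge0/mult_nat | exact/ltW/chi1_gt0].
set Sg : algC := \sum_s _ in ub *.
rewrite cS ler_pdivlMl // in ub; have Sg0 : 0 <= Sg.
  by apply: le_trans ub; rewrite mulr_ge0 ?ltW ?chi1_gt0.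
apply: le_trans ub _; rewrite -(ger0_norm Sg0); apply: le_trans (ler_norm_sum _ _ _) _.
apply: (@le_trans _ _ (\sum_(s : {'GL_1[F]}) (q%:R ^+ N *+ (s == 1%g) + (s != 1%g)%:R))).
  apply: ler_sum => s _; rewrite normrM norm_conjC -tau1 ger0_norm ?ler0n //.
  by rewrite -[X in _ <= X]mulr1 ler_wpM2l ?ler0n.
rewrite big_split /= -addrA lerD //.
  by rewrite (bigD1 1%g) //= eqxx mulr1n big1 ?addr0 // => s /negPf->.
have : \sum_(s : {'GL_1[F]}) 1 = q%:R - 1 :> algC.
  by rewrite -cS -(sum_in_full (@GLT F 1)) sumr_const.
rewrite (bigD1 1%g) //= => /(canRL (addKr _)) E.
rewrite (bigD1 1%g) //= eqxx add0r (eq_bigr (fun=> 1)) => [|s ->] //.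
by rewrite E addrCA -opprD.
Qed.

End LevelOneDegree.

Section CharacterRatio.
Variables (F : finFieldType) (n j : nat).
Local Notation q := #|F|.
Local Notation N := n.-1.+1.
Local Notation J := j.-1.+1.
Local Notation G := (GLgroup_group n F).
Local Notation S := (GLgroup_group j F).
Implicit Types (i : Iirr G) (a : Iirr S) (g : {'GL_n[F]}).

(** The field is a parameter because the numerical estimates need a total order: they are proved in
    [rat] and carried to [algC] by [ratr]. *)
Definition ratio (R : fieldType) g : R :=
  #|invariant_frames j (GLval g)^T|%:R / #|frames F n j|%:R + (q%:R ^+ (N - J) - 1)^-1.

Lemma ratr_ratio g : ratr (ratio rat g) = ratio algC g.
Proof.
by rewrite /ratio rmorphD fmorph_div fmorphV rmorphB rmorphXn !rmorph_nat rmorph1.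
Qed.

Lemma ratio_ge0 g : 0 <= ratio algC g.
Proof.
rewrite addr_ge0 ?divr_ge0 ?ler0n // invr_ge0 subr_ge0 exprn_ege1 // ler1n.
by rewrite ltnW ?card_field_gt1.
Qed.

Local Notation eig g := (eigdim (GLval g)^T).
Local Notation b g := (\sum_(l | (0 < eig g l)%N) q ^ (J * eig g l))%N.
Local Notation c := (176%:R / 100%:R : algC).

Lemma invariant_frames_le g :
  (#|invariant_frames j (GLval g)^T| <= b g + q ^ J * ((q ^ J - q) * q ^ (N * J - N)))%N.
Proof. exact: card_invariant_frames. Qed.

Lemma frames_ge : (q ^ (N * J) <= #|frames F n j| + q ^ J * q ^ (N * J - N))%N.
Proof. exact: card_not_full. Qed.

Lemma c_ratr : ratr (176%:R / 100%:R) = c.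
Proof. by rewrite fmorph_div !rmorph_nat. Qed.

Lemma noncentral_ratio g : (3 * J ^ 2 + 3 * J + 5 <= 2 * N)%N ->
  (forall l, eig g l < N)%N -> ratio algC g * q%:R ^+ J < c.
Proof.
move=> JN eN; rewrite -ratr_ratio -c_ratr -[q%:R](ratr_nat algC) -rmorphXn -rmorphM ltr_rat.
apply: (noncentral_estimate _ (card_field_gt1 F) _ JN _ (invariant_frames_le g) frames_ge) => //.
exact: (@small_eigenspaces_le F N (GLval g)^T N.-1 J).
Qed.

Lemma small_level_ratio g X : (3 * J ^ 2 + J + 5 <= N)%N -> (X <= q ^ N)%N ->
  (100 * (b g ^ 2 * X) <= 228 * (q ^ (N * J)) ^ 2)%N -> ratio algC g ^+ 2 * X%:R < c ^+ 2.
Proof.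
move=> JN XN bX.
have := small_level_estimate rat (card_field_gt1 F) (ltn0Sn _) JN (invariant_frames_le g) frames_ge XN bX.
have E1 : ratr (ratio rat g ^+ 2 * X%:R) = ratio algC g ^+ 2 * X%:R.
  by rewrite [LHS]rmorphM rmorph_nat [in LHS]rmorphXn; congr (_ ^+ 2 * _); exact: ratr_ratio.
have E2 : ratr ((176%:R / 100%:R) ^+ 2) = c ^+ 2.
  by rewrite [LHS]rmorphXn; congr (_ ^+ 2); exact: c_ratr.
by rewrite -(ltr_rat algC) E1 E2.
Qed.

Lemma degree_le i : true_level 'chi_i = J -> chi1 i <= q%:R ^+ (N * J).
Proof.
move=> lJ; have [phi phiC phiE] := tau_character F n (true_level 'chi_i).
have iphi := tau_constt phiE; rewrite lJ in phiE.
apply: le_trans (char1_ge_constt phiC iphi) _.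
rewrite phiE exprM lerXn2r ?nnegrE ?exprn_ge0 ?ler0n // /tau_nat ?ler0n //.
by rewrite -natrX ler_nat leq_pexp2l ?rank_leq_row // ltnW ?card_field_gt1.
Qed.

End CharacterRatio.

Section ExponentialSquares.
Variables (q N J : nat).
Hypotheses (q_ge2 : (1 < q)%N) (J_gt0 : (0 < J)%N).
Local Notation Z := (q ^ (N * J))%N.

Lemma dominant_square D b : (N < 2 * D)%N -> (D < N)%N ->
  (b <= q ^ (J * D) + q ^ (J * (N - D)))%N ->
  (100 * (b ^ 2 * (q ^ (J * (N - D))) ^ 2) <= 228 * Z ^ 2)%N.
Proof.
move=> D2 DN; rewrite -expnMn.
have ZE : (Z = q ^ (J * D) * q ^ (J * (N - D)))%N.
  by rewrite -expnD -mulnDr subnKC 1?mulnC // ltnW.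
(* The smaller power of [q] is at most half the larger one, so [b] is at most 3/2 of the larger;
   (3/2)^2 = 2.25 is below 2.28. *)
have y2 : (2 * (q ^ (J * (N - D)) * q ^ (J * (N - D))) <= Z)%N.
  rewrite -expnD; apply: (@two_expn_le q q_ge2 _ 1).
  by rewrite -mulnDr mulnC addnC -[J in (_ + J)%N]mul1n; nia.
move: y2; rewrite ZE; move: (q ^ (J * (N - D)))%N (q ^ (J * D))%N => y w y2 bw.
have by3 : (2 * (b * y) <= 3 * (w * y))%N by nia.
have := leq_mul by3 by3; rewrite !(expnS, expn0, muln1); move: (b * y)%N (w * y)%N => u v.
by rewrite mulnACA (mulnACA 3); move: (u * u)%N (v * v)%N; clear; lia.
Qed.

Lemma half_square b : (4 <= N)%N -> (N./2 * b <= N * q ^ (J * N./2))%N -> (b ^ 2 <= 4 * Z)%N.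
Proof.
move=> N4 bN; have D0 : (0 < N./2 ^ 2)%N by rewrite expn_gt0 half_gt0; lia.
rewrite -(leq_pmul2l D0) -expnMn; apply: leq_trans (_ : (N * q ^ (J * N./2)) ^ 2 <= _)%N.
  by rewrite leq_sqr.
rewrite expnMn -expnM -mulnA.
(* For even [N] the factor N / N./2 is 2. For odd [N] its square is at most 8, and the factor q^J >=
   2 missing from the power of [q] compensates. *)
have NE : (N = odd N + N./2 * 2)%N by rewrite muln2 odd_double_half.
case: (odd N) NE => /= NE.
  have H : (2 ^ 1 * q ^ (J * (N./2 * 2)) <= Z)%N by apply: two_expn_le => //; nia.
  have H2 : (N ^ 2 <= 8 * N./2 ^ 2)%N by rewrite !(expnS, expn0, muln1); nia.
  by nia.
move: N./2 NE => m; rewrite add0n => NE; rewrite NE expnMn (mulnC J) -mulnA.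
by rewrite leqnn.
Qed.

End ExponentialSquares.

Section LevelBounds.
Variables (F : finFieldType) (n j : nat).
Local Notation q := #|F|.
Local Notation N := n.-1.+1.
Local Notation J := j.-1.+1.
Local Notation G := (GLgroup_group n F).
Local Notation S := (GLgroup_group j F).
Local Notation eig g := (eigdim (GLval g)^T).
Local Notation c := (176%:R / 100%:R : algC).
Variables (i : Iirr G) (a : Iirr S).
Hypotheses (ti : top_irr j i) (mi : mult i a != 0).
Implicit Types (g : {'GL_n[F]}).

Let c0 : 0 < c. Proof. by rewrite divr_gt0 ?ltr0n. Qed.

Let c1 : 1 < c. Proof. by rewrite ltr_pdivlMr ?ltr0n // mul1r ltr_nat. Qed.

Let lJ : true_level 'chi_i = J. Proof. exact: true_level_top ti mi. Qed.

Lemma irr_ge1 : 1 <= chi1 i.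
Proof.
have /natrP[m mE] := Cnat_irr1 i; rewrite /chi1 mE ler1n lt0n.
by rewrite -(eqr_nat algC) -mE; exact: chi1_neq0.
Qed.

Lemma noncentral_bound g : (3 * J ^ 2 + 3 * J + 5 <= 2 * N)%N -> (forall l, eig g l < N)%N ->
  `|'chi_i g| < c * rpow (chi1 i) (n.-1%:Q / N%:Q).
Proof.
move=> JN eN; have J2N : (2 * J <= N)%N by nia.
apply: le_lt_trans (char_bound J2N g ti mi) _; rewrite mulrC.
apply: (lt_rpow_ratio _ _ _ _ _ _ (noncentral_ratio JN eN)) => //.
- exact: chi1_gt0.
- exact: ratio_ge0.
- by rewrite exprn_ge0 ?ler0n.
by rewrite subSnn expr1 -exprM mulnC degree_le.
Qed.

Lemma level_one_double_degree (m : nat) : J = 1%N -> (2 < q)%N -> chi1 i = m%:R ->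
  (2 * m <= q ^ N + 3)%N.
Proof.
move=> J1 q2 mE.
have : (q%:R - 1) * chi1 i <= q%:R ^+ N + q%:R - 2%:R.
  by move: a mi J1; case: (j) => [|[|j']] // b mb _; exact: level_one_degree mb.
have -> : q%:R - 1 = q.-1%:R :> algC by rewrite -{1}(ltn_predK q2) -natr1 addrK.
rewrite mE lerBrDr -natrX -natrM -!natrD ler_nat.
by move: (q ^ N)%N => Z; nia.
Qed.

(** Let D be the largest eigenspace dimension over [F]; D = N is trivial. If D > N/2, the dominant
    eigenspace gives the exponent D/N, or 1 - 1/(2J) once q^(2J(N - D)) exceeds q^N. If D <= N/2,
    the eigenspace sum has square at most 4 q^(NJ), which leaves room for a degree bound X^J with X
    <= 0.57 q^(NJ). *)
Lemma small_level_bound g : (3 * J ^ 2 + J + 5 <= N)%N ->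
  `|'chi_i g| < c * rpow (chi1 i)
     (Num.max (1 - (2 * J)%:Q^-1) ((\max_l eig g l)%:Q / N%:Q)).
Proof.
move=> JN; have J2N : (2 * J <= N)%N by nia.
set D := \max_l _; set r1 := 1 - _; set r2 := D%:Q / _.
have r1ge0 : 0 <= r1.
  by rewrite subr_ge0 invf_le1 ?ltr0z // -[1]/(1%N%:Q) ler_int; lia.
have DN : (D <= N)%N by apply/bigop.bigmax_leqP => l _; exact: eigdim_le.
have r2ge0 : 0 <= r2 by rewrite divr_ge0 ?ler0z.
have rmono r : 0 <= r -> r <= Num.max r1 r2 -> `|'chi_i g| < c * rpow (chi1 i) r ->
    `|'chi_i g| < c * rpow (chi1 i) (Num.max r1 r2).
  move=> r0 rm lt; apply: lt_le_trans lt _; rewrite ler_pM2l //.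
  by apply: rpow_le => //; exact: irr_ge1.
have by_r1 : `|'chi_i g| < c * rpow (chi1 i) r1 -> `|'chi_i g| < c * rpow (chi1 i) (Num.max r1 r2).
  by apply: rmono; rewrite // le_max lexx.
have by_r2 : `|'chi_i g| < c * rpow (chi1 i) r2 -> `|'chi_i g| < c * rpow (chi1 i) (Num.max r1 r2).
  by apply: rmono; rewrite // le_max lexx orbT.
have x0 : 0 < chi1 i := chi1_gt0 i.
have bd := char_bound J2N g ti mi.
have /predU1P[DE | DltN] : (D == N) || (D < N)%N by rewrite -leq_eqVlt.
  apply: by_r2; apply: le_lt_trans (char1_ge_norm _ (irr_char i)) _.
  have r21 : r2 = 1%N%:Q / 1%N%:Q by rewrite /r2 DE !divff // intr_eq0.
  have := rpowX 1 0 (ltW x0); rewrite !expr1 -r21 => ->.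
  by rewrite ltr_pMl.
have F0 : (0 < #|F|)%N by rewrite ltnW ?card_field_gt1.
have [l0 l0D] : {l0 | D = eig g l0} := @bigop.eq_bigmax F (fun l : F => eig g l) F0.
have qN0 : 0 <= q%:R ^+ N :> algC by rewrite exprn_ge0 ?ler0n.
have root2 X : chi1 i <= X%:R ^+ J -> ratio j algC g ^+ 2 * X%:R < c ^+ 2 ->
    `|'chi_i g| < c * rpow (chi1 i) (Num.max r1 r2).
  move=> xX TX; apply: by_r1; apply: le_lt_trans bd _; rewrite mulrC.
  apply: (lt_rpow_root2 _ _ _ _ xX TX) => //; exact: ratio_ge0.
have xq : chi1 i <= (q ^ N)%:R ^+ J by rewrite natrX -exprM degree_le.
have [D2 | D2] := ltnP N (2 * D).
  pose y := (q ^ (J * (N - D)))%N.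
  have bD := dominant_eigenspace_le (A := (GLval g)^T) (l0 := l0) (ltn0Sn j.-1).
  rewrite -l0D in bD; have {bD} sq := dominant_square (card_field_gt1 F) (ltn0Sn _) D2 DltN (bD D2 DltN).
  have [small | large] := leqP (2 * (J * (N - D))) N.
    apply: by_r2; apply: le_lt_trans bd _; rewrite mulrC.
    have Ty : ratio j algC g * y%:R < c.
      have y2N : (y ^ 2 <= q ^ N)%N by rewrite -expnM leq_pexp2l ?(mulnC _ 2) // ltnW ?card_field_gt1.
      have := small_level_ratio JN y2N sq; rewrite natrX -exprMn.
      by rewrite ltr_pXn2r ?nnegrE ?(ltW c0) ?mulr_ge0 ?ler0n ?ratio_ge0.
    apply: (lt_rpow_ratio x0 _ c0 _ DN _ Ty); rewrite ?ler0n ?ratio_ge0 //.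
    apply: le_trans (_ : (q%:R ^+ (N * J)) ^+ (N - D) <= _).
      by rewrite lerXn2r ?nnegrE ?(ltW x0) ?exprn_ge0 ?ler0n ?degree_le.
    by rewrite natrX -!exprM -mulnA mulnC.
  apply: root2 xq _; apply: small_level_ratio JN (leqnn _) _.
  apply: leq_trans sq; rewrite !leq_mul2l -expnM leq_pexp2l ?(mulnC _ 2) ?(ltnW large) ?orbT //.
have bD (l : F) : (eig g l <= N./2)%N.
  by apply: leq_trans (bigop.leq_bigmax l) _; rewrite geq_half_double -mul2n.
have N9 : (9 <= N)%N.
  apply: leq_trans JN; apply: (@leq_add 4 5 _ 5) => //.
  by rewrite (@leq_add 3 1) // leq_pmulr // expn_gt0.
have b4 := half_square (card_field_gt1 F) (ltn0Sn j.-1) (leq_trans (isT : 4 <= 9)%N N9)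
  (small_eigenspaces_le (ltn0Sn j.-1) bD).
have sq X (XZ : (2 * X <= q ^ (N * J) + 3)%N) :
    (100 * ((\sum_(l | (0 < eig g l)%N) q ^ (J * eig g l)) ^ 2 * X) <= 228 * (q ^ (N * J)) ^ 2)%N.
  have Z9 : (32 <= q ^ (N * J))%N.
    apply: leq_trans (_ : 2 ^ 9 <= _)%N => //.
    apply: leq_trans (_ : 2 ^ (N * J) <= _)%N; last by rewrite leq_exp2r ?card_field_gt1.
    by rewrite leq_exp2l // (leq_trans N9) // leq_pmulr.
  move: b4 XZ Z9; move: (_ ^ 2)%N (q ^ (N * J))%N; clear => b Z b4 XZ Z9.
  apply: leq_trans (_ : 100 * (4 * Z * X) <= _)%N; first by rewrite leq_mul2l leq_mul2r b4 !orbT.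
  have -> : (100 * (4 * Z * X) = Z * (200 * (2 * X)))%N by ring.
  have -> : (228 * Z ^ 2 = Z * (228 * Z))%N by rewrite expnS expn1 mulnCA.
  rewrite leq_mul2l; apply/orP; right.
  lia.
(* For J >= 2, X = q^N is at most half of q^(NJ). For J = 1 the two are equal, so either the degree
   bound or the eigenspace sum has to be improved. *)
have [J1 | J1] := ltnP 1%N J.
  apply: root2 xq _; apply: small_level_ratio JN (leqnn _) _; apply: sq.
  apply: leq_trans (leq_addr _ _); apply: (@two_expn_le q (card_field_gt1 F) _ 1).
  apply: leq_trans (_ : N * 2 <= _)%N; last by rewrite leq_mul2l J1 orbT.
  by rewrite muln2 -addnn leq_add2r.
have {}J1 : J = 1%N by apply/eqP; rewrite eqn_leq J1.
have ZN : (q ^ (N * J) = q ^ N)%N by rewrite J1 muln1.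
have [q2 | q2] := ltnP 2 q.
  have /natrP[m mE] := Cnat_irr1 i.
  have mN : (m <= q ^ N)%N.
    by rewrite -(ler_nat algC) -mE natrX; apply: le_trans (degree_le lJ) _; rewrite J1 muln1.
  apply: (root2 m); first by rewrite J1 expr1 -mE.
  apply: small_level_ratio JN mN (sq _ _); rewrite ZN; exact: level_one_double_degree J1 q2 mE.
(* For q = 2 the only possible eigenvalue in [F] of an invertible matrix is 1, which removes the
   factor 4. *)
have {}q2 : q = 2%N by apply/eqP; rewrite eqn_leq q2 card_field_gt1.
apply: root2 xq _; apply: small_level_ratio JN (leqnn _) _.
have uA : (GLval g)^T \in unitmx by rewrite unitmx_tr GLval_unit.
have b1 := unit_eigenspaces_le J uA bD.
have b2 : ((\sum_(l | (0 < eig g l)%N) q ^ (J * eig g l)) ^ 2 <= q ^ (N * J))%N.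
  apply: leq_trans (_ : (q ^ (J * N./2)) ^ 2 <= _)%N.
    by rewrite leq_sqr; apply: leq_trans b1 _; rewrite q2 mul1n.
  rewrite -expnM leq_pexp2l ?(ltnW (card_field_gt1 F)) // mulnC mulnCA mulnC leq_mul2r.
  by rewrite mul2n -geq_half_double leqnn orbT.
rewrite -ZN expnS expn1; apply: leq_mul => //; exact: leq_mul.
Qed.

End LevelBounds.

(** * Levels and linear twists *)

Section TwistedLevel.
Variables (F : finFieldType) (n : nat).
Local Notation q := #|F|.
Local Notation N := n.-1.+1.
Local Notation G := (GLgroup_group n F).
Implicit Types (i k : Iirr G) (g h : {'GL_n[F]}).

Lemma true_level_uniq i m : tau_mult m 'chi_i != 0 -> (forall r : nat, (r < m)%N -> tau_mult r 'chi_i = 0) ->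
  true_level 'chi_i = m.
Proof.
move=> m0 mmin; have [l0 lmin] := true_levelP i; apply/eqP; rewrite eqn_leq.
apply/andP; split; rewrite leqNgt; apply/negP.
  by move/lmin/eqP; apply/negP.
by move/mmin/eqP; apply/negP.
Qed.

(** A linear twist that attains the minimum changes neither absolute values nor the degree. The
    default value 0 of [level] is never taken, since the trivial twist reaches the true level. *)
Lemma level_twist i : exists k, [/\ true_level 'chi_k = level 'chi_i,
  forall g, `|'chi_k g| = `|'chi_i g| :> algC & chi1 k = chi1 i].
Proof.
suff [m [lam [lin mE m0 mmin]]] : exists m, exists lam : Iirr G, [/\ 'chi_lam \is a linear_char,
    level 'chi_i = m, tau_mult m ('chi_lam * 'chi_i) != 0 &
    forall r, (r < m)%N -> tau_mult r ('chi_lam * 'chi_i) = 0].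
  have /irrP[k kE] := mul_lin_irr lin (mem_irr i); exists k.
  split; first by rewrite mE; apply: true_level_uniq; rewrite -kE.
  - by move=> g; rewrite -kE cfunE normrM (normC_lin_char lin (GLT g)) mul1r.
  - by rewrite /chi1 -kE cfunE (lin_char1 lin) mul1r.
rewrite /level; case: ClassicalEpsilon.excluded_middle_informative => [ex|no].
  case: ex_minnP => m /existsP[lam /andP[lin m0]] mmin; exists m, lam; split=> // r rm.
  apply/eqP; apply: contraTT rm => r0; rewrite -leqNgt; apply: mmin.
  by apply/existsP; exists lam; rewrite lin.
case: no; exists (true_level 'chi_i); apply/existsP; exists 0.
rewrite irr0 cfun1_lin_char mul1r /tconst; exact: (true_levelP i).1.
Qed.

Lemma true_level0 i : true_level 'chi_i = 0%N -> i = 0.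
Proof.
move=> l0; have [] := true_levelP i; rewrite l0 => H _; apply: contraNeq H => i0.
suff -> : tau_mult 0 'chi_i = '['chi[G]_0, 'chi_i] by rewrite cfdot_irr [0 == i]eq_sym (negPf i0).
rewrite cfdotE /tau_mult; congr (_ * _).
by apply: eq_bigr => g gG; rewrite irr0 cfun1E gG expr0.
Qed.

Lemma eigdim_tr (A : 'M[F]_N) l : eigdim A^T l = eigdim A l.
Proof.
by rewrite /eigdim !mxrank_ker -(mxrank_tr (A^T - _)) raddfB /= trmxK tr_scalar_mx.
Qed.

Lemma eigdim_le_delta g l : (eigdim (GLval g)^T l <= delta g)%N.
Proof.
rewrite eigdim_tr /delta; set L := sval _.
apply: leq_trans (bigop.leq_bigmax (in_alg L l : finvect_type L)).
by rewrite -map_scalar_mx -map_mxB -map_kermx mxrank_map.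
Qed.

Lemma noncentral_eigdim (H : {group {'GL_n[F]}}) g l :
  g \in (H :\: 'Z(H))%g -> (eigdim (GLval g)^T l < N)%N.
Proof.
rewrite inE => /andP[gZ gH]; rewrite ltn_neqAle eigdim_le andbT.
apply: contraNN gZ => /eqP /eigdim_full gl; rewrite inE gH; apply/centP => h _.
have {}gl : GLval g = l%:M by rewrite -[GLval g]trmxK gl tr_scalar_mx.
suff E : GLval (g * h)%g = GLval (h * g)%g by exact: val_inj E.
by rewrite -!GLvalM gl scalar_mxC.
Qed.

End TwistedLevel.

Section LevelConditions.
Implicit Types (l n : nat).

(** The order of [algC] is partial: a root that dominates some x >= 0 is real and nonnegative, so a
    negative radicand is excluded. *)
Lemma sqr_le_sqrtC (x z : algC) : 0 <= x -> x <= sqrtC z -> x ^+ 2 <= z.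
Proof.
move=> x0 xz; have s0 : 0 <= sqrtC z := le_trans x0 xz.
by rewrite -[X in _ <= X]sqrtCK lerXn2r ?nnegrE.
Qed.

(** Squaring l + 1/2 gives 12 l^2 + 12 l + 3 <= 8 n - 17. *)
Lemma level_condition1 l n : l%:R <= sqrtC (((8 * n)%:R - 17%:R) / 12%:R) - 2%:R^-1 :> algC ->
  (3 * l ^ 2 + 3 * l + 5 <= 2 * n)%N.
Proof.
rewrite lerBrDr => /sqr_le_sqrtC H.
have {H} := H (addr_ge0 (ler0n _ _) (_ : 0 <= 2%:R^-1)); rewrite invr_ge0 ler0n => /(_ isT).
rewrite ler_pdivlMr ?ltr0n // lerBrDr.
have -> : (l%:R + 2%:R^-1) ^+ 2 * 12%:R = (12 * l ^ 2 + 12 * l + 3)%N%:R :> algC.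
  by rewrite !natrD !natrM; field.
by rewrite -natrD ler_nat; lia.
Qed.

(** Squaring 6 l + 1 gives 36 l^2 + 12 l + 1 <= 12 n - 59. *)
Lemma level_condition2 l n : l%:R <= (sqrtC ((12 * n)%:R - 59%:R) - 1) / 6%:R :> algC ->
  (3 * l ^ 2 + l + 5 <= n)%N.
Proof.
rewrite ler_pdivlMr ?ltr0n // lerBrDr -natrM natr1 => /(sqr_le_sqrtC (ler0n _ _)).
by rewrite lerBrDr -natrX -natrD ler_nat; lia.
Qed.

Lemma rpow1 r : rpow 1 r = 1.
Proof. by rewrite /rpow rootC1 ?absz_gt0 ?denq_neq0 // exp1rz. Qed.

End LevelConditions.

Section GLBounds.
Variables (F : finFieldType) (n : nat).
Hypothesis n_gt0 : (0 < n)%N.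
Local Notation G := (GLgroup_group n F).
Local Notation c := (176%:R / 100%:R : algC).
Implicit Types (i : Iirr G) (g : {'GL_n[F]}).

Let nE : n.-1.+1 = n. Proof. exact: prednK. Qed.

Let c1 : 1 < c. Proof. by rewrite ltr_pdivlMr ?ltr0n // mul1r ltr_nat. Qed.

Let c0 : 0 < c. Proof. exact: lt_trans ltr01 c1. Qed.

(** A character of level 0 is linear, so both the absolute value and the power of the degree are
    1. *)
Lemma level0_bound i g r : level 'chi_i = 0%N -> `|'chi_i g| < c * rpow (chi1 i) r.
Proof.
move=> l0; have [k [kl <- <-]] := level_twist i.
have -> : k = 0 by apply: true_level0; rewrite kl l0.
by rewrite /chi1 irr0 !cfun1E group1 GLT normr1 rpow1 mulr1.
Qed.

Lemma GL_bound_noncentral i g : (3 * level 'chi_i ^ 2 + 3 * level 'chi_i + 5 <= 2 * n)%N ->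
  (forall l, eigdim (GLval g)^T l < n.-1.+1)%N ->
  `|'chi_i g| < c * rpow (chi1 i) (1 - n%:Q^-1).
Proof.
move=> ln ge; have [l0 | l0] := posnP (level 'chi_i); first exact: level0_bound.
have [k [kl <- <-]] := level_twist i; move: (level _) kl l0 ln => j kl j0 ln.
have jE := prednK j0; rewrite -jE in kl; have [ti [a mi]] := true_level_mult kl.
have JN : (3 * j.-1.+1 ^ 2 + 3 * j.-1.+1 + 5 <= 2 * n.-1.+1)%N by rewrite jE nE.
have -> : 1 - n%:Q^-1 = n.-1%:Q / n.-1.+1%:Q; last exact (noncentral_bound ti mi JN ge).
have nQ : n.-1.+1%:Q != 0 by rewrite intr_eq0.
apply: (mulIf nQ); rewrite divfK // -[in LHS]nE mulrBl mulVf // mul1r.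
by rewrite -[1]/(1%N%:Q) -intrB; congr (_%:~R); lia.
Qed.

Lemma GL_bound_delta i g : (3 * level 'chi_i ^ 2 + level 'chi_i + 5 <= n)%N ->
  `|'chi_i g| < c * rpow (chi1 i) (if level 'chi_i == 0%N then (delta g)%:Q / n%:Q
     else Num.max (1 - (2 * level 'chi_i)%:Q^-1) ((delta g)%:Q / n%:Q)).
Proof.
move=> ln; case: eqP => [l0 | /eqP l0]; first exact: level0_bound.
rewrite -lt0n in l0.
have [k [kl <- <-]] := level_twist i; move: (level _) kl l0 ln => j kl j0 ln.
have jE := prednK j0; rewrite -jE in kl; have [ti [a mi]] := true_level_mult kl.
have JN : (3 * j.-1.+1 ^ 2 + j.-1.+1 + 5 <= n.-1.+1)%N by rewrite jE nE.
apply: lt_le_trans (small_level_bound ti mi g JN) _.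
have -> : n%:Q = n.-1.+1%:Q by rewrite nE.
rewrite ler_pM2l // jE rpow_le //; first exact (irr_ge1 k).
  by rewrite le_max [X in _ || X]divr_ge0 ?ler0z ?orbT.
rewrite ge_max !le_max lexx /=; apply/orP; right.
rewrite ler_pM2r ?invr_gt0 ?ltr0z // ler_int lez_nat.
by apply/bigop.bigmax_leqP => l _; exact: eigdim_le_delta.
Qed.

End GLBounds.

(** * Restriction to the special linear group *)

Section SpecialLinear.
Variables (F : finFieldType) (n : nat).
Local Notation q := #|F|.
Local Notation N := n.-1.+1.
Local Notation G := (GLgroup_group n F).
Local Notation SL := (SLgroup F n).
Implicit Types (i k : Iirr G) (g h : {'GL_n[F]}) (m : nat).

(** Conjugate diag(d, 1, ..., 1) by a matrix whose first column w^T is killed by [Z]: the result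
    differs from 1 by a matrix with columns in the line of w^T. *)
Lemma exists_fixator_det m (Z : 'M[F]_(m, N)) (d : F) : (m < N)%N -> d != 0 ->
  exists2 h, Z *m GLval h = Z & \det (GLval h) = d.
Proof.
move=> mN d0.
have /rowV0Pn[w /sub_kermxP wZ w0] : kermx Z^T != 0.
  rewrite kermx_eq0 /row_free mxrank_tr neq_ltn.
  by rewrite (leq_ltn_trans (rank_leq_row Z) mN).
have [P uP wE] : exists2 P : 'M[F]_N, P \in unitmx & w^T = P *m delta_mx 0 0.
  apply/eqmxMunitP/andP; split; apply: (@submx_trans _ _ _ _ _ _ 1%:M); rewrite ?submx1 // sub1mx.
    by rewrite /row_full mxrank_delta.
  by rewrite /row_full mxrank_tr rank_rV w0.
pose D := diag_mx (\row_(l < N) (if l == 0 then d else 1)).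
have detD : \det D = d.
  rewrite det_diag (bigD1 0) //= mxE eqxx big1 ?mulr1 // => l l0.
  by rewrite mxE (negPf l0).
have uh : P *m D *m invmx P \in unitmx.
  by rewrite !unitmx_mul uP unitmx_inv uP unitmxE detD unitfE d0.
have [h hE] := exists_GL uh; exists h; rewrite hE; last first.
  by rewrite !det_mulmx det_inv detD mulrAC mulfV ?mul1r // -unitfE -unitmxE.
rewrite !mulmxA (_ : Z *m P *m D = Z *m P) ?mulmxK //.
apply/matrixP => a l; rewrite mul_mx_diag !mxE; case: eqP => [-> | _]; last by rewrite mulr1.
suff -> : \sum_j Z a j * P j 0 = 0 by rewrite mul0r.
have /matrixP/(_ a 0) : Z *m w^T = 0 by rewrite -[Z]trmxK -trmx_mul wZ trmx0.
rewrite wE !mxE => ZP; rewrite -[RHS]ZP; apply: eq_bigr => l' _; congr (_ * _).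
by rewrite -colE mxE.
Qed.

(** [tau ^ m] counts fixed matrices with [m] rows, and the fixator of each contains equally many
    elements of every nonzero determinant. *)
Lemma sum_tau_SL m : (m < N)%N ->
  \sum_(g in G) tau_nat g ^+ m = (q.-1)%:R * \sum_(g in SL) tau_nat g ^+ m.
Proof.
move=> mN.
have E (H : {set {'GL_n[F]}}) : \sum_(g in H) tau_nat g ^+ m
    = \sum_(Z : 'M[F]_(m, N)) #|[set g in H | Z *m GLval g == Z]|%:R :> algC.
  under eq_bigr do rewrite tau_natE -sum1_card natr_sum.
  rewrite (exchange_big_dep xpredT) //=; apply: eq_bigr => Z _.
  by rewrite -sum1_card natr_sum; apply: eq_bigl => g; rewrite !inE.
rewrite !E mulr_sumr; apply: eq_bigr => Z _; rewrite -natrM; congr (_%:R).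
rewrite -(cardC1 (0 : F)) -sum_nat_const -sum1_card.
rewrite (partition_big (fun g => \det (GLval g)) (fun d => d \in predC1 0)) => [|g _] /=; last first.
  by rewrite inE -unitfE -unitmxE GLval_unit.
apply: eq_bigr => d; rewrite inE => d0; rewrite sum1_card.
have [h hZ hd] := exists_fixator_det Z mN d0.
rewrite -[RHS](card_imset _ (mulgI h)); apply: eq_card => g.
rewrite -[g](mulKVg h) (mem_imset _ _ (mulgI h)); move: (h^-1 * g)%g => y.
rewrite -topredE /= !inE -GLvalM mulmxA hZ det_mulmx hd andbC; congr (_ && _).
by rewrite -{2}[d]mulr1 (inj_eq (mulfI d0)).
Qed.

Lemma card_GL_SL : #|G|%:R = q.-1%:R * #|SL|%:R :> algC.
Proof.
have := sum_tau_SL (ltn0Sn n.-1).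
under eq_bigr do rewrite expr0; under [in RHS]eq_bigr do rewrite expr0.
by rewrite !sumr_const.
Qed.

Lemma sum_tau_SL_avg m : (m < N)%N ->
  #|SL|%:R^-1 * \sum_(g in SL) tau_nat g ^+ m = #|G|%:R^-1 * \sum_(g in G) tau_nat g ^+ m.
Proof.
move=> mN; rewrite (sum_tau_SL mN) card_GL_SL invfM mulrACA mulVf ?mul1r //.
by rewrite pnatr_eq0 -lt0n -ltnS (ltn_predK (card_field_gt1 F)) card_field_gt1.
Qed.

End SpecialLinear.

Section Restriction.
Variables (gT : finGroupType) (G H : {group gT}).
Hypothesis GT : forall x, x \in G.

Let sHG : H \subset G. Proof. by apply/subsetP => x _; exact: GT. Qed.

Lemma cfdot_Res1_ge (theta : 'CF(G)) : theta \is a character ->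
  '[theta, 1] <= '['Res[H] theta, 1].
Proof.
move=> thC; rewrite {2}[theta]cfun_sum_cfdot linear_sum cfdot_suml (bigD1 0) //=.
rewrite linearZ cfdotZl /= irr0 cfRes_cfun1 // cfnorm1 mulr1 lerDl sumr_ge0 // => k _.
rewrite linearZ cfdotZl mulr_ge0 //=; apply/natr_ge0.
  by rewrite Cnat_cfdot_char ?irr_char.
by rewrite Cnat_cfdot_char ?cfun1_char ?cfRes_char ?irr_char.
Qed.

(* [theta |-> '['Res[H] theta, 1] - '[theta, 1]] is additive and nonnegative on characters, so it
   vanishes on every summand of a character on which it vanishes. *)
Lemma cfnorm_Res_constt (phi : 'CF(G)) i : phi \is a character -> i \in irr_constt phi ->
  '['Res[H] (phi * phi^*%CF), 1] = '[phi * phi^*%CF, 1] -> '['Res[H] 'chi_i] = 1.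
Proof.
move=> phiC /(constt_charP _ phiC)[psi psiC ->].
pose R := 'chi_i * psi^*%CF + psi * ('chi_i)^*%CF + psi * psi^*%CF.
have RC : R \is a character.
  by rewrite !rpredD // rpredM ?cfConjC_char ?irr_char.
have -> : ('chi_i + psi) * ('chi_i + psi)^*%CF = 'chi_i * ('chi_i)^*%CF + R.
  by rewrite rmorphD /= mulrDl !mulrDr /R !addrA.
move: R RC => R RC.
have AC : 'chi_i * ('chi_i)^*%CF \is a character by rewrite rpredM ?cfConjC_char ?irr_char.
have A1 : '['chi_i * ('chi_i)^*%CF, 1] = 1.
  rewrite -(cfnorm_irr i) !cfdotE; congr (_ * _); apply: eq_bigr => x xG.
  by rewrite cfun1E xG rmorph1 mulr1 !cfunE.
have <- : '['Res[H] ('chi_i * ('chi_i)^*%CF), 1] = '['Res[H] 'chi_i].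
  rewrite !cfdotE; congr (_ * _); apply: eq_bigr => x xH.
  by rewrite !cfResE // cfun1E xH rmorph1 mulr1 !cfunE.
rewrite linearD !cfdotDl /= => E; rewrite -A1; apply/le_anti.
rewrite cfdot_Res1_ge // andbT -(lerD2r '['Res[H] R, 1]) E lerD2l; exact: cfdot_Res1_ge.
Qed.
End Restriction.

Section SLRestriction.
Variables (F : finFieldType) (n : nat).
Local Notation N := n.-1.+1.
Local Notation G := (GLgroup_group n F).
Local Notation SL := (SLgroup F n).
Implicit Types (i k : Iirr G).

(** The squared modulus of [phi] is [tau ^ (2l)], whose averages over SL_n and GL_n agree. The norm
    of the restriction depends on absolute values only, so it may be computed for the twist, whose
    true level is the level [l]. *)
Lemma Res_SL_irr i : (2 * level 'chi_i < N)%N -> 'Res[SL] 'chi_i \in irr SL.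
Proof.
have [k [kl kn _]] := level_twist i; rewrite -kl => lN.
have [phi phiC phiE] := tau_character F n (true_level 'chi_k).
have kphi := tau_constt phiE.
have sSG : SL \subset G by apply/subsetP => x _; exact: GLT.
have phiphi g : (phi * phi^*%CF) g = tau_nat g ^+ (2 * true_level 'chi_k).
  by rewrite !cfunE phiE rmorphXn /= conj_tau_nat -exprD addnn mul2n.
have avg : '['Res[SL] (phi * phi^*%CF), 1] = '[phi * phi^*%CF, 1].
  rewrite !cfdotE; transitivity (#|SL|%:R^-1 * \sum_(g in SL) tau_nat g ^+ (2 * true_level 'chi_k)).
    congr (_ * _); apply: eq_bigr => g gS.
    by rewrite cfResE // phiphi cfun1E gS rmorph1 mulr1.
  rewrite sum_tau_SL_avg //; congr (_ * _); apply: eq_bigr => g gG.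
  by rewrite phiphi cfun1E gG rmorph1 mulr1.
have := cfnorm_Res_constt (@GLT F n) phiC kphi avg.
rewrite irrEchar cfRes_char ?irr_char //= => <-; apply/eqP.
rewrite !cfdotE; congr (_ * _); apply: eq_bigr => g gS.
by rewrite !cfResE // -!normCK kn.
Qed.
End SLRestriction.

Lemma constt_Res_SL (F : finFieldType) n (i : Iirr (GLgroup_group n F)) (p : Iirr (SLgroup F n)) :
  (2 * level 'chi_i < n)%N -> p \in irr_constt ('Res[SLgroup F n] 'chi_i) ->
  'chi_p = 'Res[SLgroup F n] 'chi_i.
Proof.
move=> ln; have /irrP[p' ->] : 'Res[SLgroup F n] 'chi_i \in irr (SLgroup F n).
  by apply: Res_SL_irr; rewrite prednK // (leq_ltn_trans _ ln).
by rewrite constt_irr => /eqP ->.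
Qed.

Theorem theorem1p5 (F : finFieldType) (n j : nat) (hj1 : (1 <= j)%N) (hjn : (j <= n)%N) :
  (* (i) *)
  (forall a : Iirr (GLgroup_group j F),
     (true_level 'chi_a < 2 * j - n)%N -> Dalpha n a != 0 ->
     forall i, i \in irr_constt (Dalpha n a) -> (true_level 'chi[GLgroup_group n F]_i < j)%N)
  (* (ii) *)
  /\ (forall a : Iirr (GLgroup_group j F),
     (2 * j - n <= true_level 'chi_a)%N ->
     exists! i : Iirr (GLgroup_group n F), Dcirc_prop n a i)
  (* (iii) (together with (ii)): alpha |-> D_alpha^circ is a bijection *)
  /\ (forall i : Iirr (GLgroup_group n F),
     true_level 'chi_i = j ->
     exists! a : Iirr (GLgroup_group j F),
       (2 * j - n <= true_level 'chi_a)%N /\ Dcirc_prop n a i)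
  (* (iv) *)
  /\ (forall i : Iirr (GLgroup_group n F),
       let chi := 'chi[GLgroup_group n F]_i in
       let l := level chi in
       ((l%:R <= sqrtC (((8 * n)%:R - 17%:R) / 12%:R) - 2%:R^-1 :> algC) ->
        forall g, g \in (GLgroup_group n F :\: 'Z(GLgroup_group n F))%g ->
          `|chi g| < (176%:R / 100%:R) * rpow (chi 1%g) (1 - n%:Q^-1))
       /\
       ((l%:R <= (sqrtC ((12 * n)%:R - 59%:R) - 1) / 6%:R :> algC) ->
        forall g, g \in GLgroup_group n F ->
          `|chi g| < (176%:R / 100%:R) *
            rpow (chi 1%g)
              (if l == 0%N then (delta g)%:Q / n%:Q
               else Num.max (1 - (2 * l)%:Q^-1) ((delta g)%:Q / n%:Q))))
  (* (v) *)
  /\ (forall (p : Iirr (SLgroup F n)) (i : Iirr (GLgroup_group n F)),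
       p \in irr_constt ('Res[SLgroup F n] 'chi[GLgroup_group n F]_i) ->
       let psi := 'chi[SLgroup F n]_p in
       let l := level 'chi[GLgroup_group n F]_i in
       ((l%:R <= sqrtC (((8 * n)%:R - 17%:R) / 12%:R) - 2%:R^-1 :> algC) ->
        forall g, g \in (SLgroup F n :\: 'Z(SLgroup F n))%g ->
          `|psi g| < (176%:R / 100%:R) * rpow (psi 1%g) (1 - n%:Q^-1))
       /\
       ((l%:R <= (sqrtC ((12 * n)%:R - 59%:R) - 1) / 6%:R :> algC) ->
        forall g, g \in SLgroup F n ->
          `|psi g| < (176%:R / 100%:R) *
            rpow (psi 1%g)
              (if l == 0%N then (delta g)%:Q / n%:Q
               else Num.max (1 - (2 * l)%:Q^-1) ((delta g)%:Q / n%:Q)))).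
Proof.
have n0 : (0 < n)%N := leq_trans hj1 hjn.
have sSG : SLgroup F n \subset GLgroup_group n F by apply/subsetP => x _; exact: GLT.
split=> [a la _|]; first exact: Dalpha_low_level.
split=> [a|]; first exact: exists_unique_Dcirc.
split=> [i|]; first exact: exists_unique_alpha.
split=> [i chi l | p i pi psi l].
  split=> [/level_condition1 ln g gZ | /level_condition2 ln g _].
    apply: GL_bound_noncentral => // l'; exact: noncentral_eigdim gZ.
  exact: GL_bound_delta.
split=> [/level_condition1 ln g gZ | /level_condition2 ln g gS].
  (* Either quadratic condition gives 2l < n, so the constituent is the whole restriction and has
     the values and the degree of ['chi_i]. *)
  have l2n : (2 * level 'chi_i < n)%N by move: ln; rewrite -/l; nia.
  have gS : g \in SLgroup F n by case/setDP: gZ.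
  rewrite /psi (constt_Res_SL l2n pi) !cfResE //.
  apply: GL_bound_noncentral => // l'; exact: noncentral_eigdim gZ.
have l2n : (2 * level 'chi_i < n)%N by move: ln; rewrite -/l; nia.
rewrite /psi (constt_Res_SL l2n pi) !cfResE //; exact: GL_bound_delta.
Qed.
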